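(* There is an algorithm for Steiner Forest Enumeration with $O(nm)$ delay and $O(n+m)$ space, where $n$ and $m$ are the numbers of vertices and edges of the input graph.
   Context: Steiner Forest Enumeration: given an undirected graph $G=(V,E)$ and terminal sets $W_1,\dots,W_s\subseteq V$, output, each exactly once, all minimal Steiner forests, i.e., all inclusion-minimal subgraphs of $G$ in which, for each $i$, there is a path between every pair of vertices of $W_i$. The delay of an enumeration algorithm is the maximum running time between two consecutive outputs, including before the first and after the last output. Space is counted in words of $O(\log n)$ bits.
   Formalization: The time before the first output is O(nm + s + Σ|W_i|), as the terminal sets must be read; all other delays are O(nm). Words have O(log(n+m+s+Σ|W_i|)) bits, and in nm a zero factor counts as 1. Space is work memory beside read-only input. *)

(* Defs.v *)
From mathcomp Require Import all_boot.

Set Implicit Arguments.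
Unset Strict Implicit.
Unset Printing Implicit Defensive.

(** * Minimal Steiner forests *)

(** An instance as it is presented to an algorithm: a finite simple graph on
    [{0, .., n-1}] given by the list of its edges, each with its two ends in an
    arbitrary order, and terminal sets [W_1, .., W_s] given by duplicate-free
    lists.  The terminal sets may be empty, overlap or be repeated. *)
Record instance := Instance {
  nv : nat;
  elist : seq ('I_nv * 'I_nv);
  tlist : seq (seq 'I_nv);
  _ : all (fun e => e.1 != e.2) elist;
  _ : uniq [seq [set e.1; e.2] | e <- elist];
  _ : all uniq tlist }.

Section SteinerForests.
Variable I : instance.

Definition ne : nat := size (elist I).

Definition edges : seq {set 'I_(nv I)} := [seq [set e.1; e.2] | e <- elist I].

Definition terminals : seq {set 'I_(nv I)} := [seq [set:: t] | t <- tlist I].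

(** [s + |W_1| + .. + |W_s|], the length of the description of the terminal
    sets. *)
Definition termsize : nat := sumn [seq (size t).+1 | t <- tlist I].

(** A vertex set and an edge set. *)
Definition pregraph : Type := ({set 'I_(nv I)} * {set {set 'I_(nv I)}})%type.

Definition is_subgraph (H : pregraph) : bool :=
  [forall e in H.2, (e \in edges) && (e \subset H.1)].

Definition adjacent (H : pregraph) : rel 'I_(nv I) :=
  [rel u v | [set u; v] \in H.2].

Definition joined (H : pregraph) (u v : 'I_(nv I)) : bool :=
  [&& u \in H.1, v \in H.1 & connect (adjacent H) u v].

Definition steiner_forest (H : pregraph) : bool :=
  is_subgraph H &&
  all (fun W : {set 'I_(nv I)} => [forall u in W, forall v in W, joined H u v])
      terminals.

Definition included (K H : pregraph) : bool :=
  (K.1 \subset H.1) && (K.2 \subset H.2).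

Definition minimal_steiner_forest (H : pregraph) : bool :=
  steiner_forest H &&
  [forall K : pregraph, steiner_forest K && included K H ==> (K == H)].

(** The words describing a subgraph: [v] for the vertex [v], and [n + j] for the
    [j]-th edge of the input list. *)
Definition codes (H : pregraph) : seq nat :=
  [seq val v | v <- enum H.1] ++
  [seq nv I + j | j <- iota 0 ne & nth set0 edges j \in H.2].

Definition input_words : seq nat :=
  [:: nv I, ne
    & flatten [seq [:: val e.1; val e.2] | e <- elist I]
      ++ size (tlist I)
         :: flatten [seq size t :: [seq val v | v <- t] | t <- tlist I]].

End SteinerForests.

(** * Word RAM *)

(** Finitely many registers, a read-only input, a read-write memory, and a
    write-only output.  All values are words; [Sub] is truncated, the other
    operations wrap around. *)

Inductive binop := Add | Sub | Mul | Div | Mod | Eq | Lt.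

Inductive expr :=
  | Cst of nat
  | Reg of nat
  | Inp of expr
  | Mem of expr
  | Bin of binop & expr & expr.

Inductive program :=
  | Skip
  | Set_ of nat & expr
  | Store of expr & expr
  | Emit of expr
  | Deliver
  | Seq of program & program
  | If of expr & program & program
  | While of expr & program.

Record machine := Machine {
  wbits : nat;           (* word length in bits *)
  mcells : nat;          (* number of words of the memory *)
  minput : seq nat }.

Record state := State { regs : nat -> nat; mem : nat -> nat }.

Definition init : state := State (fun=> 0) (fun=> 0).

Definition upd (f : nat -> nat) (a v : nat) : nat -> nat :=
  fun b => if b == a then v else f b.

Definition binop_sem (o : binop) (a b : nat) : nat :=
  match o with
  | Add => a + b
  | Sub => a - b
  | Mul => a * b
  | Div => a %/ b
  | Mod => a %% b
  | Eq => a == b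
  | Lt => a < b
  end.

Definition word (M : machine) (a : nat) : nat := a %% 2 ^ wbits M.

(** [None] is an access out of the bounds of the input or of the memory. *)
Fixpoint eval (M : machine) (st : state) (e : expr) : option nat :=
  match e with
  | Cst k => Some (word M k)
  | Reg x => Some (regs st x)
  | Inp e1 =>
      if eval M st e1 is Some a then
        if a < size (minput M) then Some (word M (nth 0 (minput M) a)) else None
      else None
  | Mem e1 =>
      if eval M st e1 is Some a then
        if a < mcells M then Some (mem st a) else None
      else None
  | Bin o e1 e2 =>
      if eval M st e1 is Some a then
        if eval M st e2 is Some b then Some (word M (binop_sem o a b)) else None
      else None
  end.

Fixpoint esize (e : expr) : nat :=
  match e with
  | Cst _ | Reg _ => 1
  | Inp e1 | Mem e1 => (esize e1).+1
  | Bin _ e1 e2 => (esize e1 + esize e2).+1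
  end.

(** What a run does in each unit of time: an internal step, appending a word to
    the solution being written, or completing that solution. *)
Inductive action := Tick | Put of nat | Out.

(** Evaluating an expression takes one unit of time per node. *)
Definition ticks (e : expr) : seq action := nseq (esize e) Tick.

(** [exec M p st t st']: from [st], [p] terminates without fault in [st'], and
    [t] is its trace; its running time is [size t]. *)
Inductive exec (M : machine) :
    program -> state -> seq action -> state -> Prop :=
  | ExecSkip st : exec M Skip st [:: Tick] st
  | ExecSet st x e v :
      eval M st e = Some v ->
      exec M (Set_ x e) st (rcons (ticks e) Tick)
           (State (upd (regs st) x v) (mem st))
  | ExecStore st e1 e2 a v :
      eval M st e1 = Some a -> a < mcells M -> eval M st e2 = Some v ->
      exec M (Store e1 e2) st (rcons (ticks e1 ++ ticks e2) Tick)
           (State (regs st) (upd (mem st) a v))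
  | ExecEmit st e v :
      eval M st e = Some v ->
      exec M (Emit e) st (rcons (ticks e) (Put v)) st
  | ExecDeliver st : exec M Deliver st [:: Out] st
  | ExecSeq st1 st2 st3 p q t1 t2 :
      exec M p st1 t1 st2 -> exec M q st2 t2 st3 ->
      exec M (Seq p q) st1 (t1 ++ t2) st3
  | ExecIf st st' e v p q t :
      eval M st e = Some v ->
      exec M (if v != 0 then p else q) st t st' ->
      exec M (If e p q) st (rcons (ticks e) Tick ++ t) st'
  | ExecWhileEnd st e p :
      eval M st e = Some 0 ->
      exec M (While e p) st (rcons (ticks e) Tick) st
  | ExecWhile st1 st2 st3 e v p t1 t2 :
      eval M st1 e = Some v -> v != 0 ->
      exec M p st1 t1 st2 -> exec M (While e p) st2 t2 st3 ->
      exec M (While e p) st1 (rcons (ticks e) Tick ++ t1 ++ t2) st3.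

Lemma exec_det M p st t1 st1 t2 st2 :
  exec M p st t1 st1 -> exec M p st t2 st2 -> t1 = t2 /\ st1 = st2.
Proof.
move=> H; elim: H t2 st2 => {p st t1 st1}.
all: intros; match goal with H : exec _ _ _ ?t2 ?st2 |- _ = ?t2 /\ _ = ?st2 =>
  inversion H; subst end.
all: repeat match goal with
  | A : eval ?M ?s ?e = Some _, B : eval ?M ?s ?e = Some _ |- _ =>
      rewrite A in B; case: B => ?; subst; clear A
  | IH : forall t s, exec ?M ?p ?s1 t s -> _, A : exec ?M ?p ?s1 _ _ |- _ =>
      case: (IH _ _ A) => ? ?; subst; clear IH
  end.
all: by [].
Qed.

(** The trace cut at its [Out] actions.  The last segment, always present, is
    what follows the last output. *)
Fixpoint segments (t : seq action) : seq (seq action) :=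
  match t with
  | [::] => [:: [::]]
  | Out :: t' => [::] :: segments t'
  | a :: t' => (a :: head [::] (segments t')) :: behead (segments t')
  end.

Definition puts (t : seq action) : seq nat :=
  pmap (fun a => if a is Put v then Some v else None) t.

Definition outputs (t : seq action) : seq (seq nat) :=
  [seq puts s | s <- take (size (segments t)).-1 (segments t)].

(** Running times up to the first output, between consecutive outputs, and from
    the last output to termination. *)
Definition gaps (t : seq action) : seq nat :=
  [seq (size s).+1 | s <- segments t].

Definition enumerates (I : instance) (t : seq action) : Prop :=
  puts (last [::] (segments t)) = [::] /\
  exists Hs : seq (pregraph I),
    [/\ uniq Hs,
        forall H, (H \in Hs) = minimal_steiner_forest H
      & all2 (fun ws H => perm_eq ws (codes H)) (outputs t) Hs].

(** Bits needed to write the numbers up to [n + m + termsize]; this is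
    [O(log n)] as soon as [termsize] is polynomial in [n]. *)
Definition logsize (I : instance) : nat :=
  (trunc_log 2 (nv I + ne I + termsize I)).+1.

(** [n * m], except that a graph without edges is charged [n] (and the empty
    graph [1]) instead of [0]. *)
Definition nm (I : instance) : nat := maxn 1 (nv I) * maxn 1 (ne I).

(* Main.v *)
Require Import Defs.
From mathcomp Require Import all_boot zify.
Import Defs.

(** Only the equivalence relation generated by the terminal sets matters; if
    [rep v] is a representative of the class of [v], the demands are the pairs
    [(v, rep v)].  Let [E] be the set of edges chosen so far, [i] the first
    vertex with an unsatisfied demand and [B] its component in [E].  The path
    from [i] to [rep i] is built arc by arc: the next arc leaves [B] from the
    component [tp] reached last (from all of [B] if the path is just begun)
    and its head must be connected to [rep i] outside [B].  Every edge of [E]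
    then separates the ends of a satisfied demand, or [i] from [tp], so [E] is
    a forest, and it is a minimal solution once all demands are satisfied.
    Such an arc always exists.  Conversely, a minimal solution [T] containing
    [E] leaves [B] by exactly one arc towards [rep i], since a second one would
    be superfluous; so the leaves of this search tree are the minimal
    solutions, each found once.

    The state of the search is the stack of chosen arcs, of size at most
    [min n m].  Everything else is recomputed at each node from component labels
    of [E] and of the graph minus [B], in time [O(n + m)]; going from a leaf to
    the next one visits [O(min n m)] nodes, whence the delay [O(nm)].  In the
    preprocessing, classes are merged only within a component of the graph, so
    there are [O(m)] merges, each in time [O(n)]. *)

(** The tip [tp] serves minimality: if the path could resume anywhere in the block, the last arc
    might become a useless branch. With it, the block of an unfinished path is the block of the
    parent together with the new tip, and the head of the last arc still reaches [rep i] outside the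
    former. This fact gives the next arc, in [G] as well as in any solution below the node, so the
    search has no dead ends and a delay consists of one climb and one descent. The depth is at most
    [n], since each arc merges two components, and at most [m], since the edges are distinct;
    [minn n m * (n + m)] is at most [2nm]. Linear space forbids saving labels for each level. A node
    is rebuilt by two traversals: one with the top edge removed, which yields the labels of the
    parent and, after merging two of them, those of the node; and one of the graph outside the
    block. In the preprocessing, a bound of [n] merges would be too weak when [m] is much smaller
    than [n]; counting only vertices with an edge gives [2m]. *)

Set Implicit Arguments.
Unset Strict Implicit.
Unset Printing Implicit Defensive.

(** * Reasoning about programs *)

(** Sixteen interleaved arrays: no base address has to be computed, and stores to
    distinct arrays never interfere. *)
Definition cell (k : nat) (e : expr) : expr :=
  Bin Add (Bin Mul e (Cst 16)) (Cst k).
Definition Arr (k : nat) (e : expr) : expr := Mem (cell k e).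
Definition StoreA (k : nat) (e v : expr) : program := Store (cell k e) v.
Definition arr (st : state) (k i : nat) : nat := mem st (i * 16 + k).

Definition setr (st : state) (x v : nat) : state :=
  State (upd (regs st) x v) (mem st).
Definition seta (st : state) (k i v : nat) : state :=
  State (regs st) (upd (mem st) (i * 16 + k) v).

Lemma regs_setr st x v y : regs (setr st x v) y = if y == x then v else regs st y.
Proof. by []. Qed.
Lemma regs_seta st k i v y : regs (seta st k i v) y = regs st y.
Proof. by []. Qed.
Lemma arr_setr st x v k i : arr (setr st x v) k i = arr st k i.
Proof. by []. Qed.
Lemma arr_seta st k i v k' j : k < 16 -> k' < 16 ->
  arr (seta st k i v) k' j = if (k' == k) && (j == i) then v else arr st k' j.
Proof.
move=> hk hk'; rewrite /arr /= /upd.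
by have -> : (j * 16 + k' == i * 16 + k) = ((k' == k) && (j == i)) by lia.
Qed.

Definition wmax (M : machine) : nat := 2 ^ wbits M.

Lemma wordE M a : a < wmax M -> word M a = a.
Proof. exact: modn_small. Qed.

(** * What a run leaves unchanged *)

Section Frame.

(** Only the registers [rs] and the arrays [ks] may differ. The guard [k < 16] is there because
    [arr] with a larger array number aliases the cells of another array. *)
Definition fr (rs ks : seq nat) (st st' : state) : Prop :=
  (forall x, x \notin rs -> regs st' x = regs st x) /\
  (forall k i, k \notin ks -> k < 16 -> arr st' k i = arr st k i).

Lemma fr_refl rs ks st : fr rs ks st st.
Proof. by []. Qed.

Lemma fr_trans rs ks st1 st2 st3 :
  fr rs ks st1 st2 -> fr rs ks st2 st3 -> fr rs ks st1 st3.
Proof.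
move=> [r1 a1] [r2 a2]; split=> [x hx|k i hk k16]; first by rewrite r2 ?r1.
by rewrite a2 ?a1.
Qed.

Lemma fr_sub rs ks rs' ks' st st' :
  fr rs ks st st' -> {subset rs <= rs'} -> {subset ks <= ks'} ->
  fr rs' ks' st st'.
Proof.
move=> [r a] sr sk; split=> [x hx|k i hk k16].
  by apply: r; apply: contra hx; apply: sr.
by apply: a => //; apply: contra hk; apply: sk.
Qed.

Lemma fr_weak rs ks rs' ks' st st' :
  fr rs ks st st' -> all (fun x => x \in rs') rs -> all (fun k => k \in ks') ks ->
  fr rs' ks' st st'.
Proof. by move=> f /allP h1 /allP h2; apply: fr_sub f h1 h2. Qed.

Fixpoint wr (p : program) : seq nat :=
  match p with
  | Set_ x _ => [:: x]
  | Seq p q => wr p ++ wr q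
  | If _ p q => wr p ++ wr q
  | While _ p => wr p
  | _ => [::]
  end.

(** Recognizes the addresses built by [cell], so that the arrays a program may write can be read off
    its text. *)
Definition cellid (e : expr) : option nat :=
  if e is Bin Add (Bin Mul _ (Cst c)) (Cst k) then
    if (c == 16) && (k < 16) then Some k else None
  else None.

Fixpoint wa (p : program) : seq nat :=
  match p with
  | Store e _ => if cellid e is Some k then [:: k] else [::]
  | Seq p q => wa p ++ wa q
  | If _ p q => wa p ++ wa q
  | While _ p => wa p
  | _ => [::]
  end.

Fixpoint okp (p : program) : bool :=
  match p with
  | Store e _ => cellid e != None
  | Seq p q => okp p && okp q
  | If _ p q => okp p && okp q
  | While _ p => okp p
  | _ => true
  end.

Variable M : machine.
Hypothesis W16 : 16 %| wmax M.

(** Wrapping around keeps residues modulo 16, hence a store never leaves its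
    array. *)
Lemma eval_cell st e a k :
  cellid e = Some k -> eval M st e = Some a -> a %% 16 = k.
Proof.
case: e => // -[] // -[] // -[] // e [] // c [] // k' /=.
case: ifP => // /andP[/eqP-> k16] [<-].
case: (eval M st e) => // b [<-]; rewrite /word -/(wmax M).
rewrite modn_dvdm // -modnDm modn_dvdm // modn_dvdm // modnDmr.
rewrite -modnMmr (modn_dvdm _ W16) modnn muln0 mod0n add0n.
by rewrite (modn_small k16).
Qed.

(** Register names are literal and a store address is congruent to its array number modulo 16, so
    the frame depends on the program text alone. Correctness lemmas therefore need not list what is
    preserved. *)
Lemma exec_fr p st t st' : exec M p st t st' -> okp p -> fr (wr p) (wa p) st st'.
Proof.
elim=> {p st t st'} //=.
- move=> st x e v _ _; split=> // y; rewrite inE => /negbTE ne.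
  by rewrite /= /upd ne.
- move=> st e1 e2 a v ev1 _ _; case ce: (cellid e1) => [k|] // _.
  have am := eval_cell ce ev1; split=> // k' i; rewrite inE => ne k16.
  rewrite /arr /= /upd; case: eqP => // /(congr1 (modn^~ 16)).
  by rewrite am modnMDl modn_small // => kk; rewrite kk eqxx in ne.
- move=> st1 st2 st3 p q t1 t2 _ IH1 _ IH2 /andP[/IH1 f1 /IH2 f2].
  apply: fr_trans; [apply: fr_sub f1 _ _|apply: fr_sub f2 _ _] => x hx;
  by rewrite mem_cat hx ?orbT.
- move=> st st' e v p q t _ _ IH /andP[ok1 ok2].
  by case: ifP IH => _ /(_ _) IH; (apply: fr_sub (IH _) _ _ => // x hx;
     rewrite mem_cat hx ?orbT).
- move=> st1 st2 st3 e v p t1 t2 _ _ _ IH1 _ IH2 ok.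
  exact: fr_trans (IH1 ok) (IH2 ok).
Qed.

End Frame.

(** A silent run completes no solution, so it lies within a single gap; it may still write words. *)
Definition silent (a : action) : bool := if a is Out then false else true.

(** * A program logic with time bounds *)

Section Logic.

Variable M : machine.

Notation W := (wmax M).

Definition ev (st : state) (e : expr) (v : nat) : Prop := eval M st e = Some v.

Lemma ev_cst st k : k < W -> ev st (Cst k) k.
Proof. by move=> h; rewrite /ev /= wordE. Qed.
Lemma ev_reg st x : ev st (Reg x) (regs st x).
Proof. by []. Qed.
Lemma ev_bin st o e1 e2 a b : ev st e1 a -> ev st e2 b ->
  binop_sem o a b < W -> ev st (Bin o e1 e2) (binop_sem o a b).
Proof. by rewrite /ev /= => -> -> h; rewrite wordE. Qed.
Lemma ev_inp st e a : ev st e a -> a < size (minput M) -> nth 0 (minput M) a < W ->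
  ev st (Inp e) (nth 0 (minput M) a).
Proof. by rewrite /ev /= => -> -> h; rewrite wordE. Qed.

Definition runp (p : program) (st : state) (T : nat)
    (Q : seq nat -> state -> Prop) : Prop :=
  exists t st', [/\ exec M p st t st', all silent t, size t <= T & Q (puts t) st'].

Definition run (p : program) (st : state) (T : nat) (Q : state -> Prop) : Prop :=
  runp p st T (fun ws st' => ws = [::] /\ Q st').

Lemma puts_cat t1 t2 : puts (t1 ++ t2) = puts t1 ++ puts t2.
Proof. exact: pmap_cat. Qed.
Lemma puts_ticks e : puts (ticks e) = [::].
Proof. by rewrite /ticks; elim: (esize e). Qed.
Lemma puts_tick e : puts (rcons (ticks e) Tick) = [::].
Proof. by rewrite -cats1 puts_cat puts_ticks. Qed.
Lemma silent_ticks e : all silent (ticks e).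
Proof. by rewrite /ticks; elim: (esize e). Qed.
Lemma silent_tick e : all silent (rcons (ticks e) Tick).
Proof. by rewrite all_rcons silent_ticks. Qed.
Lemma size_ticks e : size (ticks e) = esize e.
Proof. exact: size_nseq. Qed.

Lemma runp_le p st T T' (Q Q' : seq nat -> state -> Prop) :
  runp p st T Q -> T <= T' -> (forall w s, Q w s -> Q' w s) -> runp p st T' Q'.
Proof.
move=> [t [st' [h q le QQ]]] leT imp; exists t, st'; split=> //; last exact: imp.
exact: leq_trans le leT.
Qed.

Lemma run_le p st T T' (Q Q' : state -> Prop) :
  run p st T Q -> T <= T' -> (forall s, Q s -> Q' s) -> run p st T' Q'.
Proof. by move=> r le imp; apply: runp_le r le _ => w s [-> /imp]. Qed.

Lemma run_skip st (Q : state -> Prop) : Q st -> run Skip st 1 Q.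
Proof. by move=> q; exists [:: Tick], st; split=> //; constructor. Qed.

Lemma run_set st x e v (Q : state -> Prop) :
  ev st e v -> Q (setr st x v) -> run (Set_ x e) st (esize e).+1 Q.
Proof.
move=> h q; exists (rcons (ticks e) Tick), (setr st x v).
split; rewrite ?silent_tick ?size_rcons ?size_ticks ?puts_tick //.
exact: ExecSet.
Qed.

Lemma runp_emit st e v (Q : seq nat -> state -> Prop) :
  ev st e v -> Q [:: v] st -> runp (Emit e) st (esize e).+1 Q.
Proof.
move=> h q; exists (rcons (ticks e) (Put v)), st.
split; rewrite ?size_rcons ?size_ticks //; first exact: ExecEmit.
  by rewrite all_rcons silent_ticks.
by rewrite -cats1 puts_cat puts_ticks.
Qed.

Lemma runp_seq p q st T1 T2 Q :
  runp p st T1 (fun w1 s => runp q s T2 (fun w2 => Q (w1 ++ w2))) ->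
  runp (Seq p q) st (T1 + T2) Q.
Proof.
move=> [t1 [s1 [h1 q1 le1 [t2 [s2 [h2 q2 le2 QQ]]]]]].
exists (t1 ++ t2), s2; split; first exact: ExecSeq h1 h2.
- by rewrite all_cat q1.
- by rewrite size_cat leq_add.
- by rewrite puts_cat.
Qed.

Lemma run_seq p q st T1 T2 Q :
  run p st T1 (fun s => run q s T2 Q) -> run (Seq p q) st (T1 + T2) Q.
Proof.
move=> h; apply: runp_seq; apply: runp_le h _ _ => // w s [-> r].
exact: r.
Qed.

(** Charging both branches loses only a constant factor and keeps maxima out of the time bounds,
    which are mostly inferred by unification. *)
Lemma runp_if st e v p q T1 T2 Q : ev st e v ->
  (v != 0 -> runp p st T1 Q) -> (v = 0 -> runp q st T2 Q) ->
  runp (If e p q) st ((esize e).+1 + (T1 + T2)) Q.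
Proof.
move=> h hp hq.
have [t [s [ex qt le QQ]]] : runp (if v != 0 then p else q) st (T1 + T2) Q.
  case: ifPn => [/hp|/negPn/eqP/hq] r; apply: runp_le r _ _ => //; lia.
exists (rcons (ticks e) Tick ++ t), s; split; first exact: ExecIf h ex.
- by rewrite all_cat silent_tick.
- by rewrite size_cat size_rcons size_ticks; lia.
- by rewrite puts_cat puts_tick.
Qed.

Lemma run_if st e v p q T1 T2 Q : ev st e v ->
  (v != 0 -> run p st T1 Q) -> (v = 0 -> run q st T2 Q) ->
  run (If e p q) st ((esize e).+1 + (T1 + T2)) Q.
Proof. exact: runp_if. Qed.

(** [P] bounds the time that remains: an amortized while rule. *)
Lemma runp_while (inv : nat -> seq nat -> state -> Prop)
    (Q : seq nat -> state -> Prop) e body :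
  (forall P w s, inv P w s -> exists v, [/\ ev s e v, v = 0 -> Q w s
     & v != 0 -> exists T, runp body s T (fun w' s' =>
         exists P', inv P' (w ++ w') s' /\ T + (esize e).+1 + P' <= P)]) ->
  forall P w s, inv P w s ->
  runp (While e body) s (P + (esize e).+1) (fun w' s' => Q (w ++ w') s').
Proof.
move=> H P; elim/ltn_ind: P => P IH w s /H [v [hv h0 h1]].
have [v0|vn] := eqVneq v 0.
  exists (rcons (ticks e) Tick), s; split.
  - by apply: ExecWhileEnd; rewrite -v0.
  - exact: silent_tick.
  - by rewrite size_rcons size_ticks; lia.
  - by rewrite puts_tick cats0; apply: h0.
have [T [t1 [s1 [ex1 q1 le1 [P' [inv' leP]]]]]] := h1 vn.
have ltP : P' < P by lia.
have [t2 [s2 [ex2 q2 le2 Q2]]] := IH _ ltP _ _ inv'.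
exists (rcons (ticks e) Tick ++ t1 ++ t2), s2; split.
- exact: ExecWhile hv vn ex1 ex2.
- by rewrite !all_cat silent_tick q1.
- by rewrite !size_cat size_rcons size_ticks; lia.
- by rewrite !puts_cat puts_tick /= catA.
Qed.

Lemma run_conseq p st T (Q : state -> Prop) Q' : run p st T Q' ->
  (forall s, Q' s -> Q s) -> run p st T Q.
Proof. by move=> r h; apply: run_le r _ h. Qed.

Hypothesis W16 : 16 %| wmax M.

Lemma runp_fr p st T Q : okp p -> runp p st T Q ->
  runp p st T (fun w s => Q w s /\ fr (wr p) (wa p) st s).
Proof.
move=> ok [t [st' [h q le QQ]]]; exists t, st'; split=> //.
by split=> //; apply: exec_fr h ok.
Qed.

Lemma run_fr p st T Q : okp p -> run p st T Q ->
  run p st T (fun s => Q s /\ fr (wr p) (wa p) st s).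
Proof.
move=> ok /(runp_fr ok) r; apply: runp_le r _ _ => // w s [] [-> q] f.
by [].
Qed.

(** The time bound is handed to the postcondition, so that it can be compared with a potential of
    the final state, as amortized arguments require. *)
Definition runx (p : program) (st : state) (Q : nat -> state -> Prop) : Prop :=
  exists T, run p st T (Q T).

Lemma run_runx p st T Q (Q' : nat -> state -> Prop) : run p st T Q ->
  (forall s, Q s -> Q' T s) -> runx p st Q'.
Proof. by move=> r h; exists T; apply: run_le r _ h. Qed.

Lemma runx_seq p q st (Q : nat -> state -> Prop) :
  runx p st (fun k s => runx q s (fun k' s' => Q (k + k') s')) -> runx (Seq p q) st Q.
Proof.
move=> [T [t [s [h q1 le [w [T' r]]]]]]; exists (T + T'); apply: run_seq.
by exists t, s; split.
Qed.

Lemma runx_if st e v p q (Q : nat -> state -> Prop) : ev st e v ->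
  (v != 0 -> runx p st (fun k s => Q ((esize e).+1 + k) s)) ->
  (v = 0 -> runx q st (fun k s => Q ((esize e).+1 + k) s)) ->
  runx (If e p q) st Q.
Proof.
move=> h hp hq; have [v0|vn] := eqVneq v 0.
  have [T r] := hq v0; exists ((esize e).+1 + (0 + T)); apply: run_if h _ _ => //.
  by rewrite v0.
have [T r] := hp vn; exists ((esize e).+1 + (T + 0)); rewrite addn0.
rewrite -{1}(addn0 T); apply: run_if h _ _ => // v0; by rewrite v0 in vn.
Qed.

(** The potential [P] left at the end is returned rather than discarded: a surrounding loop can
    still spend it. *)
Lemma runx_while (inv Q : nat -> state -> Prop) e body st P0 :
  okp body ->
  (forall P s, fr (wr body) (wa body) st s -> inv P s ->
     exists v, [/\ ev s e v, v = 0 -> Q P s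
     & v != 0 -> runx body s (fun k s' =>
         exists P', inv P' s' /\ k + (esize e).+1 + P' <= P)]) ->
  inv P0 st ->
  runx (While e body) st (fun k s => exists P, [/\ Q P s,
     fr (wr body) (wa body) st s & k + P <= P0 + (esize e).+1]).
Proof.
move=> ok H i0.
have main P : forall s, fr (wr body) (wa body) st s -> inv P s ->
    runx (While e body) s (fun k s' => exists P', [/\ Q P' s',
     fr (wr body) (wa body) st s' & k + P' <= P + (esize e).+1]).
  elim/ltn_ind: P => P IH s f i; have [v [hv h0 h1]] := H _ _ f i.
  have [v0|vn] := eqVneq v 0.
    exists (esize e).+1, (rcons (ticks e) Tick), s; split.
    - by apply: ExecWhileEnd; rewrite -v0.
    - exact: silent_tick.
    - by rewrite size_rcons size_ticks.
    - by rewrite puts_tick; split=> //; exists P; split=> //; [apply: h0|lia].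
  have [T r] := h1 vn.
  have [t1 [s1 [ex1 q1 le1 [w1 [[P' [i' leP]] f1]]]]] := run_fr ok r.
  have ltP : P' < P by lia.
  have [T2 [t2 [s2 [ex2 q2 le2 [w2 [P2 [Q2 f2 leP2]]]]]]] := IH _ ltP _ (fr_trans f f1) i'.
  exists ((esize e).+1 + T + T2), (rcons (ticks e) Tick ++ t1 ++ t2), s2; split.
  - exact: ExecWhile hv vn ex1 ex2.
  - by rewrite !all_cat silent_tick q1.
  - by rewrite !size_cat size_rcons size_ticks; lia.
  - rewrite !puts_cat puts_tick w1 w2; split=> //; exists P2; split=> //; lia.
exact: main (fr_refl _ _ _) i0.
Qed.

Lemma run_while (inv : nat -> state -> Prop) (Q : state -> Prop) e body st P0 :
  okp body ->
  (forall P s, fr (wr body) (wa body) st s -> inv P s ->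
     exists v, [/\ ev s e v, v = 0 -> Q s
     & v != 0 -> exists T, run body s T (fun s' =>
         exists P', inv P' s' /\ T + (esize e).+1 + P' <= P)]) ->
  inv P0 st ->
  run (While e body) st (P0 + (esize e).+1)
    (fun s => Q s /\ fr (wr body) (wa body) st s).
Proof.
move=> ok H i0.
pose inv' P (w : seq nat) s :=
  [/\ w = [::], inv P s & fr (wr body) (wa body) st s].
have I0 : inv' P0 [::] st by [].
pose Q' (w : seq nat) s := w = [::] /\ (Q s /\ fr (wr body) (wa body) st s).
have := @runp_while inv' Q' e body _ P0 [::] st I0; apply.
move=> P w s [-> i f]; have [v [hv h0 h1]] := H _ _ f i.
exists v; split=> //; first by move=> /h0 q.
move=> /h1 [T r]; exists T; have r' := run_fr ok r.
apply: runp_le r' _ _ => // w' s' [-> [[P' [i' le]] f']].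
exists P'; split=> //; split=> //; exact: fr_trans f f'.
Qed.

Variable L : nat.
Hypothesis Lcells : L * 16 <= mcells M.
Hypothesis Lword : L * 16 + 32 <= wmax M.

Lemma ev_arr st k e i : ev st e i -> i < L -> k < 16 -> ev st (Arr k e) (arr st k i).
Proof.
rewrite /ev /= => -> iL k16; rewrite !wordE; [|lia..].
by have -> : i * 16 + k < mcells M by lia.
Qed.

Lemma run_store st k e1 e2 i v (Q : state -> Prop) :
  ev st e1 i -> i < L -> k < 16 -> ev st e2 v -> Q (seta st k i v) ->
  run (StoreA k e1 e2) st (esize e1 + esize e2 + 5) Q.
Proof.
move=> h1 iL k16 h2 q; exists (rcons (ticks (cell k e1) ++ ticks e2) Tick).
exists (seta st k i v); split.
- apply: ExecStore h2; last by lia.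
  by rewrite /= h1 !wordE //; lia.
- by rewrite all_rcons all_cat !silent_ticks.
- rewrite size_rcons size_cat !size_ticks /=; lia.
- by split=> //; rewrite -cats1 !puts_cat !puts_ticks.
Qed.

Definition For (x : nat) (e : expr) (body : program) : program :=
  Seq (Set_ x (Cst 0))
      (While (Bin Lt (Reg x) e)
             (Seq body (Set_ x (Bin Add (Reg x) (Cst 1))))).

(** The invariant must be insensitive to the counter, which is incremented after the body. Each
    round pays 4 units for the test and 4 for the increment; the final 6 are the initialization and
    the last test. *)
Lemma run_for (inv : nat -> state -> Prop) x y body st N T :
  okp body -> x != y -> x \notin wr body -> y \notin wr body ->
  regs st y = N -> N < W ->
  (forall j s s', fr [:: x] [::] s s' -> inv j s -> inv j s') ->
  inv 0 st ->
  (forall j s, j < N -> regs s x = j -> fr (x :: wr body) (wa body) st s ->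
     inv j s -> run body s T (inv j.+1)) ->
  run (For x (Reg y) body) st (N * (T + 8) + 6)
    (fun s => inv N s /\ fr (x :: wr body) (wa body) st s).
Proof.
move=> ok xy xb yb stN NW inv_fr i0 step.
have frx s v : fr [:: x] [::] s (setr s x v).
  by split=> // z; rewrite inE regs_setr => /negbTE ->.
rewrite /For.
apply: (@run_le _ _ (2 + (N * (T + 8) + 4)) _
  (fun s => inv N s /\ fr (x :: wr body) (wa body) st s)) => //; last by lia.
apply: run_seq; apply: run_set; first by apply: ev_cst; lia.
set st1 := setr _ _ _.
pose I P s := exists j, [/\ j <= N, regs s x = j, inv j s & (N - j) * (T + 8) = P].
set wb := Seq body _.
have fr1 : fr (x :: wr body) (wa body) st st1.
  by apply: fr_sub (frx _ _) _ _ => // z; rewrite !inE => ->.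
have sub s s' : fr (wr wb) (wa wb) s s' -> fr (x :: wr body) (wa body) s s'.
  move=> f; apply: fr_sub f _ _ => z /=; first by rewrite mem_cat !inE orbC.
  by rewrite cats0.
apply: (@run_le _ _ ((N * (T + 8)) + (esize (Bin Lt (Reg x) (Reg y))).+1) _
  (fun s => inv N s /\ fr (wr wb) (wa wb) st1 s)) => //; first last.
  move=> s [i f]; split=> //; apply: fr_trans fr1 _; exact: sub.
apply: (run_while (inv := I)).
- by rewrite /= ok.
- move=> P s /sub f [j [jN xj ij <-]].
  have yN : regs s y = N.
    by rewrite f.1 ?inE ?negb_or 1?eq_sym ?xy // regs_setr eq_sym (negbTE xy).
  exists (j < N); split.
  + have -> : nat_of_bool (j < N) = binop_sem Lt j N by [].
    rewrite -{1}xj -yN; apply: ev_bin; [exact: ev_reg|exact: ev_reg|].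
    have := leq_b1 (regs s x < regs s y); rewrite /=; lia.
  + move=> jN0; suff -> : N = j by []. lia.
  + move=> jN1; have ltj : j < N by lia.
    exists (T + 4); apply: run_seq.
    have f1 := fr_trans fr1 f.
    have r := run_fr ok (step j s ltj xj f1 ij).
    apply: run_le r _ _ => // s' [i' f'].
    have x' : regs s' x = j by rewrite f'.1.
    apply: run_set.
      by apply: ev_bin (ev_reg _ _) (ev_cst _ _) _; rewrite /= ?x'; lia.
    exists ((N - j.+1) * (T + 8)); split=> /=.
      exists j.+1; split=> //; last exact: inv_fr (frx _ _) i'.
      by rewrite regs_setr eqxx x' addn1.
    have : N - j = (N - j.+1).+1 by lia. 
    by move=> ->; rewrite mulSn; lia.
- exists 0; split=> //; rewrite ?subn0 //; first by rewrite regs_setr eqxx.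
  exact: inv_fr (frx _ _) i0.
Qed.

End Logic.

(** * The search tree *)

Lemma connect_closed (T : finType) (e : rel T) (P : T -> Prop) u v :
  (forall a b, e a b -> P a -> P b) -> connect e u v -> P u -> P v.
Proof.
move=> cl /connectP[p pth ->]; elim: p u pth => //= w p IH u /andP[uw /IH h] Pu.
by apply: h; apply: cl uw Pu.
Qed.

(** Cut the path at its last exit from [S]: what follows never meets [S] again. *)
Lemma connect_exit (T : finType) (r : rel T) (S : {set T}) z t :
  connect r z t -> z \in S -> t \notin S ->
  exists y x, [/\ y \in S, x \notin S, r y x &
    connect [rel a b | [&& r a b, a \notin S & b \notin S]] x t].
Proof.
set rS := [rel a b | _].
have main p : forall z, path r z p -> last z p \notin S ->
    (exists y x, [/\ y \in S, x \notin S, r y x & connect rS x (last z p)]) \/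
    z \notin S /\ connect rS z (last z p).
  elim: p => [|w p IH] {}z /=; first by move=> _ ->; right.
  move=> /andP[zw /IH{}IH] /IH [|[wS c]]; first by left.
  case: (boolP (z \in S)) => zS; first by left; exists z, w.
  right; split=> //; apply: connect_trans c; apply: connect1.
  by rewrite /= zw zS.
move=> /connectP[p pth ->] zS tS; have [//|[]] := main _ _ pth tS.
by rewrite zS.
Qed.

Lemma set2_inj (V : finType) (a b c d : V) : [set a; b] = [set c; d] ->
  (a = c /\ b = d) \/ (a = d /\ b = c).
Proof.
move=> ab.
have: a \in [set c; d] by rewrite -ab !inE eqxx.
have: b \in [set c; d] by rewrite -ab !inE eqxx orbT.
have: c \in [set a; b] by rewrite ab !inE eqxx.
have: d \in [set a; b] by rewrite ab !inE eqxx orbT.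
rewrite !inE => /orP[/eqP hd|/eqP hd] /orP[/eqP hc|/eqP hc] /orP[/eqP hb|/eqP hb];
  move=> /orP[/eqP ha|/eqP ha]; subst; auto.
Qed.

(** * Connectivity in edge sets *)

Section Conn.
Variable V : finType.
Implicit Types (E T : {set {set V}}) (S : {set V}).

Definition conn E (u v : V) : bool := connect [rel x y | [set x; y] \in E] u v.

(** Paths avoiding [S]. The empty path is allowed even at a vertex of [S], so membership of the ends
    has to be tested separately. *)
Definition connA E S (u v : V) : bool :=
  connect [rel x y | [&& [set x; y] \in E, x \notin S & y \notin S]] u v.

Lemma connC E u v : conn E u v = conn E v u.
Proof. by apply: sym_connect_sym => x y /=; rewrite setUC. Qed.

Lemma connAC E S u v : connA E S u v = connA E S v u.
Proof.
by apply: sym_connect_sym => x y /=; rewrite setUC [(_ \notin _) && _]andbC.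
Qed.

Lemma conn_refl E u : conn E u u. Proof. exact: connect0. Qed.
Lemma conn_trans E u v w : conn E u v -> conn E v w -> conn E u w.
Proof. exact: connect_trans. Qed.

Lemma conn1 E u v : [set u; v] \in E -> conn E u v.
Proof. by move=> h; apply: connect1. Qed.

Lemma conn_eql E u v w : conn E u v -> conn E u w = conn E v w.
Proof.
move=> h; apply/idP/idP; apply: conn_trans => //; by rewrite connC.
Qed.

Lemma connS E E' u v : E \subset E' -> conn E u v -> conn E' u v.
Proof.
move=> sub; apply: connect_sub => x y /= h; apply: connect1.
by apply: (subsetP sub).
Qed.

Lemma connAS E E' S u v : E \subset E' -> connA E S u v -> connA E' S u v.
Proof.
move=> sub; apply: connect_sub => x y /= /andP[h h']; apply: connect1.
by rewrite /= (subsetP sub).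
Qed.

Lemma connA0 E u v : connA E set0 u v = conn E u v.
Proof. by apply: eq_connect => x y /=; rewrite !inE !andbT. Qed.

(** As a property of [v], the right-hand side is closed under the edges of [E] and under the new
    edge, so it holds along every path from [u]. *)
Lemma conn_add E y x u v : conn ([set y; x] |: E) u v =
  [|| conn E u v, conn E u y && conn E x v | conn E u x && conn E y v].
Proof.
set E' := _ |: _; have sub : E \subset E' by apply: subsetUr.
have yx : conn E' y x by apply: conn1; rewrite !inE eqxx.
apply/idP/idP; last first.
  case/or3P=> [|/andP[h1 h2]|/andP[h1 h2]]; first exact: connS.
    by apply: conn_trans (connS sub h1) (conn_trans yx (connS sub h2)).
  rewrite connC in yx.
  by apply: conn_trans (connS sub h1) (conn_trans yx (connS sub h2)).
move=> h; move: (conn_refl E u).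
pose P v := [|| conn E u v, conn E u y && conn E x v | conn E u x && conn E y v].
move=> uu; apply: (connect_closed (P := P)) h _; last by rewrite /P uu.
move=> a b /=; rewrite !inE /P => /orP[/eqP ab|/conn1 ab]; last first.
  have eab w : conn E w a = conn E w b.
    by rewrite connC [RHS]connC; apply: conn_eql.
  by rewrite !eab.
case: (set2_inj ab) => -[-> ->]; rewrite !conn_refl !andbT.
  by case/or3P=> [->|/andP[-> _]|->]; rewrite ?orbT.
by case/or3P=> [->|->|/andP[-> _]]; rewrite ?orbT.
Qed.

(** The component of [x] is disjoint from that of [i], so a path from [x] within [E] cannot enter
    the latter. *)
Lemma connA_blk E (i x z : V) : ~~ conn E i x -> conn E x z ->
  connA E [set v | conn E i v] x z.
Proof.
move=> ix xz.
suff : connA E [set v | conn E i v] x z /\ conn E x z by case.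
move: xz => h; apply: (connect_closed (P := fun z => connA E _ x z /\ conn E x z)) h _.
  move=> a b /= ab [h1 h2]; split; last exact: conn_trans (conn1 ab).
  apply: connect_trans h1 _; apply: connect1; rewrite /= ab !inE /=.
  have xb := conn_trans h2 (conn1 ab).
  apply/andP; split; apply: contra ix => h; apply: conn_trans h _.
    by rewrite connC.
  by rewrite connC.
by split; rewrite ?conn_refl //; apply: connect0.
Qed.

End Conn.

(** * Nodes of the search tree *)

Section Tree.
Variables (n na : nat) (tl hd : 'I_na -> 'I_n) (rep : 'I_n -> 'I_n).
Notation V := 'I_n.
Hypothesis arc_inj : forall a b, tl a = tl b -> hd a = hd b -> a = b.
Hypothesis arc_rev : forall a, exists b, tl b = hd a /\ hd b = tl a.

Definition eo (a : 'I_na) : {set V} := [set tl a; hd a].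
Definition G : {set {set V}} := [set eo a | a in [set: 'I_na]].

Lemma eoG a : eo a \in G.
Proof. exact: imset_f. Qed.

Lemma G_arc y x : [set y; x] \in G -> exists a, tl a = y /\ hd a = x.
Proof.
move=> /imsetP[a _ /set2_inj[[-> ->]|[-> ->]]]; first by exists a.
by have [b [h1 h2]] := arc_rev a; exists b.
Qed.

Hypothesis feasible : forall v, conn G v (rep v).

Definition sat (T : {set {set V}}) : Prop := forall v, conn T v (rep v).
Definition minT (T : {set {set V}}) : Prop :=
  [/\ T \subset G, sat T & forall e, e \in T -> ~ sat (T :\ e)].

Definition unsat (E : {set {set V}}) : option V :=
  [pick i | ~~ conn E i (rep i) & [forall j : V, (j < i) ==> conn E j (rep j)]].

Lemma unsat_some E (i : V) : reflect
  (~~ conn E i (rep i) /\ forall j : V, j < i -> conn E j (rep j))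
  (unsat E == Some i).
Proof.
rewrite /unsat; case: pickP => [k /andP[k1 /forallP k2]|none]; last first.
  apply: (iffP idP) => // -[h1 h2]; have := none i; rewrite h1 /=.
  by move/negP; case; apply/forallP=> j; apply/implyP/h2.
apply: (iffP eqP) => [[<-]|[h1 h2]].
  by split=> // j jk; apply: (implyP (k2 j)).
congr Some; apply: val_inj; case: (ltngtP k i) => // h.
  by move: k1; rewrite h2.
by move: h1; rewrite (implyP (k2 i) h).
Qed.

Lemma unsat_none E : unsat E = None <-> sat E.
Proof.
split=> [|sE]; last first.
  case u: (unsat E) => [i|//]; have /eqP/unsat_some[] := u.
  by rewrite sE.
move=> u v; apply/negPn/negP=> nv.
have ex : exists i : nat, (fun i : nat => [exists j : V, (val j == i) && ~~ conn E j (rep j)]) i.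
  by exists (val v); apply/existsP; exists v; rewrite eqxx.
case: (ex_minnP ex) => k /existsP[j /andP[/eqP <- nj]] mn.
suff : unsat E == Some j by rewrite u.
apply/unsat_some; split=> // l lj; apply/negPn/negP=> nl.
have := mn (val l); rewrite leqNgt lj => h; apply: notF; apply: h.
by apply/existsP; exists l; rewrite eqxx.
Qed.

Fixpoint es (s : seq 'I_na) : {set {set V}} :=
  if s is a :: s' then eo a |: es s' else set0.

Definition blk (s : seq 'I_na) (i : V) : {set V} := [set v | conn (es s) i v].

(** The vertices from which the path under construction may continue. *)
Definition tp (s : seq 'I_na) (i : V) : {set V} :=
  if s is a :: s' then
    if unsat (es s') == Some i then [set v | conn (es s') (hd a) v] else blk s i
  else blk s i.

Definition valid (s : seq 'I_na) (a : 'I_na) : bool :=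
  if unsat (es s) is Some i then
    [&& tl a \in tp s i, hd a \notin blk s i
      & connA G (blk s i) (hd a) (rep i)]
  else false.

Inductive reach : seq 'I_na -> Prop :=
  | reach0 : reach [::]
  | reachS s a : reach s -> valid s a -> reach (a :: s).

Lemma es_sub s : es s \subset G.
Proof.
elim: s => [|a s IH] /=; first exact: sub0set.
by rewrite subUset IH sub1set eoG.
Qed.

Lemma validP s a : valid s a -> exists i, [/\ unsat (es s) = Some i,
  tl a \in tp s i, ~~ conn (es s) i (hd a) & connA G (blk s i) (hd a) (rep i)].
Proof.
rewrite /valid; case u: unsat => [i|] // /and3P[h1 h2 h3]; exists i; split=> //.
by rewrite inE in h2.
Qed.

Lemma tp_sub s i : reach s -> unsat (es s) = Some i -> tp s i \subset blk s i.
Proof.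
move=> r; elim: r i => // {}s a rs IH va i u /=.
case: ifP => // ui; apply/subsetP=> v; rewrite !inE => h.
have [i' [u' tla _ _]] := validP va.
have ? : i' = i by move: ui; rewrite u' => /eqP[].
subst i'; have := subsetP (IH _ u') _ tla; rewrite inE => c.
by rewrite /= conn_add c h orbT.
Qed.

Lemma valid_conn s a i : reach s -> valid s a -> unsat (es s) = Some i ->
  [/\ conn (es s) i (tl a), ~~ conn (es s) i (hd a), tl a \in tp s i,
      connA G (blk s i) (hd a) (rep i) & eo a \notin es s].
Proof.
move=> rs /validP[i' [u' tla hda cA]] u; move: u' tla hda cA; rewrite u => -[<-] tla hda cA.
have c : conn (es s) i (tl a).
  by have := subsetP (tp_sub rs u) _ tla; rewrite inE.
split=> //; apply: contra hda => h; apply: conn_trans c _; exact: conn1.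
Qed.

Lemma unsat_next s a i : unsat (es s) = Some i ->
  unsat (es (a :: s)) = Some i \/ conn (es (a :: s)) i (rep i).
Proof.
move=> /eqP/unsat_some[h1 h2].
case c: (conn (es (a :: s)) i (rep i)); [by right|left].
apply/eqP/unsat_some; split; first by rewrite c.
move=> j /h2; apply: connS; exact: subsetUr.
Qed.

(** The dichotomy behind most arguments below. As [a] joins the block to a different component, the
    block of an unfinished child is the disjoint union of the parent's block and the new tip; if the
    demand of [i] is settled, the next path starts from its whole block. *)
Lemma tp_next s a i : reach s -> valid s a -> unsat (es s) = Some i ->
  [/\ unsat (es (a :: s)) = Some i,
      tp (a :: s) i = [set v | conn (es s) (hd a) v]
    & blk (a :: s) i :\: tp (a :: s) i = blk s i] \/
  conn (es (a :: s)) i (rep i) /\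
  forall i', unsat (es (a :: s)) = Some i' -> tp (a :: s) i' = blk (a :: s) i'.
Proof.
move=> rs va u; have [ctl chd _ _ _] := valid_conn rs va u.
have [u'|c] := unsat_next a u; [left|right].
  have E : tp (a :: s) i = [set v | conn (es s) (hd a) v] by rewrite /= u eqxx.
  split=> //; rewrite E; apply/setP=> v; rewrite !inE /= conn_add ctl (negbTE chd) /=.
  rewrite orbF; case: (boolP (conn _ (hd a) v)) => //= h; last by rewrite orbF.
  by apply/esym/negbTE; apply: contra chd => h'; apply: conn_trans h' _; rewrite connC.
split=> // i' u' /=; case: ifP => // /eqP; rewrite u => -[?]; subst i'.
by have /eqP/unsat_some[] := u'; rewrite c.
Qed.

(** An edge of an unfinished path need not serve any demand yet. The second alternative is the
    invariant that carries such an edge along: since it cuts the tip off from [i], it becomes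
    necessary as soon as the path arrives at [rep i]. *)
Lemma reach_nec s e : reach s -> e \in es s ->
  (exists j, conn (es s) j (rep j) /\ ~~ conn (es s :\ e) j (rep j)) \/
  (exists i, unsat (es s) = Some i /\
     forall y, y \in tp s i -> ~~ conn (es s :\ e) i y).
Proof.
move=> r; elim: r e => [e|{}s a rs IH va e]; first by rewrite inE.
have [i [u _ _ _]] := validP va.
have [ctl chd tla cA na'] := valid_conn rs va u.
have /eqP/unsat_some[nc _] := u.
have sub f : es s :\ f \subset es s by apply: subsetDl.
have subS := @connS _ _ _ _ _ (sub _).
have Dadd f : f \in es s -> es (a :: s) :\ f = eo a |: (es s :\ f).
  move=> fs; have ne : eo a != f by apply: contraNneq na' => ->.
  apply/setP=> g; rewrite !inE; case: (g =P eo a) => //= ->; by rewrite ne.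
(* If [a] reconnected [j] with [rep j], its two ends would be joined to these two vertices; as they
   are connected in [es s], so would be the ends of [a]. *)
have keep f j : f \in es s -> conn (es s) j (rep j) ->
    ~~ conn (es s :\ f) j (rep j) -> ~~ conn (es (a :: s) :\ f) j (rep j).
  move=> fs cj nj; rewrite (Dadd _ fs) conn_add (negbTE nj) /=.
  rewrite negb_or; apply/andP; split; apply: contra chd => /andP[/subS h1 /subS h2].
    apply: conn_trans ctl _; rewrite (conn_eql _ (_ : conn _ _ j)); last by rewrite connC.
    by apply: conn_trans cj _; rewrite connC.
  apply: conn_trans ctl _; apply: conn_trans h2 _; rewrite connC in cj.
  exact: conn_trans cj h1.
rewrite in_setU1 => /orP[/eqP->{e}|es_].
  have D : es (a :: s) :\ eo a = es s by rewrite /= setU1K.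
  rewrite D; have [[u' tE _]|[c _]] := tp_next rs va u; [right|left].
    exists i; split=> // y; rewrite tE inE => h; apply: contra chd => h'.
    by apply: conn_trans h' _; rewrite connC.
  by exists i.
have [[j [cj nj]]|[i' [u' nt]]] := IH _ es_.
  left; exists j; split; last exact: keep.
  by apply: connS cj; apply: subsetUr.
have ? : i' = i by move: u'; rewrite u => -[].
(* The tail of the new arc lies in the old tip, so deleting [e] cuts [i] off from [tl a], hence from
   all that is reached through [a]. *)
subst i'; have nt' := nt _ tla.
have [[u2 tE _]|[c _]] := tp_next rs va u; [right|left].
  exists i; split=> // y; rewrite tE inE => h; rewrite (Dadd _ es_) conn_add (negbTE nt') /=.
  rewrite negb_or; apply/andP; split; apply: contra chd.
    by move=> /subS h'; apply: conn_trans h' _; rewrite connC.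
  by move=> /andP[/subS].
exists i; split=> //; rewrite (Dadd _ es_) conn_add (negbTE nt') /= negb_or.
apply/andP; split; first by apply: contra nc => /subS.
by apply: contra chd => /andP[/subS].
Qed.

Lemma blk0 s i : blk s i :\: blk s i = set0.
Proof. exact: setDv. Qed.

(** For a path just begun this is feasibility, since nothing is avoided. Otherwise validity of the
    last arc says that its head, now in the tip, sees [rep i] outside the parent's block, which is
    the set avoided here. *)
Lemma reach_ext s i : reach s -> unsat (es s) = Some i ->
  exists2 z, z \in tp s i & connA G (blk s i :\: tp s i) z (rep i).
Proof.
have base t j : exists2 z, z \in blk t j & connA G (blk t j :\: blk t j) z (rep j).
  by exists j; rewrite ?inE ?conn_refl // blk0 connA0.
case=> [_|{}s a rs va u']; first exact: base.
have [i0 [u _ _ _]] := validP va.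
have [ctl chd tla cA _] := valid_conn rs va u.
have [[u2 tE bE]|[_ /(_ _ u') ->]] := tp_next rs va u; last exact: base.
have ? : i0 = i by move: u'; rewrite u2 => -[].
by subst i0; exists (hd a); rewrite ?bE // tE inE conn_refl.
Qed.

(** The local criterion for a minimal solution [T] to occur below [s]. Containing the chosen edges
    is not enough: they may serve other demands of [T] while the route of [i] leaves the block
    elsewhere than at the tip. *)
Definition compat (T : {set {set V}}) (s : seq 'I_na) : Prop :=
  es s \subset T /\ forall i, unsat (es s) = Some i ->
    exists2 z, z \in tp s i & connA T (blk s i :\: tp s i) z (rep i).

Lemma rep_notin_blk s i : unsat (es s) = Some i -> rep i \notin blk s i.
Proof. by move=> /eqP/unsat_some[h _]; rewrite inE. Qed.

(** After its last exit from the tip, a route that avoids the rest of the block avoids the whole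
    block. Taking [T] to be [G] gives a next arc, taking a minimal solution gives the child that
    leads to it. *)
Lemma tp_exit (T : {set {set V}}) s i : reach s -> unsat (es s) = Some i -> T \subset G ->
  (exists2 z, z \in tp s i & connA T (blk s i :\: tp s i) z (rep i)) ->
  exists a, [/\ valid s a, eo a \in T & connA T (blk s i) (hd a) (rep i)].
Proof.
move=> rs u TG [z zt c]; have nr := rep_notin_blk u.
have sub := subsetP (tp_sub rs u).
have nt : rep i \notin tp s i by apply: contra nr; apply: sub.
have [y [x [yt xt /= /and3P[yx yn xn] cx]]] := connect_exit c zt nt.
have xB : x \notin blk s i by move: xn; rewrite inE xt.
have cx' : connA T (blk s i) x (rep i).
  apply: connect_sub cx => p q /= /and3P[/and3P[pq pn qn] pt qt].
  apply: connect1; move: pn qn; rewrite /= pq !in_setD pt qt /=.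
  by move=> -> ->.
have [a [ya xa]] := G_arc (subsetP TG _ yx).
exists a; rewrite /valid u ya xa yt xB /eo ya xa; split=> //.
exact: connAS TG cx'.
Qed.

Lemma valid_exists s : reach s -> unsat (es s) <> None -> exists a, valid s a.
Proof.
move=> rs; case u: unsat => [i|] // _.
by have [a []] := tp_exit rs u (subxx _) (reach_ext rs u); exists a.
Qed.

Lemma compat_next (T : {set {set V}}) s i : reach s -> unsat (es s) = Some i -> minT T ->
  compat T s -> exists2 a, valid s a & compat T (a :: s).
Proof.
move=> rs u [TG sT _] [sub /(_ _ u) h].
have [a [va aT cA]] := tp_exit rs u TG h.
exists a => //; split; first by rewrite /= subUset sub1set aT.
move=> i' u'; have [[u2 tE bE]|[_ /(_ _ u') ->]] := tp_next rs va u.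
  have ? : i' = i by move: u'; rewrite u2 => -[].
  by subst i'; exists (hd a); rewrite ?bE // tE inE conn_refl.
by exists i'; rewrite ?inE ?conn_refl // blk0 connA0.
Qed.

(** Within the old component of [hd a] everything avoids the parent's block. If the path is
    unfinished, compatibility continues from a vertex of that component; if [a] settled the demand,
    [rep i] already lies in it. *)
Lemma compat_exit (T : {set {set V}}) s a i : reach s -> valid s a -> unsat (es s) = Some i ->
  compat T (a :: s) -> connA T (blk s i) (hd a) (rep i).
Proof.
move=> rs va u [sub h]; have [ctl chd tla cA _] := valid_conn rs va u.
have sub' : es s \subset T by apply: subset_trans sub; apply: subsetUr.
have inner z : conn (es s) (hd a) z -> connA T (blk s i) (hd a) z.
  by move=> c; apply: connAS sub' _; apply: connA_blk.
have [[u2 tE bE]|[c _]] := tp_next rs va u.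
  have [z] := h _ u2; rewrite bE tE inE => /inner c1 c2.
  exact: connect_trans c1 c2.
apply: inner; move: c; rewrite /= conn_add (negbTE chd) /= orbF.
have /eqP/unsat_some[nc _] := u.
by rewrite (negbTE nc) /= => /andP[].
Qed.

Lemma exit_unique (T : {set {set V}}) s a b i : minT T -> reach s -> valid s a -> valid s b ->
  unsat (es s) = Some i ->
  es s \subset T -> eo a \in T -> eo b \in T ->
  connA T (blk s i) (hd a) (rep i) -> connA T (blk s i) (hd b) (rep i) -> a = b.
Proof.
move=> [TG sT mT] rs va vb u sub aT bT ca cb.
have [cta cha _ _ na'] := valid_conn rs va u.
have [ctb chb _ _ nb] := valid_conn rs vb u.
have [eab|nab] := eqVneq (eo a) (eo b).
  case: (set2_inj eab) => [] [e1 e2]; first exact: arc_inj.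
  by move: cha; rewrite e2 ctb.
case: (mT _ bT) => v.
have sub' : es s \subset T :\ eo b by rewrite subsetD1 sub.
(* A route outside the block cannot use [b], whose tail is in the block. *)
have inner x : connA T (blk s i) x (rep i) -> conn (T :\ eo b) x (rep i).
  apply: connect_sub => p q /= /and3P[pq pn qn]; apply: conn1; rewrite !inE pq andbT.
  apply: contra pn => /eqP /set2_inj [[-> _]|[pb qb]]; first by rewrite inE.
  by move: qn; rewrite qb inE ctb.
(* The ends of [b] stay connected without it: inside the block to [tl a], across [a], then outside
   the block to [rep i] and back to [hd b]. *)
have key : conn (T :\ eo b) (tl b) (hd b).
  apply: conn_trans (_ : conn _ i (hd b)); first by rewrite connC; apply: connS ctb.
  apply: conn_trans (connS sub' cta) _; apply: conn_trans (_ : conn _ (hd a) _).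
    by apply: conn1; rewrite !inE nab.
  by apply: conn_trans (inner _ ca) _; rewrite connC; apply: inner.
have := sT v; rewrite -{1}(setD1K bT) /eo conn_add -/(eo b).
case/or3P=> // /andP[h1 h2].
  exact: conn_trans h1 (conn_trans key h2).
by rewrite connC in key; apply: conn_trans h1 (conn_trans key h2).
Qed.

(** A rank argument: relabelling the component of the head by that of the tail describes the new
    components and loses one label, so each arc lowers the number of components. *)
Lemma reach_labels s : reach s -> exists lab : V -> V,
  (forall u v, (lab u == lab v) = conn (es s) u v) /\
  #|[set lab v | v in [set: V]]| + size s <= n.
Proof.
elim=> [|{}s a rs [lab [labP labn]] va].
  exists id; split; last by rewrite imset_id cardsT card_ord addn0.
  move=> u v; apply/idP/idP=> [/eqP->|]; first exact: conn_refl.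
  move=> h; apply: (connect_closed (P := fun v => u == v)) h _ => // x y /=.
  by rewrite inE.
have [i [u _ _ _]] := validP va; have [cta cha _ _ _] := valid_conn rs va u.
exists (fun v => if lab v == lab (hd a) then lab (tl a) else lab v).
have ne : lab (tl a) != lab (hd a).
  by rewrite labP; apply: contra cha => h; apply: conn_trans cta h.
split=> [p q|].
  rewrite /= conn_add -!labP.
  rewrite (eq_sym (lab (hd a))).
  case: (lab p =P lab (hd a)) => [->|hp]; case: (lab q =P lab (hd a)) => [->|hq];
    rewrite ?eqxx ?andbT ?andbF ?orbF ?orbT //=.
  - rewrite (eq_sym (lab (hd a)) (lab q)) (negbTE (introN eqP hq)) /=.
    by [].
  - by rewrite (negbTE (introN eqP hp)) //= ?orbF.
rewrite addnS -addSn; apply: leq_trans labn; rewrite leq_add2r.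
apply: proper_card; apply/properP; split.
  by apply/subsetP=> w /imsetP[v _ ->]; case: ifP => _; apply: imset_f.
exists (lab (hd a)); first exact: imset_f.
apply/imsetP=> -[v _]; case: ifP => [_|/eqP h /esym//].
by move/esym/eqP; rewrite (negbTE ne).
Qed.

Lemma reach_size s : reach s -> size s <= n.
Proof. by move=> /reach_labels[lab [_ h]]; apply: leq_trans h; apply: leq_addl. Qed.

Lemma reach_card s : reach s -> #|es s| = size s.
Proof.
elim=> [|{}s a rs IH va] /=; first by rewrite cards0.
have [i [u _ _ _]] := validP va; have [_ _ _ _ nb] := valid_conn rs va u.
by rewrite cardsU1 nb IH.
Qed.

(** * Leaves of the tree and minimal solutions *)

Fixpoint solsf (f : nat) (s : seq 'I_na) : seq (seq 'I_na) :=
  if unsat (es s) is Some i then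
    if f is f'.+1 then
      flatten [seq solsf f' (a :: s) | a <- enum 'I_na & valid s a]
    else [::]
  else [:: s].

(** The depth never exceeds [n], so fuel [n + 1] suffices at every node; by [solsf_fuel] the surplus
    is harmless. *)
Definition sols (s : seq 'I_na) := solsf n.+1 s.

Lemma solsf_fuel f f' s : reach s -> n < f + size s -> n < f' + size s ->
  solsf f s = solsf f' s.
Proof.
elim: f f' s => [|f IH] [|f'] s rs h h' //=.
- by have := reach_size rs; lia.
- by have := reach_size rs; lia.
case: unsat => // _; congr flatten; apply/eq_in_map => a.
rewrite mem_filter => /andP[va _]; apply: IH; first exact: reachS.
  by rewrite /=; lia.
by rewrite /=; lia.
Qed.

Lemma sols_leaf s : unsat (es s) = None -> sols s = [:: s].
Proof. by rewrite /sols /= => ->. Qed.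

Lemma sols_node s : reach s -> unsat (es s) <> None ->
  sols s = flatten [seq sols (a :: s) | a <- enum 'I_na & valid s a].
Proof.
move=> rs; rewrite {1}/sols /=; case: unsat => // i _; congr flatten.
apply/eq_in_map => a; rewrite mem_filter => /andP[va _].
by apply: solsf_fuel; [exact: reachS|rewrite /=; lia..].
Qed.

Lemma reach_sat_min s : reach s -> unsat (es s) = None -> minT (es s).
Proof.
move=> rs u; split; [exact: es_sub|exact/unsat_none|].
move=> e he sD; have [[j [_]]|[i [u' _]]] := reach_nec rs he; first by rewrite sD.
by rewrite u in u'.
Qed.

Lemma solsf_compat f s (T : {set {set V}}) : reach s -> n < f + size s -> minT T ->
  T \in map es (solsf f s) <-> compat T s.
Proof.
move=> + + mT; elim: f s => [|f IH] s rs hf.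
  by have := reach_size rs; lia.
have [TG sT minT'] := mT.
rewrite /=; case u: unsat => [i|] /=; last first.
  rewrite inE; split=> [/eqP->|[sub _]]; first by split; rewrite // u.
  have /unsat_none sE := u.
  (* At a leaf the chosen edges already satisfy every demand, so a further edge of [T] would
     contradict its minimality. *)
  rewrite eqEsubset sub andbT; apply/subsetPn=> -[e eT ne].
  case: (minT' _ eT) => v; apply: connS (sE v).
  by rewrite subsetD1 sub.
split=> [/mapP[t /flatten_mapP[a]]|c].
  rewrite mem_filter => /andP[va _] tin Tt.
  have ra := reachS rs va.
  have ca : compat T (a :: s).
    apply/(IH _ ra); [by rewrite /=; lia|rewrite Tt; exact: map_f].
  have cA := compat_exit rs va u ca.
  have [sub _] := ca; move: sub; rewrite /= subUset sub1set => /andP[aT sub].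
  split=> // i' ; rewrite u => -[<-].
  have [cta _ tla _ _] := valid_conn rs va u.
  (* Prefix the route from [hd a] by the arc [a] itself: its tail is in the tip, and the rest avoids
     the parent's block. *)
  exists (tl a) => //; have nt : hd a \notin blk s i.
    by have [_ + _ _ _] := valid_conn rs va u; rewrite inE.
  apply: connect_trans (_ : connA T (blk s i :\: tp s i) (hd a) (rep i)).
    by apply: connect1; rewrite /= !in_setD tla (negbTE nt) andbF /= aT.
  apply: connect_sub cA => p q /= /and3P[pq pn qn]; apply: connect1.
  by rewrite /= pq !in_setD (negbTE pn) (negbTE qn) !andbF.
have [a va ca] := compat_next rs u mT c.
have ra := reachS rs va.
have /(IH _ ra) : compat T (a :: s) by [].
rewrite addSnnS in hf; move=> /(_ hf) /mapP[t ts ->]; apply: map_f.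
apply/flatten_mapP; exists a => //.
by rewrite mem_filter va mem_enum.
Qed.

Lemma solsf_reach f s t : reach s -> t \in solsf f s ->
  reach t /\ unsat (es t) = None.
Proof.
elim: f s => [|f IH] s rs /=; case u: unsat => [i|];
  rewrite ?inE //; try by move=> /eqP->.
move=> /flatten_mapP[a]; rewrite mem_filter => /andP[va _].
by apply: IH; apply: reachS.
Qed.

Lemma uniq_flatten_map (A B : eqType) (g : A -> seq B) (l : seq A) :
  uniq l -> (forall a, a \in l -> uniq (g a)) ->
  (forall a b x, a \in l -> b \in l -> x \in g a -> x \in g b -> a = b) ->
  uniq (flatten (map g l)).
Proof.
elim: l => //= a l IH /andP[al ul] ug dis; rewrite cat_uniq ug ?mem_head //=.
rewrite IH //; first last.
- by move=> b c x bl cl; apply: dis; rewrite inE ?bl ?cl orbT.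
- by move=> b bl; apply: ug; rewrite inE bl orbT.
rewrite andbT; apply/hasPn=> x /flatten_mapP[b bl xb]; apply/negP=> xa.
move: al; rewrite (dis a b x) ?mem_head ?bl //; by rewrite inE bl orbT.
Qed.

(** A solution found below two children would leave the block towards [rep i] by both arcs, which
    [exit_unique] excludes. *)
Lemma solsf_uniq f s : reach s -> n < f + size s -> uniq (map es (solsf f s)).
Proof.
elim: f s => [|f IH] s rs hf.
  by have := reach_size rs; lia.
rewrite /=; case u: unsat => [i|] //=; rewrite map_flatten -map_comp.
rewrite addSnnS in hf; apply: uniq_flatten_map.
- by rewrite filter_uniq ?enum_uniq.
- move=> a; rewrite mem_filter => /andP[va _]; apply: IH => //; exact: reachS.
move=> a b T; rewrite !mem_filter => /andP[va _] /andP[vb _] /= Ta Tb.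
have ra := reachS rs va; have rb := reachS rs vb.
have mT : minT T.
  have /mapP[t ts ->] := Ta; have [rt ut] := solsf_reach ra ts.
  exact: reach_sat_min.
have ca : compat T (a :: s) by apply: (solsf_compat ra hf mT).1 Ta.
have cb : compat T (b :: s) by apply: (solsf_compat rb hf mT).1 Tb.
have cA := compat_exit rs va u ca; have cB := compat_exit rs vb u cb.
have [] := ca; have [] := cb; rewrite /= !subUset !sub1set.
move=> /andP[bT sub] _ /andP[aT _] _.
exact: exit_unique mT rs va vb u sub aT bT cA cB.
Qed.

(** At the root the tip is the whole block, so compatibility only asks that [T] connect [i] with
    [rep i]. *)
Lemma sols_root (T : {set {set V}}) : T \in map es (sols [::]) <-> minT T.
Proof.
have r0 := reach0; split=> [/mapP[t ts ->]|mT].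
  by have [rt ut] := solsf_reach r0 ts; apply: reach_sat_min.
apply/(solsf_compat r0) => //; first by rewrite addn0.
split; first exact: sub0set.
move=> i u; exists i; rewrite ?inE ?conn_refl // blk0 connA0.
by have [_ sT _] := mT.
Qed.

Lemma sols_uniq : uniq (map es (sols [::])).
Proof. by apply: solsf_uniq reach0 _; rewrite addn0. Qed.

(** The leaves that come after [s] and its descendants in depth-first order. *)
Fixpoint later (s : seq 'I_na) : seq (seq 'I_na) :=
  if s is a :: s' then
    flatten [seq sols (b :: s') | b <- enum 'I_na & valid s' b && (a < b)]
    ++ later s'
  else [::].

(** Both sides are strictly increasing with the same members. The bound [k] is 0 for a first child
    and one more than the popped arc for a next sibling. *)
Lemma enum_split (P : pred 'I_na) (k : nat) (r : 'I_na) :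
  P r -> k <= r -> (forall b : 'I_na, k <= b -> b < r -> ~~ P b) ->
  [seq b <- enum 'I_na | P b && (k <= b)] =
  r :: [seq b <- enum 'I_na | P b && (r < b)].
Proof.
move=> Pr kr min; pose lt := [rel a b : 'I_na | a < b].
have tr : transitive lt by move=> x y z /=; apply: ltn_trans.
have so Q : sorted lt [seq b <- enum 'I_na | Q b].
  apply: sorted_filter => //; have := iota_ltn_sorted 0 na.
  by rewrite -val_enum_ord sorted_map.
apply: (irr_sorted_eq tr) => //.
- by move=> x /=; rewrite ltnn.
- rewrite /= path_min_sorted //; apply/allP=> b; rewrite mem_filter.
  by case/andP=> /andP[].
have mf Q b : (b \in [seq b <- enum 'I_na | Q b]) = Q b.
  by rewrite mem_filter mem_enum andbT.
move=> b; rewrite in_cons !mf.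
case: (ltngtP b r) => [br|rb|/val_inj ->] /=; rewrite ?eqxx ?Pr ?kr //.
- have -> : (b == r) = false by apply/negbTE; rewrite neq_ltn br.
  rewrite andbF; case Pb: (P b) => //=; apply/negbTE/negP=> kb.
  by have := min b kb br; rewrite Pb.
- have -> : (b == r) = false by apply/negbTE; rewrite neq_ltn rb orbT.
  by rewrite (leq_trans kr (ltnW rb)).
Qed.

(** The leaves still to come, [sols s ++ later s], are the invariant of the search. This lemma
    covers the descent to the first child; the next two cover the move to a sibling and the removal
    of an exhausted arc. *)
Lemma sols_later s (r : 'I_na) : reach s -> valid s r ->
  (forall b : 'I_na, b < r -> ~~ valid s b) ->
  sols s ++ later s = sols (r :: s) ++ later (r :: s).
Proof.
move=> rs vr min; rewrite sols_node //; last by move: vr; rewrite /valid; case: unsat.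
have := @enum_split (valid s) 0 r vr isT (fun b _ => min b).
under eq_filter do rewrite andbT; move=> -> /=.
by rewrite catA.
Qed.

Lemma later_next s (a r : 'I_na) : valid s r -> a < r ->
  (forall b : 'I_na, a < b -> b < r -> ~~ valid s b) ->
  later (a :: s) = sols (r :: s) ++ later (r :: s).
Proof.
by move=> vr ar min /=; rewrite (@enum_split (valid s) a.+1 r) //= catA.
Qed.

Lemma later_pop s (a : 'I_na) : (forall b : 'I_na, a < b -> ~~ valid s b) ->
  later (a :: s) = later s.
Proof.
move=> none /=; rewrite (_ : filter _ _ = [::]) //.
apply/eqP; rewrite -(negbK (_ == _)) -has_filter; apply/hasPn=> b _.
by case ab: (a < b); rewrite ?andbF // andbT none.
Qed.

End Tree.

(** * Arcs of an instance *)

Section Arcs.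
Variable I : instance.
Notation n := (nv I).
Notation m := (ne I).
Notation V := 'I_(nv I).

(** Arc [2j + b] is the [j]-th edge of the input, traversed from its first end
    if [b = 0] and from its second end if [b = 1]. *)
Definition narcs : nat := m.*2.

Lemma half_arc (a : 'I_narcs) : a./2 < size (elist I).
Proof. by case: a => a /= h; rewrite -/m; move: h; rewrite /narcs; lia. Qed.

Definition ed (a : 'I_narcs) : V * V := tnth (in_tuple (elist I)) (Ordinal (half_arc a)).
Definition tl (a : 'I_narcs) : V := if odd a then (ed a).2 else (ed a).1.
Definition hd (a : 'I_narcs) : V := if odd a then (ed a).1 else (ed a).2.

(** Exchanges [2j] and [2j + 1], written with machine operations because [flip_e] has to compute
    it. *)
Definition flip (a : nat) : nat := a + 1 - 2 * (a %% 2).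

Lemma flip_lt (a : 'I_narcs) : flip a < narcs.
Proof. by case: a => a /=; rewrite /flip /narcs; lia. Qed.

Definition flipo (a : 'I_narcs) : 'I_narcs := Ordinal (flip_lt a).

Lemma ed_half (a b : 'I_narcs) : a./2 = b./2 -> ed a = ed b.
Proof. by move=> h; rewrite /ed; congr tnth; apply: val_inj. Qed.

Lemma odd_flip a : odd (flip a) = ~~ odd a.
Proof. rewrite /flip; lia. Qed.
Lemma half_flip a : (flip a)./2 = a./2.
Proof. rewrite /flip; lia. Qed.

Lemma tl_flip a : tl (flipo a) = hd a.
Proof.
by rewrite /tl /hd (@ed_half (flipo a) a (half_flip a)) /= odd_flip; case: odd.
Qed.
Lemma hd_flip a : hd (flipo a) = tl a.
Proof.
by rewrite /tl /hd (@ed_half (flipo a) a (half_flip a)) /= odd_flip; case: odd.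
Qed.

Lemma arc_rev a : exists b, tl b = hd a /\ hd b = tl a.
Proof. by exists (flipo a); rewrite tl_flip hd_flip. Qed.

Lemma eo_ed a : eo tl hd a = [set (ed a).1; (ed a).2].
Proof. by rewrite /eo /tl /hd; case: odd => //; rewrite setUC. Qed.

Lemma eo_nth a : eo tl hd a = nth set0 (edges I) a./2.
Proof.
rewrite eo_ed /ed /edges (tnth_nth (ed a)) /=.
by rewrite (nth_map (ed a)) //; apply: half_arc.
Qed.

Lemma edges_uniq : uniq (edges I).
Proof. by case: I. Qed.

Lemma size_edges : size (edges I) = m.
Proof. exact: size_map. Qed.

Lemma eo_half (a b : 'I_narcs) : (eo tl hd a == eo tl hd b) = (a./2 == b./2).
Proof. by rewrite !eo_nth nth_uniq ?edges_uniq // size_edges half_arc. Qed.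

Lemma ed_neq a : (ed a).1 != (ed a).2.
Proof.
have : all (fun e => e.1 != e.2) (elist I) by case: I.
by move/allP; apply; apply: mem_tnth.
Qed.

(** Arcs with the same ends lie on the same edge because the input repeats no edge, and run in the
    same direction because it has no loops. *)
Lemma arc_inj a b : tl a = tl b -> hd a = hd b -> a = b.
Proof.
move=> ht hh; have hb : a./2 = b./2.
  by apply/eqP; rewrite -eo_half /eo ht hh.
apply: val_inj => /=.
suff oab : odd a = odd b by move: hb oab; move: (nat_of_ord a) (nat_of_ord b); lia.
have := ed_neq a; move: ht; rewrite /tl (ed_half hb).
by case: odd; case: odd => // ->; rewrite eqxx.
Qed.

Notation G := (G tl hd).

Lemma G_edges : G = [set:: edges I].
Proof.
apply/setP=> e; rewrite inE; apply/imsetP/idP => [[a _ ->]|].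
  by rewrite eo_nth mem_nth // size_edges half_arc.
move=> he; have lt : (index e (edges I)).*2 < narcs.
  by rewrite /narcs ltn_double -size_edges index_mem.
by exists (Ordinal lt) => //; rewrite eo_nth /= doubleK nth_index.
Qed.

Lemma card_G : #|G| <= m.
Proof.
by rewrite G_edges -size_edges cardsE; apply: card_size.
Qed.

(** * Layout of the input, and lists of outgoing arcs *)

Notation iw := (input_words I).

Lemma nth_pairs (A : Type) (f g : A -> nat) (l : seq A) d k :
  k./2 < size l ->
  nth 0 (flatten [seq [:: f e; g e] | e <- l]) k =
  if odd k then g (nth d l k./2) else f (nth d l k./2).
Proof.
elim: l k => [|e l IH] // [|[|k]] //= h; rewrite negbK.
exact: IH.
Qed.

Lemma size_pairs (A : Type) (f g : A -> nat) (l : seq A) :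
  size (flatten [seq [:: f e; g e] | e <- l]) = (size l).*2.
Proof. by elim: l => //= e l ->. Qed.

(** The numbering of arcs is made for this: input word [2 + a] is itself the tail of [a], so the
    edge list is never copied. *)
Lemma iw_arc (a : 'I_narcs) : nth 0 iw (2 + a) = tl a.
Proof.
rewrite /input_words /= nth_cat size_pairs.
have -> : a < (size (elist I)).*2 by case: (a).
rewrite add0n (nth_pairs _ _ (ed a)) ?half_arc // /tl {3 4}/ed !(tnth_nth (ed a)) /=.
by case: odd.
Qed.

Lemma size_iw : size iw = 3 + narcs + termsize I.
Proof.
rewrite /input_words /= size_cat size_pairs /= size_flatten /shape -map_comp.
rewrite /narcs /termsize (eq_map (g := fun t => (size t).+1)); last first.
  by move=> t /=; rewrite size_map.
rewrite /ne; lia.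
Qed.

(** One more than the last arc before [b] that leaves [v], or [0]. *)
Fixpoint prevarc (v b : nat) : nat :=
  if b is b'.+1 then
    if nth 0 iw (2 + b') == v then b'.+1 else prevarc v b'
  else 0.

Lemma prevarcS v b :
  prevarc v b.+1 = if nth 0 iw (2 + b) == v then b.+1 else prevarc v b.
Proof. by []. Qed.

Definition outdeg (v b : nat) : nat := count (fun a => nth 0 iw (2 + a) == v) (iota 0 b).

Lemma outdegS v b : outdeg v b.+1 = outdeg v b + (nth 0 iw (2 + b) == v).
Proof. by rewrite /outdeg -[b.+1]addn1 iotaD count_cat /= add0n addn0. Qed.

Lemma prevarcP v b a : prevarc v b = a.+1 ->
  [/\ nth 0 iw (2 + a) = v, a < b, outdeg v b = (outdeg v a).+1 &
      forall c, a < c -> c < b -> nth 0 iw (2 + c) <> v].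
Proof.
elim: b => //= b IH; rewrite outdegS; case: eqP => [hv [<-]|hv h].
  by split=> //; [rewrite addn1|move=> c; lia].
have [h1 h2 h3 h4] := IH h; split=> //; [lia|lia|].
move=> c ac; rewrite ltnS leq_eqVlt => /orP[/eqP->//|]; exact: h4.
Qed.

Lemma prevarc0 v b c : prevarc v b = 0 -> c < b -> nth 0 iw (2 + c) <> v.
Proof.
elim: b => //= b IH; case: eqP => // hv /IH{}IH.
by rewrite ltnS leq_eqVlt => /orP[/eqP->|/IH].
Qed.

(** Every arc is counted at its tail only; this total pays for the arcs scanned in one traversal. *)
Lemma sum_outdeg : \sum_(v : V) outdeg v narcs = narcs.
Proof.
suff main b : b <= narcs -> \sum_(v : V) outdeg v b = b by apply: main.
elim: b => [|b IH] hb; first by rewrite big1.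
pose a := Ordinal hb; have src : nth 0 iw (2 + b) = tl a := iw_arc a.
under eq_bigr do rewrite outdegS src.
rewrite big_split /= IH; last exact: ltnW.
rewrite -[RHS]addn1; congr addn.
rewrite (bigD1 (tl a)) //= eqxx big1 // => v.
by rewrite -val_eqE /= eq_sym => /negbTE ->.
Qed.

End Arcs.

(** * The program *)

Arguments setr : simpl never.
Arguments seta : simpl never.
Arguments arr : simpl never.
Arguments input_words : simpl never.
Arguments flip : simpl never.
Arguments wmax : simpl never.

Notation rN := 0 (only parsing).
Notation rM := 1 (only parsing).
Notation rNA := 2 (only parsing).
Notation rALL := 3 (only parsing).
Notation rr := 4 (only parsing).
Notation rqh := 5 (only parsing).
Notation rqt := 6 (only parsing).
Notation rv := 7 (only parsing).
Notation rp := 8 (only parsing).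
Notation ra := 9 (only parsing).
Notation rx := 10 (only parsing).

(** [aHEAD] and [aNEXT] are the linked lists of the arcs leaving each vertex, [0]
    ending a list and [a + 1] standing for arc [a]; [aFL] flags the chosen edges. *)
Notation aHEAD := 0 (only parsing).
Notation aNEXT := 1 (only parsing).
Notation aMARK := 2 (only parsing).
Notation aQUE := 3 (only parsing).
Notation aFL := 4 (only parsing).

Definition flip_e (e : expr) : expr :=
  Bin Sub (Bin Add e (Cst 1)) (Bin Mul (Cst 2) (Bin Mod e (Cst 2))).
Definition src_e (e : expr) : expr := Inp (Bin Add (Cst 2) e).
Definition dst_e (e : expr) : expr := src_e (flip_e e).

Definition scan_arc : program :=
  Seq (Set_ ra (Bin Sub (Reg rp) (Cst 1)))
  (Seq (If (Bin Add (Arr aFL (Bin Div (Reg ra) (Cst 2))) (Reg rALL))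
           (Seq (Set_ rx (dst_e (Reg ra)))
                (If (Bin Eq (Arr aMARK (Reg rx)) (Cst 0))
                    (Seq (StoreA aMARK (Reg rx) (Bin Add (Reg rr) (Cst 1)))
                    (Seq (StoreA aQUE (Reg rqt) (Reg rx))
                         (Set_ rqt (Bin Add (Reg rqt) (Cst 1)))))
                    Skip))
           Skip)
       (Set_ rp (Arr aNEXT (Reg ra)))).

Definition scan_vertex : program :=
  Seq (Set_ rv (Arr aQUE (Reg rqh)))
  (Seq (Set_ rqh (Bin Add (Reg rqh) (Cst 1)))
  (Seq (Set_ rp (Arr aHEAD (Reg rv)))
       (While (Reg rp) scan_arc))).

(** The queue is shared by all roots and never reset, so it finally lists every vertex reached.
    Labels are roots plus one, 0 meaning unmarked. *)
Definition scan_root : program :=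
  If (Bin Eq (Arr aMARK (Reg rr)) (Cst 0))
     (Seq (StoreA aMARK (Reg rr) (Bin Add (Reg rr) (Cst 1)))
     (Seq (StoreA aQUE (Reg rqt) (Reg rr))
     (Seq (Set_ rqt (Bin Add (Reg rqt) (Cst 1)))
          (While (Bin Lt (Reg rqh) (Reg rqt)) scan_vertex))))
     Skip.

(** Labels in [aMARK] the components of the graph formed by the unmarked vertices
    and the flagged edges (all edges if [rALL] is set). *)
Definition components : program :=
  Seq (Set_ rqh (Cst 0))
  (Seq (Set_ rqt (Cst 0))
  (Seq (Set_ rr (Cst 0))
       (While (Bin Lt (Reg rr) (Reg rN))
              (Seq scan_root (Set_ rr (Bin Add (Reg rr) (Cst 1))))))).

Notation rk := 11 (only parsing).
Notation rcur := 12 (only parsing).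
Notation rcur0 := 13 (only parsing).
Notation rlx := 14 (only parsing).
Notation rly := 15 (only parsing).
Notation rj := 16 (only parsing).
Notation rres := 17 (only parsing).
Notation rfrom := 18 (only parsing).
Notation rta := 19 (only parsing).
Notation rfnd := 20 (only parsing).
Notation rtgt := 30 (only parsing).
Notation rl := 31 (only parsing).

Notation aSTK := 5 (only parsing).
Notation aLAB := 6 (only parsing).
Notation aTP := 7 (only parsing).
Notation aREP := 8 (only parsing).
Notation aTERM := 9 (only parsing).

Definition clear_marks : program :=
  For rj (Reg rN) (StoreA aMARK (Reg rj) (Cst 0)).

(** With the top edge unflagged, one traversal serves twice: it labels the parent's components,
    which determine the tip, and merging the labels at the two ends of the top arc gives the
    components of the node. *)
Definition drop_top : program :=
  If (Reg rk)
     (Seq (Set_ rta (Arr aSTK (Bin Sub (Reg rk) (Cst 1))))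
          (StoreA aFL (Bin Div (Reg rta) (Cst 2)) (Cst 0)))
     Skip.

Definition restore_top : program :=
  If (Reg rk)
     (Seq (StoreA aFL (Bin Div (Reg rta) (Cst 2)) (Cst 1))
     (Seq (Set_ rly (Arr aMARK (src_e (Reg rta))))
          (Set_ rlx (Arr aMARK (dst_e (Reg rta))))))
     Skip.

(** With an empty stack [rlx] is 0, which equals no label, so the labels are copied unchanged. *)
Definition merge_labels : program :=
  For rj (Reg rN)
    (If (Bin Eq (Arr aMARK (Reg rj)) (Reg rlx))
        (Seq (StoreA aLAB (Reg rj) (Reg rly)) (StoreA aTP (Reg rj) (Cst 1)))
        (Seq (StoreA aLAB (Reg rj) (Arr aMARK (Reg rj))) (StoreA aTP (Reg rj) (Cst 0)))).

(** Scanning downwards makes the last assignment the first vertex. [rcur0] is the answer for the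
    parent: the path under construction continues exactly when the stack is nonempty and the two
    agree. *)
Definition find_unsat : program :=
  Seq (Set_ rcur (Reg rN))
  (Seq (Set_ rcur0 (Reg rN))
  (Seq (Set_ rj (Reg rN))
  (While (Reg rj)
     (Seq (Set_ rj (Bin Sub (Reg rj) (Cst 1)))
     (Seq (If (Bin Eq (Arr aLAB (Reg rj)) (Arr aLAB (Arr aREP (Reg rj))))
              Skip (Set_ rcur (Reg rj)))
          (If (Bin Eq (Arr aMARK (Reg rj)) (Arr aMARK (Arr aREP (Reg rj))))
              Skip (Set_ rcur0 (Reg rj)))))))).

Definition restart_tip : program :=
  For rj (Reg rN) (StoreA aTP (Reg rj) (Bin Eq (Arr aLAB (Reg rj)) (Reg rl))).

(** The mark [n + 1] exceeds every label that [components] assigns, so blocked vertices are skipped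
    and never confused with a component. *)
Definition block : program :=
  For rj (Reg rN)
    (If (Bin Eq (Arr aLAB (Reg rj)) (Reg rl))
        (StoreA aMARK (Reg rj) (Bin Add (Reg rN) (Cst 1)))
        (StoreA aMARK (Reg rj) (Cst 0))).

Definition open_node : program :=
  Seq (Set_ rl (Arr aLAB (Reg rcur)))
  (Seq (If (Bin Mul (Bin Lt (Cst 0) (Reg rk)) (Bin Eq (Reg rcur) (Reg rcur0)))
           Skip restart_tip)
  (Seq block
  (Seq (Set_ rALL (Cst 1))
  (Seq components
       (Set_ rtgt (Arr aMARK (Arr aREP (Reg rcur)))))))).

Definition label_node : program :=
  Seq (Set_ rlx (Cst 0))
  (Seq (Set_ rly (Cst 0))
  (Seq drop_top
  (Seq clear_marks
  (Seq (Set_ rALL (Cst 0))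
  (Seq components
  (Seq restore_top merge_labels)))))).

(** Sets [rcur] to the first vertex with an unsatisfied demand ([n] if there is
    none), [aTP] to the vertices from which its path may continue, and makes
    [aMARK] equal to [rtgt] exactly on the vertices connected to the other end of
    the demand outside the blocked component. *)
Definition visit : program :=
  Seq label_node
  (Seq find_unsat
       (If (Bin Lt (Reg rcur) (Reg rN)) open_node Skip)).

(** Validity of an arc is a constant-time test on its ends. The downward scan leaves in [rres] the
    smallest valid arc from [rfrom] on, or the number of arcs if there is none. *)
Definition find_child : program :=
  Seq (Set_ rres (Reg rNA))
  (Seq (Set_ rj (Reg rNA))
  (While (Bin Lt (Reg rfrom) (Reg rj))
     (Seq (Set_ rj (Bin Sub (Reg rj) (Cst 1)))
          (If (Bin Mul (Arr aTP (src_e (Reg rj)))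
                       (Bin Eq (Arr aMARK (dst_e (Reg rj))) (Reg rtgt)))
              (Set_ rres (Reg rj)) Skip)))).

Definition push_arc : program :=
  Seq (StoreA aSTK (Reg rk) (Reg rres))
  (Seq (StoreA aFL (Bin Div (Reg rres) (Cst 2)) (Cst 1))
       (Set_ rk (Bin Add (Reg rk) (Cst 1)))).

Definition pop_arc : program :=
  Seq (Set_ rk (Bin Sub (Reg rk) (Cst 1)))
  (Seq (Set_ rta (Arr aSTK (Reg rk)))
       (StoreA aFL (Bin Div (Reg rta) (Cst 2)) (Cst 0))).

Definition descend : program :=
  While (Bin Lt (Reg rcur) (Reg rN))
    (Seq (Set_ rfrom (Cst 0))
    (Seq find_child
    (Seq push_arc visit))).

Definition backtrack : program :=
  Seq (Set_ rfnd (Cst 0))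
  (While (Bin Mul (Bin Lt (Cst 0) (Reg rk)) (Bin Eq (Reg rfnd) (Cst 0)))
    (Seq pop_arc
    (Seq (Set_ rfrom (Bin Add (Reg rta) (Cst 1)))
    (Seq visit
    (Seq find_child
         (If (Bin Lt (Reg rres) (Reg rNA))
             (Seq push_arc (Set_ rfnd (Cst 1)))
             Skip)))))).

(** [aTP] is reused to flag the vertices to be written; the next [visit] recomputes the tip
    anyway. *)
Definition mark_terminals : program :=
  For rj (Reg rN) (StoreA aTP (Reg rj) (Arr aTERM (Reg rj))).

Definition mark_ends : program :=
  For rj (Reg rM)
    (If (Arr aFL (Reg rj))
        (Seq (StoreA aTP (src_e (Bin Mul (Cst 2) (Reg rj))) (Cst 1))
             (StoreA aTP (dst_e (Bin Mul (Cst 2) (Reg rj))) (Cst 1)))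
        Skip).

Definition emit_loop (y k : nat) (e : expr) : program :=
  For rj (Reg y) (If (Arr k (Reg rj)) (Emit e) Skip).

Definition emit_solution : program :=
  Seq mark_terminals
  (Seq mark_ends
  (Seq (emit_loop rN aTP (Reg rj))
       (emit_loop rM aFL (Bin Add (Reg rN) (Reg rj))))).

(** It begins with [visit] because [backtrack] pushes the next sibling without visiting it. *)
Definition to_leaf : program := Seq visit (Seq descend emit_solution).

Definition round : program := Seq to_leaf (Seq Deliver backtrack).

Notation rq := 21 (only parsing).
Notation rcnt := 22 (only parsing).
Notation rlen := 23 (only parsing).
Notation ru := 24 (only parsing).
Notation rw := 25 (only parsing).
Notation rbad := 26 (only parsing).
Notation rold := 27 (only parsing).
Notation rnew := 28 (only parsing).

Definition build_adjacency : program :=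
  For rj (Reg rNA)
    (Seq (StoreA aNEXT (Reg rj) (Arr aHEAD (src_e (Reg rj))))
         (StoreA aHEAD (src_e (Reg rj)) (Bin Add (Reg rj) (Cst 1)))).

Definition init_rep : program := For rj (Reg rN) (StoreA aREP (Reg rj) (Reg rj)).

Definition relabel : program :=
  For rj (Reg rN)
    (If (Bin Eq (Arr aREP (Reg rj)) (Reg rold)) (StoreA aREP (Reg rj) (Reg rnew)) Skip).

Definition merge_class : program :=
  Seq (Set_ rold (Arr aREP (Reg rw)))
  (Seq (Set_ rnew (Arr aREP (Reg ru))) relabel).

(** Each terminal is compared with the first one of its set. The pass over all vertices is made only
    when two classes really merge. Terminals of one set in different components of the graph raise
    [rbad], and then nothing is output. *)
Definition read_terminal : program :=
  Seq (Set_ rw (Inp (Reg rq)))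
  (Seq (Set_ rq (Bin Add (Reg rq) (Cst 1)))
  (Seq (Set_ rlen (Bin Sub (Reg rlen) (Cst 1)))
  (Seq (StoreA aTERM (Reg rw) (Cst 1))
       (If (Bin Eq (Arr aMARK (Reg rw)) (Arr aMARK (Reg ru)))
           (If (Bin Eq (Arr aREP (Reg rw)) (Arr aREP (Reg ru))) Skip merge_class)
           (Set_ rbad (Cst 1)))))).

Definition read_set : program :=
  Seq (Set_ rcnt (Bin Sub (Reg rcnt) (Cst 1)))
  (Seq (Set_ rlen (Inp (Reg rq)))
  (Seq (Set_ rq (Bin Add (Reg rq) (Cst 1)))
       (If (Reg rlen)
           (Seq (Set_ ru (Inp (Reg rq))) (While (Reg rlen) read_terminal))
           Skip))).

Definition read_terminals : program :=
  Seq (Set_ rq (Bin Add (Cst 2) (Reg rNA)))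
  (Seq (Set_ rcnt (Inp (Reg rq)))
  (Seq (Set_ rq (Bin Add (Reg rq) (Cst 1)))
       (While (Reg rcnt) read_set))).

Definition preprocess : program :=
  Seq (Set_ rN (Inp (Cst 0)))
  (Seq (Set_ rM (Inp (Cst 1)))
  (Seq (Set_ rNA (Bin Mul (Cst 2) (Reg rM)))
  (Seq build_adjacency
  (Seq (Set_ rALL (Cst 1))
  (Seq components
  (Seq init_rep
       read_terminals)))))).

Definition steiner_enum : program :=
  Seq preprocess
      (If (Reg rbad) Skip (Seq (Set_ rfnd (Cst 1)) (While (Reg rfnd) round))).

(** * Component labels *)

Section Machine.
Variables (I : instance) (M : machine).
Notation n := (nv I).
Notation m := (ne I).
Notation V := 'I_(nv I).
Notation na := (narcs I).
Notation L := (2 * (n + m)).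
Notation tl := (@tl I).
Notation hd := (@hd I).
Notation eo := (eo tl hd).
Notation G := (G tl hd).
Notation iw := (input_words I).
Notation W := (wmax M).
Hypothesis Min : minput M = iw.
Hypothesis W16 : 16 %| W.
Hypothesis Lcells : L * 16 <= mcells M.
Hypothesis Wbig : 64 * (n + m + termsize I + 4) <= W.

Lemma Lword : L * 16 + 32 <= W.
Proof. lia. Qed.

Lemma na_def : na = 2 * m. Proof. rewrite /narcs; lia. Qed.

Lemma run_bound p st T T' Q : run M p st T Q -> T <= T' -> run M p st T' Q.
Proof. by move=> h le; apply: run_le h le _. Qed.

Lemma ev_eq st e v v' : ev M st e v -> v = v' -> ev M st e v'.
Proof. by move=> h <-. Qed.

Lemma ev_lt st e1 e2 a b : ev M st e1 a -> ev M st e2 b ->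
  ev M st (Bin Lt e1 e2) (a < b).
Proof. by move=> h1 h2; apply: (@ev_bin M st Lt _ _ _ _ h1 h2); rewrite /=; have := leq_b1 (a < b); lia. Qed.

Lemma ev_eqb st e1 e2 (a b : nat) : ev M st e1 a -> ev M st e2 b ->
  ev M st (Bin Eq e1 e2) (a == b).
Proof. by move=> h1 h2; apply: (@ev_bin M st Eq _ _ _ _ h1 h2); rewrite /=; have := leq_b1 (a == b); lia. Qed.

Lemma ev_add st e1 e2 a b : ev M st e1 a -> ev M st e2 b -> a + b < W ->
  ev M st (Bin Add e1 e2) (a + b).
Proof. by move=> h1 h2; apply: (@ev_bin M st Add _ _ _ _ h1 h2). Qed.

Lemma ev_sub st e1 e2 a b : ev M st e1 a -> ev M st e2 b -> a - b < W ->
  ev M st (Bin Sub e1 e2) (a - b).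
Proof. by move=> h1 h2; apply: (@ev_bin M st Sub _ _ _ _ h1 h2). Qed.

Lemma ev_mul st e1 e2 a b : ev M st e1 a -> ev M st e2 b -> a * b < W ->
  ev M st (Bin Mul e1 e2) (a * b).
Proof. by move=> h1 h2; apply: (@ev_bin M st Mul _ _ _ _ h1 h2). Qed.

Lemma ev_half st e a : ev M st e a -> a < W -> ev M st (Bin Div e (Cst 2)) a./2.
Proof.
move=> h aW; rewrite -divn2.
by apply: (@ev_bin _ _ Div) h (ev_cst _ _) _; rewrite /=; lia.
Qed.

Lemma ev_arrL st k e i : ev M st e i -> i < L -> k < 16 -> ev M st (Arr k e) (arr st k i).
Proof. exact: (ev_arr W16 Lcells Lword). Qed.

Lemma run_storeL st k e1 e2 i v (Q : state -> Prop) :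
  ev M st e1 i -> ev M st e2 v -> i < L -> k < 16 -> Q (seta st k i v) ->
  run M (StoreA k e1 e2) st (esize e1 + esize e2 + 5) Q.
Proof. move=> h1 h2 iL k16; exact: (run_store W16 Lcells Lword h1 iL k16 h2). Qed.

Definition run_whileL inv Q e body st P0 :=
  @run_while M W16 inv Q e body st P0.
Definition run_forL inv x y body st N T :=
  @run_for M W16 _ Lcells Lword inv x y body st N T.

Lemma vL (v : V) : v < L. Proof. by have := ltn_ord v; lia. Qed.
Lemma arc_lt (a : 'I_na) : a < 2 * m.
Proof. by have := ltn_ord a; have := na_def; lia. Qed.
Lemma aL (a : 'I_na) : a < L. Proof. by have := arc_lt a; lia. Qed.
Lemma haL (a : 'I_na) : a./2 < L. Proof. by have := aL a; lia. Qed.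

Lemma ev_input st e a : ev M st e a -> a < size iw -> nth 0 iw a < W ->
  ev M st (Inp e) (nth 0 iw a).
Proof. by rewrite -Min; apply: ev_inp. Qed.

Lemma ev_src st e (a : 'I_na) : ev M st e a -> ev M st (src_e e) (tl a).
Proof.
move=> h; have ha := arc_lt a.
apply: (@ev_eq _ _ (nth 0 iw (2 + a))); last exact: iw_arc.
apply: ev_input.
- by apply: ev_add h _; [apply: ev_cst|]; lia.
- by rewrite size_iw; have := na_def; lia.
- by rewrite iw_arc; have := ltn_ord (tl a); lia.
Qed.

Lemma ev_dst st e (a : 'I_na) : ev M st e a -> ev M st (dst_e e) (hd a).
Proof.
move=> h; have ha := arc_lt a.
rewrite -tl_flip; apply: ev_src.
have c k : k < 64 -> ev M st (Cst k) k by move=> hk; apply: ev_cst; lia.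
have e1 : ev M st (Bin Add e (Cst 1)) (a + 1) by apply: ev_add h (c 1 isT) _; lia.
have e2 : ev M st (Bin Mod e (Cst 2)) (a %% 2).
  by apply: (@ev_bin M st Mod _ _ _ _ h (c 2 isT)); rewrite /=; lia.
have e3 := ev_mul (c 2 isT) e2.
by apply: ev_sub e1 (e3 _) _; lia.
Qed.

Ltac evt := first
  [ apply: ev_cst; lia
  | apply: ev_reg
  | apply: ev_lt; evt
  | apply: ev_eqb; evt
  | apply: ev_half; [evt|]
  | apply: ev_arrL; [evt| |by []]
  | apply: ev_add; [evt|evt|]
  | apply: ev_sub; [evt|evt|]
  | apply: ev_mul; [evt|evt|] ].

Record Env (st : state) : Prop := MkEnv {
  envN : regs st rN = n;
  envM : regs st rM = m;
  envNA : regs st rNA = na;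
  envHEAD : forall v : V, arr st aHEAD v = prevarc I v na;
  envNEXT : forall a : 'I_na, arr st aNEXT a = prevarc I (tl a) a }.

Lemma Env_fr rs ks st st' : fr rs ks st st' -> Env st ->
  all (fun x => x \notin rs) [:: rN; rM; rNA] ->
  all (fun k => k \notin ks) [:: aHEAD; aNEXT] -> Env st'.
Proof.
move=> [fR fA] [h1 h2 h3 h4 h5] /and4P[k1 k2 k3 _] /and3P[k4 k5 _].
by split=> [|||v|a]; rewrite ?fR ?fA.
Qed.

Section Components.
Variables (E : {set {set V}}) (mk0 : V -> nat).
Hypothesis EG : E \subset G.
Notation S := [set v | mk0 v != 0].

Definition cl (s : state) (v : V) : Prop :=
  forall u, mk0 u = 0 -> [set v; u] \in E -> arr s aMARK u = arr s aMARK v.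

(** Here [q] is the whole history of the queue and its first [k] entries are scanned. By [b_cl], an
    entry whose neighbourhood is not yet settled carries the label of the current root [r]; this is
    what makes labels of different roots separate components. *)
Record bfs (r : nat) (s : state) (q : seq V) (k : nat) : Prop := Bfs {
  b_uniq : uniq q;
  b_qt : regs s rqt = size q;
  b_que : forall j, j < size q -> arr s aQUE j = nth 0 (map val q) j;
  b_keep : forall v, mk0 v != 0 -> arr s aMARK v = mk0 v;
  b_q : forall v, v \in q -> mk0 v = 0;
  b_mark : forall v, mk0 v = 0 -> (arr s aMARK v != 0) = (v \in q);
  b_root : forall v, v \in q -> exists rho : V,
     [/\ mk0 rho = 0, arr s aMARK v = rho.+1 & connA E S rho v];
  b_done : forall v, v \in take k q -> cl s v;
  b_cl : forall v, v \in q -> cl s v \/ arr s aMARK v = r.+1 }.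

Lemma bfs_size r s q k : bfs r s q k -> size q <= n.
Proof.
move=> b; rewrite -(card_uniqP (b_uniq b)) -[X in _ <= X]card_ord.
exact: max_card.
Qed.

Lemma fr_setr st x v : fr [:: x] [::] st (setr st x v).
Proof. by split=> // y; rewrite inE regs_setr => /negbTE ->. Qed.

Lemma fr_seta st k i v : k < 16 -> fr [::] [:: k] st (seta st k i v).
Proof.
by move=> k16; split=> // k' j; rewrite inE => /negbTE ne k'16; rewrite arr_seta // ne.
Qed.

Lemma bfs_fr (r : nat) s s' q k : bfs r s q k ->
  regs s' rqt = regs s rqt ->
  (forall j, j < size q -> arr s' aQUE j = arr s aQUE j) ->
  (forall v : V, arr s' aMARK v = arr s aMARK v) -> bfs r s' q k.
Proof.
move=> [h1 h2 h3 h4 h5 h6 h7 h8 h9] eqt eq em; split=> //.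
- by rewrite eqt.
- by move=> j hj; rewrite eq // h3.
- by move=> v; rewrite em; apply: h4.
- by move=> v; rewrite em; apply: h6.
- by move=> v; rewrite em; apply: h7.
- by move=> v vq u; rewrite !em; apply: h8.
- by move=> v vq; rewrite em; case: (h9 v vq) => c; [left=> u; rewrite !em; apply: c|right].
Qed.

Lemma bfs_push (r x : V) s s' q k : bfs r s q k -> k <= size q ->
  mk0 r = 0 -> mk0 x = 0 -> arr s aMARK x = 0 -> connA E S r x ->
  regs s' rqt = (size q).+1 ->
  (forall j, arr s' aQUE j = if j == size q then val x else arr s aQUE j) ->
  (forall v : V, arr s' aMARK v = if v == x then r.+1 else arr s aMARK v) ->
  bfs r s' (rcons q x) k.
Proof.
move=> b kq r0 x0 mx cx qt qe me; have [h1 h2 h3 h4 h5 h6 h7 h8 h9] := b.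
have xq : x \notin q by rewrite -h6 // mx.
have qne v : v \in q -> (v == x) = false by move=> vq; apply: contraNF xq => /eqP <-.
(* A closed vertex has no edge to [x]: its neighbours carry its own nonzero mark, while [x] was
   unmarked. *)
have keep v : v \in q -> cl s v -> cl s' v.
  move=> vq c u u0 vu; rewrite !me (qne _ vq); case: eqP => [ux|_]; last exact: c.
  have := c _ u0 vu; rewrite ux mx => /esym/eqP; rewrite -[_ == _]negbK h6 ?vq //.
  exact: h5.
split.
- by rewrite rcons_uniq xq.
- by rewrite size_rcons.
- move=> j; rewrite size_rcons map_rcons nth_rcons size_map ltnS qe.
  case: ltngtP => //; by move=> jq _; apply: h3.
- move=> v v0; rewrite me; case: eqP => [vx|_]; last exact: h4.
  by rewrite vx x0 in v0.
- by move=> v; rewrite mem_rcons inE => /orP[/eqP->//|/h5].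
- move=> v v0; rewrite me mem_rcons in_cons; case: (v =P x) => //= _; exact: h6.
- move=> v; rewrite mem_rcons in_cons me; case: (v =P x) => [->|_] /=; last exact: h7.
  by exists r.
- move=> v; rewrite -cats1 takel_cat // => vt.
  by apply: keep; [apply: mem_take vt|apply: h8].
- move=> v; rewrite mem_rcons in_cons me; case: (v =P x) => [_|_] /=; first by right.
  by move=> vq; case: (h9 v vq); [left; apply: keep|right].
Qed.

(** Credit of a vertex not yet scanned: 100 units for each outgoing arc and 2 for its loop test,
    then 24 for the vertex and 4 for the test of the queue, rounded up. Vertices not yet reached
    keep their credit, so all roots share one budget. *)
Definition weight (v : nat) : nat := 110 * outdeg I v na + 30.
Definition pot (q : seq V) (k : nat) : nat :=
  \sum_(v : V | v \notin take k q) weight v.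

Lemma pot_next q k (v : V) : uniq q -> k < size q -> nth 0 (map val q) k = v ->
  pot q k = weight v + pot q k.+1.
Proof.
move=> uq kq; rewrite (nth_map v) // => /val_inj nv.
have tk : take k.+1 q = rcons (take k q) v by rewrite (take_nth v) // nv.
rewrite /pot tk (bigD1 v) /=; last first.
  have : uniq (take k.+1 q) by apply: take_uniq.
  by rewrite tk rcons_uniq => /andP[].
congr addn; apply: eq_bigl => u; rewrite mem_rcons inE negb_or andbC.
by [].
Qed.

Lemma pot_total : pot [::] 0 <= 220 * m + 30 * n.
Proof.
rewrite /pot /weight big_split /= sum_nat_const.
have -> : #|[pred i : V | i \notin [::]]| = n by rewrite -[RHS]card_ord; apply: eq_card.
rewrite -big_distrr /= (eq_bigl predT) // sum_outdeg na_def; lia.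
Qed.

Section Loops.
Variables (st0 : state) (all : nat).
Hypothesis env0 : Env st0.
Hypothesis fl1 : forall a : 'I_na, arr st0 aFL a./2 <= 1.
Hypothesis all0 : regs st0 rALL = all.
Hypothesis all1 : all <= 1.
Hypothesis flE : forall a : 'I_na, (arr st0 aFL a./2 + all != 0) = (eo a \in E).

Definition wrc := [:: rr; rqh; rqt; rv; rp; ra; rx].
Definition base (s : state) : Prop := fr wrc [:: aMARK; aQUE] st0 s.

Lemma base_env s : base s -> Env s.
Proof. by move=> f; apply: Env_fr f env0 _ _. Qed.

Lemma base_fr s s' rs ks : base s -> fr rs ks s s' ->
  seq.all (fun x => x \in wrc) rs -> seq.all (fun x => x \in [:: aMARK; aQUE]) ks ->
  base s'.
Proof.
move=> f f' /allP h1 /allP h2; apply: fr_trans f _; exact: fr_sub f' h1 h2.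
Qed.

(** The arcs of [v] from [b] on have been treated. Each call passes exactly one outgoing arc, which
    is recorded by [outdeg] dropping by one and pays for the call. *)
Lemma scan_arc_ok (r v : V) s q k (b : nat) :
  base s -> bfs r s q k -> k <= size q -> v \in q -> mk0 r = 0 -> regs s rr = r ->
  regs s rp = prevarc I v b -> b <= na -> prevarc I v b != 0 ->
  (forall c : 'I_na, b <= c -> tl c = v -> eo c \in E -> mk0 (hd c) = 0 ->
     arr s aMARK (hd c) = arr s aMARK v) ->
  run M scan_arc s 100 (fun s' => exists q' (b' : nat),
    [/\ [/\ bfs r s' q' k, exists w, q' = q ++ w & regs s' rp = prevarc I v b'],
       b' < b, (outdeg I v b').+1 = outdeg I v b, arr s' aMARK v = arr s aMARK v &
       forall c : 'I_na, b' <= c -> tl c = v -> eo c \in E -> mk0 (hd c) = 0 ->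
          arr s' aMARK (hd c) = arr s' aMARK v]).
Proof.
move=> bs B kq vq r0 hr hp bna; case pa: prevarc => [//|a] _ clos.
have [src ab deg gap] := prevarcP pa.
have na2 := na_def; have ana : a < na by lia.
pose ao : 'I_na := Ordinal ana.
have tla : tl ao = v by apply: ord_inj; rewrite -(iw_arc ao) -src.
pose x := hd ao.
have eox : eo ao = [set v; x] by rewrite /eo tla.
have v0 : mk0 v = 0 := b_q B vq.
have mvn : arr s aMARK v != 0 by rewrite (b_mark B).
have closc (mk : V -> nat) : (forall u : V, arr s aMARK u != 0 -> mk u = arr s aMARK u) ->
    (eo ao \in E -> mk0 x = 0 -> mk x = mk v) ->
    forall c : 'I_na, a <= c -> tl c = v -> eo c \in E -> mk0 (hd c) = 0 ->
      mk (hd c) = mk v.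
  move=> keep hx c; rewrite leq_eqVlt => /orP[/eqP ac|ac] tc ce h0.
    have ? : c = ao by apply: ord_inj.
    by subst c; apply: hx.
  have bc : b <= c.
    by rewrite leqNgt; apply/negP=> cb; apply: (gap _ ac cb); rewrite iw_arc tc.
  by have h := clos _ bc tc ce h0; rewrite !keep ?h.
pose P s2 := [/\ base s2, regs s2 ra = a & exists q',
  [/\ bfs r s2 q' k, exists w, q' = q ++ w &
      arr s2 aMARK v = arr s aMARK v /\
      forall c : 'I_na, a <= c -> tl c = v -> eo c \in E -> mk0 (hd c) = 0 ->
          arr s2 aMARK (hd c) = arr s2 aMARK v]].
rewrite /scan_arc; apply: run_bound.
apply: run_seq; apply: run_set; first by evt; rewrite hp pa; lia.
rewrite hp pa subn1 /=; set s1 := setr _ _ _.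
have b1 : base s1 by apply: base_fr bs (fr_setr _ _ _) _ _.
have a1 : regs s1 ra = a by [].
apply: run_seq; apply: (run_conseq (Q' := P)); first last.
  move=> s2 [b2 a2 [q' [B' qq' [mv2 clos2]]]].
  have [_ _ _ _ NX] := base_env b2.
  apply: run_set; first by evt; rewrite a2; apply: (aL ao).
  exists q', a; split=> //; split=> //; first exact: bfs_fr B' _ _ _.
  by rewrite regs_setr /= a2 (NX ao) tla.
have evfl : ev M s1 (Bin Add (Arr aFL (Bin Div (Reg ra) (Cst 2))) (Reg rALL))
   (arr st0 aFL ao./2 + all).
  have -> : arr st0 aFL ao./2 = arr s1 aFL ao./2 by rewrite b1.2.
  rewrite -all0 -(b1.1 rALL) //; evt.
  - by have := aL ao; rewrite /=; lia.
  - exact: (haL ao).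
  - by rewrite b1.2 // b1.1 // all0; have := fl1 ao; rewrite /=; lia.
apply: run_if evfl _ _ => [|/eqP];
  [rewrite flE => aE|rewrite -[_ == 0]negbK flE => aE]; last first.
  apply: run_skip; split=> //; exists q; split; [exact: bfs_fr B _ _ _|by exists [::]; rewrite cats0|].
  split=> //; apply: (closc (fun u : V => arr s1 aMARK u)) => //; by move=> eE; rewrite eE in aE.
apply: run_seq; apply: run_set; first by apply: (@ev_dst _ _ ao); exact: ev_reg.
set s2 := setr _ _ _.
have b2 : base s2 by apply: base_fr b1 (fr_setr _ _ _) _ _.
have x2 : regs s2 rx = x by [].
apply: run_if; first by evt; rewrite x2; apply: vL.
- rewrite x2 eqb0 negbK => /eqP mx; have mxs : arr s aMARK x = 0 := mx.
  have x0 : mk0 x = 0.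
    by apply/eqP; apply: contraTT isT => h; have := b_keep B h; rewrite mxs => h'; rewrite -h' in h.
  (* Otherwise [v] would be closed and its neighbour [x] already marked. *)
  have mvr : arr s aMARK v = r.+1.
    have [c|//] := b_cl B vq; move: mvn; rewrite -(c x) // -?eox //.
    by rewrite mxs.
  have cx : connA E S r x.
    have [rho [rho0 mr c]] := b_root B vq; rewrite mvr in mr; case: mr => /ord_inj hrho.
    rewrite hrho; apply: connect_trans c _; apply: connect1.
    by rewrite /= -eox aE !inE v0 x0.
  have szq := bfs_size B.
  have qt2 : regs s2 rqt = size q by rewrite -(b_qt B).
  have szn : size q < n.
    rewrite -[X in _ < X]card_ord -(card_uniqP (b_uniq B)); apply: proper_card.
    apply/properP; split; first by apply/subsetP.
    by exists x => //; rewrite -(b_mark B) // mxs.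
  have rr2 : regs s2 rr = r by rewrite -hr.
  apply: run_seq; apply: run_storeL.
  - by evt.
  - by evt; rewrite rr2; have := ltn_ord r; lia.
  - by rewrite x2; apply: vL.
  - by [].
  rewrite x2 rr2; set s3 := seta _ _ _ _.
  have b3 : base s3 by apply: base_fr b2 (fr_seta _ _ _ _) _ _.
  apply: run_seq; apply: run_storeL; [by evt|by evt| |by []|].
    by rewrite [regs s3 rqt]qt2; lia.
  rewrite [regs s3 rqt]qt2 [regs s3 rx]x2; set s4 := seta _ _ _ _.
  have b4 : base s4 by apply: base_fr b3 (fr_seta _ _ _ _) _ _.
  apply: run_set; first by evt; rewrite [regs s4 rqt]qt2; lia.
  rewrite [regs s4 rqt]qt2; set s5 := setr _ _ _.
  have b5 : base s5 by apply: base_fr b4 (fr_setr _ _ _) _ _.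
  have m5 (u : V) : arr s5 aMARK u = if u == x then r.+1 else arr s aMARK u.
    rewrite arr_setr /s4 arr_seta //= /s3 arr_seta //= -val_eqE /=.
    by rewrite addn1.
  have q5 j : arr s5 aQUE j = if j == size q then val x else arr s aQUE j.
    by rewrite arr_setr /s4 arr_seta //= /s3 arr_seta.
  split=> //; exists (rcons q x); split.
  + apply: (bfs_push B) => //; by rewrite regs_setr /= addn1.
  + by exists [:: x]; rewrite cats1.
  + have xv : (v == x) = false.
      by apply/negbTE/eqP=> vx; move: mvn; rewrite vx mxs.
    split; first by rewrite m5 xv.
    apply: (closc (fun u : V => arr s5 aMARK u)).
      by move=> u; rewrite m5; case: (u =P x) => // ->; rewrite mxs.
    by move=> _ _; rewrite !m5 eqxx xv mvr.
- rewrite x2 => /eqP; rewrite eqb0 => mx; apply: run_skip; split=> //.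
  exists q; split; [exact: bfs_fr B _ _ _|by exists [::]; rewrite cats0|].
  split=> //; apply: (closc (fun u : V => arr s2 aMARK u)) => // _ x0.
  (* Both ends are in the queue. If one of them is closed, the marks agree; otherwise both carry the
     current label [r + 1]. *)
  have xq : x \in q by rewrite -(b_mark B).
  have xv : [set x; v] \in E by rewrite setUC -eox.
  have vx : [set v; x] \in E by rewrite -eox.
  have [c|e1] := b_cl B xq; first exact: esym (c _ v0 xv).
  by have [c|e2] := b_cl B vq; [exact: c|rewrite [LHS]e1 [RHS]e2].
by [].
Qed.

Lemma bfs_done (r : nat) s q k (v : V) : bfs r s q k -> k < size q ->
  nth 0 (map val q) k = v -> cl s v -> bfs r s q k.+1.
Proof.
move=> [h1 h2 h3 h4 h5 h6 h7 h8 h9] kq nv c; split=> // u.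
move: nv; rewrite (nth_map v) // => /ord_inj nv.
rewrite (take_nth v) // nv mem_rcons in_cons => /orP[/eqP->//|].
exact: h8.
Qed.

(** Once the queue is exhausted every entry is closed, so the invariant no longer depends on the
    root. *)
Lemma bfs_root (r r' : nat) s q : bfs r s q (size q) -> bfs r' s q (size q).
Proof.
move=> [h1 h2 h3 h4 h5 h6 h7 h8 h9]; split=> // v vq; left; apply: h8.
by rewrite take_size.
Qed.

Lemma scan_vertex_ok (r v : V) s q k :
  base s -> bfs r s q k -> k < size q -> mk0 r = 0 -> regs s rr = r ->
  regs s rqh = k -> nth 0 (map val q) k = v ->
  run M scan_vertex s (110 * outdeg I v na + 24) (fun s' => exists q',
    [/\ bfs r s' q' k.+1, regs s' rqh = k.+1 & exists w, q' = q ++ w]).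
Proof.
move=> bs B kq r0 hr hk nv; have na2 := na_def; have szq := bfs_size B.
have vq : v \in q.
  by move: nv; rewrite (nth_map v) // => /ord_inj <-; apply: mem_nth.
rewrite /scan_vertex; apply: run_bound.
apply: run_seq; apply: run_set; first by evt; rewrite hk; lia.
rewrite hk (b_que B) // nv; set s1 := setr _ _ _.
apply: run_seq; apply: run_set; first by evt; rewrite [regs s1 _]hk; lia.
rewrite [regs s1 _]hk; set s2 := setr _ _ _.
have b2 : base s2.
  apply: base_fr (fr_setr _ _ _) _ _ => //; exact: base_fr bs (fr_setr _ _ _) _ _.
have [_ _ _ HE _] := base_env b2.
apply: run_seq; apply: run_set; first by evt; rewrite [regs s2 _]/(val v); apply: vL.
rewrite [regs s2 _]/(val v) HE; set s3 := setr _ _ _.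
have b3 : base s3 by apply: base_fr b2 (fr_setr _ _ _) _ _.
have B3 : bfs r s3 q k by apply: bfs_fr B _ _ _.
pose inv P s := exists q' (b : nat), [/\
  [/\ bfs r s q' k, exists w, q' = q ++ w & regs s rp = prevarc I v b],
  b <= na, P = 110 * outdeg I v b &
  forall c : 'I_na, b <= c -> tl c = v -> eo c \in E -> mk0 (hd c) = 0 ->
     arr s aMARK (hd c) = arr s aMARK v].
pose Q s := exists q', bfs r s q' k.+1 /\ exists w, q' = q ++ w.
apply: (run_conseq (Q' := fun s => Q s /\ fr (wr scan_arc) (wa scan_arc) s3 s)).
  apply: (@run_whileL inv Q _ _ _ (110 * outdeg I v na)) => //.
    move=> P t ft [q' [b [[B' [w qw] hp] bna -> clos]]].
    have kq' : k < size q' by rewrite qw size_cat; lia.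
    have bt : base t by apply: base_fr b3 ft _ _.
    have vq' : nth 0 (map val q') k = v.
      by rewrite qw map_cat nth_cat size_map kq.
    exists (regs t rp); split; first exact: ev_reg.
      rewrite hp => p0; exists q'; split; last by exists w.
      apply: bfs_done B' _ vq' _ => //.
      (* The list of [v] is exhausted: no arc of [v] lies below [b], so the invariant covers all its
         neighbours. *)
      move=> u u0 vu; have [c [tc hc]] := G_arc (@arc_rev I) (subsetP EG _ vu).
      rewrite -hc; apply: clos; rewrite ?hc //; last by rewrite /eo tc hc.
      rewrite leqNgt; apply/negP=> cb; apply: (prevarc0 p0 cb).
      by rewrite iw_arc tc.
    rewrite hp => pn; exists 100.
    have vin : v \in q'.
      by move: vq'; rewrite (nth_map v) // => /ord_inj <-; apply: mem_nth.
    have rt : regs t rr = r by rewrite ft.1.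
    have kq2 := ltnW kq'.
    apply: (run_conseq (scan_arc_ok bt B' kq2 vin r0 rt hp bna pn clos)).
    move=> t' [q2 [b2' [[B2 [w' qw'] hp2] lb deg mv clos2]]].
    exists (110 * outdeg I v b2'); split; last by rewrite -deg /=; lia.
    exists q2, b2'; split=> //; last by lia.
    by split=> //; exists (w ++ w'); rewrite qw' qw catA.
  exists q, na; split=> // [|c]; last by rewrite leqNgt ltn_ord.
  by split=> //; exists [::]; rewrite cats0.
  move=> t [[q' [B' qw]] ft]; exists q'; split=> //.
  have -> : regs t rqh = regs s3 rqh := ft.1 rqh isT.
  by rewrite -[k.+1]addn1.
by rewrite /=; lia.
Qed.

Lemma scan_queue_ok (r : V) s q k :
  base s -> bfs r s q k -> k <= size q -> mk0 r = 0 -> regs s rr = r ->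
  regs s rqh = k ->
  runx M (While (Bin Lt (Reg rqh) (Reg rqt)) scan_vertex) s (fun T s' =>
    exists q', [/\ bfs r s' q' (size q'), regs s' rqh = size q',
       T + pot q' (size q') <= pot q k + 4, {subset q <= q'} & base s']).
Proof.
move=> bs B kq r0 hr hk.
pose inv P s := exists q' k', [/\ bfs r s q' k', k' <= size q', regs s rqh = k',
  P = pot q' k' & {subset q <= q'}].
pose Q P s := exists q', [/\ bfs r s q' (size q'), regs s rqh = size q',
  P = pot q' (size q') & {subset q <= q'}].
have i0 : inv (pot q k) s by exists q, k; split.
have := @runx_while M W16 inv Q (Bin Lt (Reg rqh) (Reg rqt)) scan_vertex s _ isT _ i0.
case.
  move=> P t ft [q' [k' [B' kq' hk' -> sub]]].
  have bt : base t by apply: base_fr bs ft _ _.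
  exists (k' < size q'); split.
  - by rewrite -hk' -(b_qt B'); evt.
  - move=> /eqP; rewrite eqb0 -leqNgt => le; have ek : k' = size q' by lia.
    by exists q'; split=> //; rewrite -?ek.
  rewrite eqb0 negbK => lt.
  case def_q : q' lt => [//|d q''] lt; rewrite -def_q in lt *.
  pose v := nth d q' k'.
  have nv : nth 0 (map val q') k' = v by rewrite (nth_map d).
  have rt : regs t rr = r by rewrite (ft.1 rr isT).
  apply: (run_runx (scan_vertex_ok bt B' lt r0 rt hk' nv)) => t' [q2 [B2 hk2 [w qw]]].
  exists (pot q2 k'.+1); split.
    exists q2, k'.+1; split=> //; first by rewrite qw size_cat; lia.
    by move=> z /sub zq; rewrite qw mem_cat zq.
  by rewrite (pot_next (b_uniq B') lt nv) /pot qw takel_cat // /weight /=; lia.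
move=> T h; exists T; apply: (run_conseq h) => t [P [[q' [B' hq' -> sub]] ft le]].
exists q'; split=> //; exact: base_fr bs ft _ _.
Qed.

Lemma scan_root_ok (r : V) s q :
  base s -> bfs r s q (size q) -> regs s rr = r -> regs s rqh = size q ->
  runx M scan_root s (fun T s' => exists q',
    [/\ bfs r s' q' (size q'), regs s' rqh = size q',
       T + pot q' (size q') <= pot q (size q) + 40,
       {subset q <= q'} & mk0 r = 0 -> r \in q']).
Proof.
move=> bs B hr hk; have szq := bfs_size B; have rn := ltn_ord r.
apply: runx_if; first by evt; rewrite hr; apply: vL.
  rewrite hr eqb0 negbK => /eqP mr.
  have r0 : mk0 r = 0.
    apply/eqP; apply: contraTT isT => h; have := b_keep B h.
    by rewrite mr => h'; rewrite -h' in h.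
  have szn : size q < n.
    rewrite -[X in _ < X]card_ord -(card_uniqP (b_uniq B)); apply: proper_card.
    apply/properP; split; first by apply/subsetP.
    by exists r => //; rewrite -(b_mark B) // mr.
  apply: runx_seq; apply: run_runx.
    apply: run_storeL; [by evt|by evt; rewrite hr; lia|by rewrite hr; apply: vL|by []|].
    by rewrite hr; apply: erefl.
  move=> _ <-; set s1 := seta _ _ _ _.
  have b1 : base s1 by apply: base_fr bs (fr_seta _ _ _ _) _ _.
  have qt1 : regs s1 rqt = size q by rewrite -(b_qt B).
  have r1 : regs s1 rr = r by rewrite -hr.
  apply: runx_seq; apply: run_runx.
    apply: run_storeL; [by evt|by evt|by rewrite qt1; lia|by []|].
    by rewrite qt1 r1; apply: erefl.
  move=> _ <-; set s2 := seta _ _ _ _.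
  have b2 : base s2 by apply: base_fr b1 (fr_seta _ _ _ _) _ _.
  apply: runx_seq; apply: run_runx.
    apply: run_set; first by evt; rewrite [regs s2 _]qt1; lia.
    by rewrite [regs s2 _]qt1; apply: erefl.
  move=> _ <-; set s3 := setr _ _ _.
  have b3 : base s3 by apply: base_fr b2 (fr_setr _ _ _) _ _.
  have B3 : bfs r s3 (rcons q r) (size q).
    apply: (bfs_push B) => //.
    - exact: connect0.
    - by rewrite regs_setr /= addn1.
    - by move=> j; rewrite arr_setr arr_seta //= arr_seta.
    - move=> u; rewrite arr_setr arr_seta //= arr_seta //= -val_eqE /=.
      by rewrite addn1.
  have kq : size q <= size (rcons q r) by rewrite size_rcons.
  have [T h] := scan_queue_ok b3 B3 kq r0 r1 hk.
  exists T; apply: (run_conseq h) => t [q' [B' hq' le sub bt]].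
  exists q'; split=> //.
  - have : pot (rcons q r) (size q) = pot q (size q).
      by rewrite /pot -cats1 takel_cat.
    by rewrite /=; lia.
  - by move=> z zq; apply: sub; rewrite mem_rcons inE zq orbT.
  - by move=> _; apply: sub; rewrite mem_rcons mem_head.
rewrite hr => /eqP; rewrite eqb0 => mr; apply: run_runx.
  by apply: run_skip; apply: erefl.
move=> _ <-; exists q; split=> //; first by rewrite /=; lia.
by move=> r0; rewrite -(b_mark B).
Qed.

Hypothesis mark0 : forall v : V, arr st0 aMARK v = mk0 v.

Lemma components_ok : run M components st0 (220 * (n + m) + 20) (fun s =>
  [/\ base s, forall v, mk0 v != 0 -> arr s aMARK v = mk0 v,
      forall v, mk0 v = 0 -> 0 < arr s aMARK v <= n
    & forall u v, mk0 u = 0 -> mk0 v = 0 ->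
      (arr s aMARK u == arr s aMARK v) = connA E S u v]).
Proof.
have [hN _ _ _ _] := env0; have pt := pot_total.
rewrite /components; apply: run_bound.
apply: run_seq; apply: run_set; first by evt.
apply: run_seq; apply: run_set; first by evt.
apply: run_seq; apply: run_set; first by evt.
set s3 := setr _ rr 0.
have b3 : base s3.
  by do 3![apply: base_fr (fr_setr _ _ _) _ _ => //].
(* Each root costs 48 beyond the shared potential: 40 for [scan_root], 4 for the increment, 4 for
   the loop test. *)
pose inv P s := exists r q, [/\ regs s rr = r, r <= n, regs s rqh = size q,
  bfs r s q (size q) & P = (n - r) * 48 + pot q (size q) /\
  forall v : V, v < r -> mk0 v = 0 -> v \in q].
pose Q s := exists q, bfs 0 s q (size q) /\ forall v, mk0 v = 0 -> v \in q.
apply: (run_conseq (@run_whileL inv Q _ _ s3 (n * 48 + pot [::] 0) _ _ _)) => //.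
- move=> P t ft [r [q [hr rn hq B [-> all_r]]]].
  have bt : base t by apply: base_fr b3 ft _ _.
  have [tN _ _ _ _] := base_env bt.
  exists (r < n); split.
  + by rewrite -hr -[X in _ < X]tN; evt.
  + move=> /eqP; rewrite eqb0 -leqNgt => le; exists q; split.
      exact: bfs_root B.
    by move=> v; apply: all_r; apply: leq_trans (ltn_ord v) le.
  rewrite eqb0 negbK => rn'; pose ro : V := Ordinal rn'.
  have [T h] := @scan_root_ok ro t q bt B hr hq.
  exists (T + 4); apply: run_seq.
  apply: (run_conseq (run_fr W16 _ h)) => // t' [[q' [B' hq' le sub inr]] ft'].
  have hr' : regs t' rr = r by rewrite (ft'.1 rr isT).
  apply: run_set; first by evt; rewrite hr'; lia.
  rewrite hr'; set t2 := setr _ _ _.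
  exists ((n - r.+1) * 48 + pot q' (size q')); split; last first.
    have -> : n - r = (n - r.+1).+1 by lia.
    by rewrite /=; lia.
  exists r.+1, q'; split=> //.
  + by rewrite regs_setr /= addn1.
  + by apply: (@bfs_root r); apply: bfs_fr B' _ _ _.
  split=> // v; rewrite ltnS leq_eqVlt => /orP[/eqP vr v0|vr v0].
    have vro : v = ro by apply: ord_inj.
    by rewrite vro in v0 *; apply: inr.
  by apply: sub; apply: all_r.
- exists 0, [::]; split=> //; last by rewrite subn0.
  split=> //.
  + by move=> v v0; rewrite [LHS](mark0 v).
  + by move=> v v0; rewrite [arr _ _ _](mark0 v) v0.
- move=> t [[q [B all_q]] ft].
  have bt : base t by apply: base_fr b3 ft _ _.
  have mq v : mk0 v = 0 -> exists rho : V,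
      [/\ mk0 rho = 0, arr t aMARK v = rho.+1 & connA E S rho v].
    by move=> v0; apply: (b_root B); apply: all_q.
  have clq v : mk0 v = 0 -> cl t v.
    by move=> v0; apply: (b_done B); rewrite take_size; apply: all_q.
  split=> //; first exact: (b_keep B).
    by move=> v /mq[rho [_ -> _]]; rewrite ltn_ord.
  (* Equal marks name the same root, to which both vertices are connected; conversely all vertices
     being closed, marks are constant along paths. *)
  move=> u v u0 v0; apply/eqP/idP=> [eqm|].
    have [r1 [_ m1 c1]] := mq _ u0; have [r2 [_ m2 c2]] := mq _ v0.
    move: eqm; rewrite m1 m2 => -[/ord_inj e12]; rewrite e12 in c1.
    by apply: connect_trans c2; rewrite -/(connA _ _ _ _) connAC.
  move=> h; apply: (connect_closed (P := fun w : V => arr t aMARK u = arr t aMARK w)) h _ => //.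
  move=> a b /=; rewrite !inE !negbK => /and3P[ab /eqP a0 /eqP b0] ->.
  by rewrite (clq _ a0 _ b0 ab).
rewrite /=; lia.
Qed.

End Loops.
End Components.

(** For loops in which round [v] changes only the entries at index [v]. [F v] describes these
    entries over all arrays at once; the last hypothesis replaces extensionality. *)
Lemma run_each (F : V -> (nat -> nat) -> Prop) body st T :
  okp body -> rj \notin wr body -> rN \notin wr body -> regs st rN = n ->
  (forall (v : V) s, fr (rj :: wr body) (wa body) st s -> regs s rj = v ->
     (forall k, k < 16 -> arr s k v = arr st k v) ->
     run M body s T (fun s' =>
       (forall k (i : nat), k < 16 -> i != v :> nat -> arr s' k i = arr s k i) /\
       F v (fun k => arr s' k v))) ->
  (forall v f g, (forall k, k < 16 -> f k = g k) -> F v f -> F v g) ->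
  run M (For rj (Reg rN) body) st (n * (T + 8) + 6) (fun s =>
    (forall v, F v (fun k => arr s k v)) /\ fr (rj :: wr body) (wa body) st s).
Proof.
move=> ok jb nb hN step Fext.
pose inv j s := (forall v : V, v < j -> F v (fun k => arr s k v)) /\
  (forall k i, k < 16 -> j <= i -> arr s k i = arr st k i).
apply: (run_conseq (@run_forL inv rj rN body st n T ok isT jb nb hN _ _ _ _)); first by lia.
- move=> j s s' [_ fA] [h1 h2]; split.
    by move=> v vj; apply: Fext (h1 v vj) => k k16; rewrite fA.
  by move=> k i k16 ji; rewrite fA // h2.
- by split.
- move=> j s jn hj f [h1 h2]; pose v : V := Ordinal jn.
  apply: (run_conseq (step v s f hj _)); first by move=> k k16; apply: h2.
  move=> s' [keep Fv]; split.
    move=> u; rewrite ltnS leq_eqVlt => /orP[/eqP uj|uj].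
      by have -> : u = v by [apply: ord_inj].
    by apply: Fext (h1 u uj) => k k16; rewrite keep //= neq_ltn uj.
  by move=> k i k16 ji; rewrite keep ?h2 //= ?(ltnW ji) // neq_ltn ji orbT.
- by move=> s [[h1 h2] f]; split=> // v; apply: h1.
Qed.

(** * The search *)

Definition flags (st : state) (E : {set {set V}}) : Prop :=
  forall a : 'I_na, arr st aFL a./2 = (eo a \in E).

Lemma flags_le st E a : flags st E -> arr st aFL (a : 'I_na)./2 <= 1.
Proof. by move=> ->; apply: leq_b1. Qed.

Lemma flags_add st st' E (a : 'I_na) : flags st E ->
  (forall i, arr st' aFL i = if i == a./2 then 1 else arr st aFL i) ->
  flags st' (eo a |: E).
Proof.
move=> h e b; rewrite e in_setU1 eo_half; case: eqP => //= _; exact: h.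
Qed.

Lemma flags_del st st' E (a : 'I_na) : flags st (eo a |: E) -> eo a \notin E ->
  (forall i, arr st' aFL i = if i == a./2 then 0 else arr st aFL i) ->
  flags st' E.
Proof.
move=> h aE e b; rewrite e; case: (b./2 =P a./2) => [ba|ba].
  have -> : eo b = eo a by apply/eqP; rewrite eo_half; apply/eqP.
  by rewrite (negbTE aE).
by rewrite h in_setU1 eo_half (introF eqP ba).
Qed.

Section Search.
Variables (rep : V -> V) (TV : {set V}).
Notation unsat := (unsat rep).
Notation reach := (reach tl hd rep).
Notation es := (es tl hd).
Notation valid := (valid tl hd rep).
Notation tp := (tp tl hd rep).
Notation blk := (blk tl hd).

Fixpoint stk (st : state) (s : seq 'I_na) : Prop :=
  if s is a :: s' then arr st aSTK (size s') = a /\ stk st s' else True.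

Lemma stk_eq st st' s : stk st s -> (forall i, i < size s -> arr st' aSTK i = arr st aSTK i) ->
  stk st' s.
Proof.
elim: s => //= a s IH [h1 h2] e; split; first by rewrite e.
by apply: IH => // i hi; apply: e; apply: leqW.
Qed.

(** The edge flags are kept out because [label_node] works for a while with the top edge unflagged;
    [State_ok] adds them. *)
Record Core (st : state) (s : seq 'I_na) : Prop := MkCore {
  c_env : Env st;
  c_k : regs st rk = size s;
  c_stk : stk st s;
  c_rep : forall v : V, arr st aREP v = rep v;
  c_term : forall v : V, arr st aTERM v = (v \in TV) }.

Lemma Core_fr rs ks st st' s : fr rs ks st st' -> Core st s ->
  all (fun x => x \notin rs) [:: rN; rM; rNA; rk] ->
  all (fun k => k \notin ks) [:: aHEAD; aNEXT; aSTK; aREP; aTERM] -> Core st' s.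
Proof.
move=> f [h1 h2 h3 h4 h5] /and5P[k1 k2 k3 k4 _] /and5P[k5 k6 k7 k8 /andP[k9 _]]; split.
- by apply: Env_fr f h1 _ _; rewrite /= ?k1 ?k2 ?k3 ?k5 ?k6.
- by rewrite f.1.
- by apply: stk_eq h3 _ => i _; rewrite f.2.
- by move=> v; rewrite f.2.
- by move=> v; rewrite f.2.
Qed.

(** Both bounds are used: their minimum turns [O(n + m)] per node into [O(nm)] per branch. *)
Lemma size_reach s : reach s -> size s <= n /\ size s <= m.
Proof.
move=> r; split; first exact: reach_size r.
rewrite -(reach_card r); apply: leq_trans (card_G I).
apply: subset_leq_card; exact: es_sub.
Qed.

Lemma reach_behead s : reach s -> reach (behead s).
Proof. by case=> //; constructor. Qed.

Lemma reach_top a s : reach (a :: s) -> eo a \notin es s.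
Proof.
move=> r; inversion r; subst; have [i [u _ _ _]] := validP H2.
by have [_ _ _ _] := valid_conn H1 H2 u.
Qed.

Definition topreg (st : state) (s : seq 'I_na) : Prop :=
  if s is a :: _ then regs st rta = a else True.

Lemma drop_top_ok st s : Core st s -> reach s -> flags st (es s) ->
  run M drop_top st 40 (fun st' => flags st' (es (behead s)) /\
    topreg st' s).
Proof.
move=> C r fl; have [sn sm] := size_reach r; rewrite /drop_top; apply: run_bound.
  apply: run_if; first by evt.
    rewrite (c_k C); case: s C r fl sn sm => // a s C r fl sn sm _.
    have top : arr st aSTK (size s) = a by have [] := c_stk C.
    apply: run_seq; apply: run_set.
      by evt; rewrite (c_k C) /= in sn sm *; lia.
    have -> : regs st rk - 1 = size s by rewrite (c_k C) /= subn1.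
    rewrite top; set st1 := setr _ _ _.
    have ta : regs st1 rta = a by [].
    apply: run_storeL; [evt|by evt| |by []|].
    - by rewrite ta; have := aL a; lia.
    - by rewrite ta; apply: haL.
    split=> //; rewrite ta; apply: (flags_del fl); first exact: reach_top r.
    by move=> i; rewrite arr_seta.
  rewrite (c_k C); case: s C r fl sn sm => // C r fl sn sm _.
  by apply: run_skip; split.
by [].
Qed.

Lemma clear_marks_ok st : Env st -> run M clear_marks st (n * 15 + 6) (fun st' =>
  forall v : V, arr st' aMARK v = 0).
Proof.
move=> e; rewrite /clear_marks.
apply: (run_le (@run_each (fun v f => f aMARK = 0) _ st 7 _ _ _ (envN e) _ _)) => //;
  [|by move=> v f g h e0; rewrite -h|by move=> s []].
- move=> v s f hj _; apply: run_bound.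
    apply: run_storeL; [by evt|by evt|by rewrite hj; apply: vL|by []|].
    rewrite hj; split; last by rewrite arr_seta //= eqxx.
    by move=> k i k16 iv; rewrite arr_seta // (negbTE iv) andbF.
  by [].
Qed.

Lemma restore_top_ok st s : Core st s -> reach s -> flags st (es (behead s)) ->
  topreg st s ->
  regs st rlx = 0 -> regs st rly = 0 ->
  run M restore_top st 60 (fun st' => flags st' (es s) /\
    [/\ regs st' rlx = (if s is a :: _ then arr st aMARK (hd a) else 0) &
        regs st' rly = (if s is a :: _ then arr st aMARK (tl a) else 0)]).
Proof.
move=> C r fl ta lx ly; rewrite /restore_top; apply: run_bound.
  apply: run_if; first by evt.
    rewrite (c_k C); case: s C r fl ta => // a s C r fl ta _.
    apply: run_seq; apply: run_storeL; [evt|by evt| |by []|].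
    - by rewrite ta; have := aL a; lia.
    - by rewrite ta; apply: haL.
    rewrite ta; set st1 := seta _ _ _ _.
    have ta1 : regs st1 rta = a by [].
    have ev1 : ev M st1 (Reg rta) a by rewrite -ta1; evt.
    have mk1 (v : V) : arr st1 aMARK v = arr st aMARK v by rewrite arr_seta.
    apply: run_seq; apply: run_set.
      by apply: ev_arrL; [apply: ev_src ev1|apply: vL|].
    apply: run_set.
      apply: ev_arrL; [apply: ev_dst (_ : ev M _ _ a)|apply: vL|by []].
      exact: (ev_eq (ev_reg _ _ _) ta1).
    split; last by rewrite !regs_setr /= arr_setr !mk1.
    by apply: (flags_add fl) => i; rewrite !arr_setr arr_seta.
  rewrite (c_k C); case: s C r fl ta => // C r fl ta _.
  by apply: run_skip; split.
by [].
Qed.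

Definition eqlab (st : state) (k : nat) (E : {set {set V}}) : Prop :=
  forall u v : V, (arr st k u == arr st k v) = conn E u v.

(** After [label_node], [aMARK] labels the components before the top arc was
    added, and [aLAB] those of the node itself. *)
Definition labeled (st : state) (s : seq 'I_na) : Prop :=
  [/\ eqlab st aMARK (es (behead s)), eqlab st aLAB (es s) &
      if s is a :: s' then
        forall v : V, arr st aTP v = (v \in [set w | conn (es s') (hd a) w])
      else True].

Lemma merge_labels_ok st s : Core st s -> reach s -> eqlab st aMARK (es (behead s)) ->
  (forall v : V, 0 < arr st aMARK v) ->
  regs st rlx = (if s is a :: _ then arr st aMARK (hd a) else 0) ->
  regs st rly = (if s is a :: _ then arr st aMARK (tl a) else 0) ->
  run M merge_labels st (n * 60 + 6) (labeled^~ s).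
Proof.
move=> C r lab pos lx ly; rewrite /merge_labels.
pose F (v : V) (f : nat -> nat) :=
  f aLAB = (if arr st aMARK v == regs st rlx then regs st rly else arr st aMARK v) /\
  f aTP = (arr st aMARK v == regs st rlx).
apply: (run_le (@run_each F _ st 52 _ _ _ (envN (c_env C)) _ _)) => //;
  [|by move=> v f g h [h1 h2]; rewrite /F -!h|].
- move=> v t f hj same; have vl := vL v.
  have lxt : regs t rlx = regs st rlx := f.1 rlx isT.
  have lyt : regs t rly = regs st rly := f.1 rly isT.
  apply: run_bound.
    apply: run_if; first by evt; rewrite hj.
      rewrite hj lxt same // eqb0 negbK => e.
      apply: run_seq; apply: run_storeL; [by evt|by evt|by rewrite hj|by []|].
      rewrite hj lyt; set t1 := seta _ _ _ _.
      apply: run_storeL; [by evt|by evt|by rewrite [regs _ _]hj|by []|].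
      rewrite [regs _ _]hj; split.
        by move=> k i k16 iv; rewrite !arr_seta // (negbTE iv) !andbF.
      by rewrite /F e; split; rewrite !arr_seta //= eqxx.
    rewrite hj lxt same // => /eqP; rewrite eqb0 => /negbTE e.
    apply: run_seq; apply: run_storeL; [by evt|by evt; rewrite hj|by rewrite hj|by []|].
    rewrite hj same //; set t1 := seta _ _ _ _.
    apply: run_storeL; [by evt|by evt|by rewrite [regs _ _]hj|by []|].
    rewrite [regs _ _]hj; split.
      by move=> k i k16 iv; rewrite !arr_seta // (negbTE iv) !andbF.
    by rewrite /F e; split; rewrite !arr_seta //= eqxx.
  by [].
move=> t [ht f]; have mt (v : V) : arr t aMARK v = arr st aMARK v by rewrite f.2.
split.
- by move=> u v; rewrite !mt.
- move=> u v; have [-> _] := ht u; have [-> _] := ht v; rewrite lx ly.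
  case: s C r lab lx ly => [|a s] C r lab lx ly.
    by rewrite !eqn0Ngt !pos /= lab.
  rewrite /= /eo conn_add -!lab /= !(eq_sym (arr st aMARK (hd a))).
  set p := arr st aMARK u; set q := arr st aMARK v.
  set x := arr st aMARK (hd a); set y := arr st aMARK (tl a).
  case: (p =P x) => [->|px]; case: (q =P x) => [->|qx]; rewrite ?eqxx ?andbT ?andbF ?orbT ?orbF //=.
  + by rewrite (eq_sym x q) (introF eqP qx).
  + by rewrite (introF eqP px).
- case: s C r lab lx ly => // a s C r lab lx ly v.
  by have [_ ->] := ht v; rewrite lx inE -lab eq_sym.
Qed.

Lemma label_node_ok st s : Core st s -> reach s -> flags st (es s) ->
  run M label_node st (300 * (n + m) + 200) (fun st' =>
    [/\ labeled st' s, Core st' s & flags st' (es s)]).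
Proof.
move=> C r fl; have r' := reach_behead r.
rewrite /label_node; apply: run_bound.
apply: run_seq; apply: run_set; first by evt.
apply: run_seq; apply: run_set; first by evt.
set s1 := setr _ rly 0.
have f1 : fr [:: rlx; rly] [::] st s1.
  apply: fr_trans (fr_sub (fr_setr _ _ _) _ _) (fr_sub (fr_setr _ _ _) _ _) => // x;
  by rewrite !inE => ->; rewrite ?orbT.
have C1 : Core s1 s by apply: Core_fr f1 C _ _.
have fl1 : flags s1 (es s) by move=> a; rewrite f1.2.
apply: run_seq; apply: (run_conseq (run_fr W16 _ (drop_top_ok C1 r fl1))) => //.
move=> s2 [[fl2 ta2] f2]; have C2 := Core_fr f2 C1 isT isT.
apply: run_seq; apply: (run_conseq (run_fr W16 _ (clear_marks_ok (c_env C2)))) => //.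
move=> s3 [mk3 f3]; have C3 := Core_fr f3 C2 isT isT.
apply: run_seq; apply: run_set; first by evt.
set s4 := setr _ _ _.
have f4 : fr [:: rALL] [::] s3 s4 := fr_setr _ _ _.
have C4 := Core_fr f4 C3 isT isT.
have fl4 : flags s4 (es (behead s)).
  by move=> a; rewrite f4.2 // f3.2.
have EG : es (behead s) \subset G := es_sub _ _ _.
apply: run_seq.
have ok4 (a : 'I_na) : (arr s4 aFL a./2 + 0 != 0) = (eo a \in es (behead s)).
  by rewrite addn0 fl4; case: (_ \in _).
have comp := @components_ok (es (behead s)) (fun=> 0) EG s4 0 (c_env C4)
  (fun a => flags_le a fl4) erefl isT ok4 mk3.
apply: (run_conseq (run_fr W16 _ comp)) => //.
move=> s5 [[b5 _ pos5 lab5] f5]; have C5 := Core_fr f5 C4 isT isT.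
have eq5 : eqlab s5 aMARK (es (behead s)).
  move=> u v; rewrite lab5 // -connA0; congr connA; apply/setP=> z; by rewrite !inE.
have fl5 : flags s5 (es (behead s)) by move=> a; rewrite f5.2.
have ta5 : topreg s5 s.
  move: ta2; rewrite /topreg; case: (s) => // a _ <-.
  by rewrite (f5.1 rta isT) (f4.1 rta isT) (f3.1 rta isT).
have lx5 : regs s5 rlx = 0.
  by rewrite (f5.1 rlx isT) (f4.1 rlx isT) (f3.1 rlx isT) (f2.1 rlx isT).
have ly5 : regs s5 rly = 0.
  by rewrite (f5.1 rly isT) (f4.1 rly isT) (f3.1 rly isT) (f2.1 rly isT).
apply: run_seq.
apply: (run_conseq (run_fr W16 _ (restore_top_ok C5 r fl5 ta5 lx5 ly5))) => //.
move=> s6 [[fl6 [lx6 ly6]] f6]; have C6 := Core_fr f6 C5 isT isT.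
have mk6 (v : V) : arr s6 aMARK v = arr s5 aMARK v by rewrite f6.2.
have eq6 : eqlab s6 aMARK (es (behead s)) by move=> u v; rewrite !mk6.
have pos6 (v : V) : 0 < arr s6 aMARK v by rewrite mk6; case/andP: (pos5 v erefl).
have lx6' : regs s6 rlx = (if s is a :: _ then arr s6 aMARK (hd a) else 0).
  by rewrite lx6; case: (s) => // a _; rewrite mk6.
have ly6' : regs s6 rly = (if s is a :: _ then arr s6 aMARK (tl a) else 0).
  by rewrite ly6; case: (s) => // a _; rewrite mk6.
apply: (run_conseq (run_fr W16 _ (merge_labels_ok C6 r eq6 pos6 lx6' ly6'))) => //.
move=> s7 [lab7 f7]; split=> //; first exact: Core_fr f7 C6 isT isT.
by move=> a; rewrite f7.2.
by rewrite /=; lia.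
Qed.

Definition enc (o : option V) : nat := if o is Some i then i : nat else n.

Definition first_from (E : {set {set V}}) (j c : nat) : Prop :=
  (c = n /\ forall v : V, j <= v -> conn E v (rep v)) \/
  exists i : V, [/\ c = i, ~~ conn E i (rep i), j <= i &
    forall v : V, j <= v -> v < i -> conn E v (rep v)].

Lemma first_from0 E c : first_from E 0 c -> c = enc (unsat E).
Proof.
move=> [[-> h]|[i [-> h1 _ h2]]].
  by have -> : unsat E = None by apply/unsat_none => v; apply: h.
suff /eqP -> : unsat E == Some i by [].
by apply/unsat_some; split=> // j ji; apply: h2.
Qed.

Lemma first_from_step E (v : V) c : first_from E v.+1 c ->
  first_from E v (if conn E v (rep v) then c else v).
Proof.
case: ifPn => [cv|ncv h]; last first.
  right; exists v; split=> // u h1 h2; lia.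
have split_ (u : V) : v <= u -> u = v \/ v < u.
  by rewrite leq_eqVlt => /orP[/eqP/ord_inj ->|]; auto.
case=> [[-> h]|[i [-> h1 h2 h3]]]; [left|right].
  by split=> // u /split_[->|] //; apply: h.
exists i; split=> //; first exact: ltnW.
by move=> u /split_[-> //|vu] ui; apply: h3.
Qed.

Lemma run_cond_set st e (b : bool) x y : ev M st e b ->
  run M (If e Skip (Set_ x (Reg y))) st (esize e + 4) (fun t =>
    fr [:: x] [::] st t /\ regs t x = if b then regs st x else regs st y).
Proof.
move=> h; apply: run_bound.
  apply: run_if h _ _ => hb.
    by apply: run_skip; split; [exact: fr_refl|rewrite eqb0 negbK in hb; rewrite hb].
  apply: run_set; first by evt.
  by split; [exact: fr_setr|rewrite regs_setr eqxx; case: (b) hb].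
by rewrite /=; lia.
Qed.

Lemma ev_demand st k (v : V) : regs st rj = v ->
  (forall u : V, arr st aREP u = rep u) -> k < 16 ->
  ev M st (Bin Eq (Arr k (Reg rj)) (Arr k (Arr aREP (Reg rj))))
    (arr st k v == arr st k (rep v)).
Proof.
move=> h hrep k16; have e := ev_eq (ev_reg M st rj) h.
have vl u := vL u.
have e2 := ev_arrL e (vl v) (isT : aREP < 16); rewrite hrep in e2.
exact: ev_eqb (ev_arrL e (vl v) k16) (ev_arrL e2 (vl _) k16).
Qed.

Lemma find_unsat_ok st s : Core st s -> labeled st s ->
  run M find_unsat st (n * 60 + 20) (fun st' =>
    regs st' rcur = enc (unsat (es s)) /\ regs st' rcur0 = enc (unsat (es (behead s)))).
Proof.
move=> C [labM labL _]; have hN := envN (c_env C).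
rewrite /find_unsat; apply: run_bound.
apply: run_seq; apply: run_set; first by evt.
apply: run_seq; apply: run_set; first by evt.
apply: run_seq; apply: run_set; first by evt.
rewrite [regs (setr (setr _ _ _) _ _) _]hN [regs (setr _ _ _) _]hN hN.
set s3 := setr _ rj _.
have f3 : fr [:: rcur; rcur0; rj] [::] st s3.
  by split=> // x; rewrite !inE !negb_or !regs_setr => /and3P[/negbTE-> /negbTE-> /negbTE->].
pose inv P t := exists j, [/\ regs t rj = j, j <= n, P = j * 60,
  first_from (es s) j (regs t rcur) & first_from (es (behead s)) j (regs t rcur0)].
pose Q t := regs t rcur = enc (unsat (es s)) /\ regs t rcur0 = enc (unsat (es (behead s))).
apply: (run_conseq (@run_whileL inv Q _ _ s3 (n * 60) _ _ _)) => //.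
- move=> P t ft [j [hj jn -> h1 h2]]; exists j; split.
  + by rewrite -hj; evt.
  + by move=> j0; rewrite j0 in h1 h2; split; apply: first_from0.
  move=> j0; case: j j0 hj jn h1 h2 => // j _ hj jn h1 h2.
  pose v : V := Ordinal jn; have vl := vL v.
  have fst : fr [:: rj; rcur; rcur0] [::] st t.
    by apply: fr_trans (fr_weak f3 _ _) (fr_weak ft _ _).
  have At k i : k < 16 -> arr t k i = arr st k i by move=> k16; apply: fst.2.
  exists 58; apply: run_bound.
    apply: run_seq; apply: run_set; first by evt; rewrite hj; lia.
    rewrite hj subn1 /=; set t1 := setr _ _ _.
    have A1 k i : k < 16 -> arr t1 k i = arr st k i by move=> k16; rewrite arr_setr At.
    have r1 (u : V) : arr t1 aREP u = rep u by rewrite A1 // (c_rep C).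
    have evL := ev_demand (erefl : regs t1 rj = v) r1 (isT : aLAB < 16).
    rewrite !A1 // in evL.
    apply: run_seq; apply: (run_conseq (run_cond_set rcur rj evL)).
    move=> t2 [f2 c2]; have A2 k i : k < 16 -> arr t2 k i = arr st k i.
      by move=> k16; rewrite f2.2 // A1.
    have j2 : regs t2 rj = v by rewrite (f2.1 rj isT).
    have r2 (u : V) : arr t2 aREP u = rep u by rewrite A2 // (c_rep C).
    have ev2 := ev_demand j2 r2 (isT : aMARK < 16).
    rewrite !A2 // in ev2.
    apply: (run_conseq (run_cond_set rcur0 rj ev2)) => t4 [f4 c4].
    exists (j * 60); split; last by rewrite /=; lia.
    exists j; split=> //; rewrite ?(ltnW jn) //.
    + by rewrite (f4.1 rj isT).
    + rewrite (f4.1 rcur isT) c2 labL; exact: (@first_from_step _ v _ h1).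
    + rewrite c4 labM (f2.1 rcur0 isT) j2; exact: (@first_from_step _ v _ h2).
  by [].
- exists n; split=> //; left; split=> // v; rewrite leqNgt ltn_ord //.
- by move=> t [].
rewrite /=; lia.
Qed.

(** What reduces validity of an arc to one lookup at each end. Avoiding the block is stated
    separately since [connA] is reflexive even there. *)
Definition node_ready (st : state) (s : seq 'I_na) (i : V) : Prop :=
  (forall v : V, arr st aTP v = (v \in tp s i)) /\
  (forall v : V, (arr st aMARK v == regs st rtgt) =
     (v \notin blk s i) && connA G (blk s i) v (rep i)).

Lemma restart_tip_ok st s (i : V) : Core st s -> eqlab st aLAB (es s) ->
  regs st rl = arr st aLAB i ->
  run M restart_tip st (n * 30 + 6) (fun st' =>
    forall v : V, arr st' aTP v = (v \in blk s i)).
Proof.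
move=> C lab hl; rewrite /restart_tip.
pose F (v : V) (f : nat -> nat) := f aTP = (v \in blk s i).
apply: (run_le (@run_each F _ st 22 _ _ _ (envN (c_env C)) _ _)) => //;
  [|by move=> v f g h e0; rewrite /F -h|by move=> t []].
move=> v t f hj same; have vl := vL v.
have lt : regs t rl = regs st rl := f.1 rl isT.
apply: run_bound.
  apply: run_storeL; [by evt|by evt; rewrite hj|by rewrite hj|by []|].
  rewrite hj lt same //; split.
    by move=> k j k16 iv; rewrite !arr_seta // (negbTE iv) !andbF.
  by rewrite /F arr_seta //= eqxx hl lab inE connC.
by [].
Qed.

Lemma block_ok st s (i : V) : Core st s -> eqlab st aLAB (es s) ->
  regs st rl = arr st aLAB i ->
  run M block st (n * 40 + 6) (fun st' =>
    forall v : V, arr st' aMARK v = if v \in blk s i then n.+1 else 0).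
Proof.
move=> C lab hl; rewrite /block.
pose F (v : V) (f : nat -> nat) := f aMARK = if v \in blk s i then n.+1 else 0.
apply: (run_le (@run_each F _ st 32 _ _ _ (envN (c_env C)) _ _)) => //;
  [|by move=> v f g h e0; rewrite /F -h|by move=> t []].
move=> v t f hj same; have vl := vL v.
have lt : regs t rl = regs st rl := f.1 rl isT.
have Nt : regs t rN = n by rewrite (f.1 rN isT) (envN (c_env C)).
apply: run_bound.
  apply: run_if; first by evt; rewrite hj.
    rewrite hj lt same // hl lab connC eqb0 negbK => c.
    apply: run_storeL; [by evt|by evt; rewrite Nt; lia|by rewrite hj|by []|].
    rewrite hj Nt; split.
      by move=> k j k16 iv; rewrite !arr_seta // (negbTE iv) !andbF.
    by rewrite /F arr_seta //= eqxx inE c addn1.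
  rewrite hj lt same // hl lab connC => /eqP; rewrite eqb0 => c.
  apply: run_storeL; [by evt|by evt|by rewrite hj|by []|].
  rewrite hj; split.
    by move=> k j k16 iv; rewrite !arr_seta // (negbTE iv) !andbF.
  by rewrite /F arr_seta //= eqxx inE (negbTE c).
by [].
Qed.

Lemma open_node_ok st s (i : V) : Core st s -> flags st (es s) -> labeled st s ->
  unsat (es s) = Some i ->
  regs st rcur = i -> regs st rcur0 = enc (unsat (es (behead s))) ->
  run M open_node st (300 * (n + m) + 200) (fun st' => node_ready st' s i).
Proof.
move=> C fl [labM labL tpL] u hc hc0.
have nrep := rep_notin_blk u.
have il := vL i.
rewrite /open_node; apply: run_bound.
apply: run_seq; apply: run_set; first by evt; rewrite hc.
rewrite hc; set s1 := setr _ _ _.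
have f1 : fr [:: rl] [::] st s1 := fr_setr _ _ _.
have C1 := Core_fr f1 C isT isT.
have lab1 : eqlab s1 aLAB (es s) by [].
apply: run_seq; apply: (run_conseq (Q' := fun t =>
   (forall v : V, arr t aTP v = (v \in tp s i)) /\ fr [:: rj] [:: aTP] s1 t)).
  apply: run_if.
    apply: ev_mul; [by evt|by evt|].
    rewrite /=; have := leq_b1 (0 < regs s1 rk); have := leq_b1 (regs s1 rcur == regs s1 rcur0).
    by case: (0 < _); case: (_ == _ :> nat); lia.
    rewrite muln_eq0 negb_or !eqb0 !negbK (c_k C1).
    rewrite [regs s1 rcur]hc [regs s1 rcur0]hc0 => /andP[s0 ec].
    apply: run_skip; split; last exact: fr_refl.
    move=> v; case: s s0 C fl labM labL tpL u hc0 nrep C1 lab1 ec => // a s' _ C fl labM labL tpL u hc0 nrep C1 lab1 ec.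
    have -> : tp (a :: s') i = [set w | conn (es s') (hd a) w]; last exact: tpL.
    rewrite /=; suff -> : unsat (es s') == Some i by [].
    (* Had the parent no unsatisfied demand, [rcur0] would be [n], which is no vertex. *)
    move: ec; rewrite /=; case: (unsat (es s')) => [j|] /= /eqP; first by move/ord_inj->.
    by move=> e; have := ltn_ord i; rewrite e ltnn.
  rewrite (c_k C1) [regs s1 rcur]hc [regs s1 rcur0]hc0 => e.
  have tpE : tp s i = blk s i.
    move: e; case: (s) => // a s' /=; case: ifP => // /eqP -> /=.
    by rewrite eqxx.
  rewrite tpE.
  apply: (run_conseq (run_fr W16 _ (restart_tip_ok C1 lab1 (erefl : regs s1 rl = arr s1 aLAB i)))) => // t [h f].
  by split=> //; apply: fr_weak f _ _.
move=> s2 [tp2 f2]; have C2 := Core_fr f2 C1 isT isT.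
have lab2 : eqlab s2 aLAB (es s) by move=> p q; rewrite !f2.2.
have l2 : regs s2 rl = arr s2 aLAB i by rewrite (f2.1 rl isT) f2.2.
apply: run_seq; apply: (run_conseq (run_fr W16 _ (block_ok C2 lab2 l2))) => // s3 [mk3 f3].
have C3 := Core_fr f3 C2 isT isT.
apply: run_seq; apply: run_set; first by evt.
set s4 := setr _ _ _; have f4 : fr [:: rALL] [::] s3 s4 := fr_setr _ _ _.
have C4 := Core_fr f4 C3 isT isT.
have fl4 : flags s4 (es s).
  by move=> a; rewrite f4.2 // f3.2 // f2.2 // f1.2.
pose mk0 (v : V) := if v \in blk s i then n.+1 else 0.
have mk0E v : (mk0 v != 0) = (v \in blk s i) by rewrite /mk0; case: ifP.
have SE : [set v | mk0 v != 0] = blk s i by apply/setP=> v; rewrite !inE mk0E inE.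
have ok4 (a : 'I_na) : (arr s4 aFL a./2 + 1 != 0) = (eo a \in G).
  by rewrite addn1 eoG.
have mk4 (v : V) : arr s4 aMARK v = mk0 v by rewrite f4.2 // mk3.
apply: run_seq.
have comp := @components_ok G mk0 (subxx _) s4 1 (c_env C4)
  (fun a => flags_le a fl4) erefl isT ok4 mk4.
apply: (run_conseq (run_fr W16 _ comp)) => // s5 [[_ keep5 pos5 lab5] f5].
have C5 := Core_fr f5 C4 isT isT.
have c5 : regs s5 rcur = i.
  by rewrite (f5.1 rcur isT) (f4.1 rcur isT) (f3.1 rcur isT) (f2.1 rcur isT) (f1.1 rcur isT).
apply: run_set; first by evt; rewrite ?c5 ?(c_rep C5) //; apply: vL.
rewrite c5 (c_rep C5); split=> v.
  by rewrite arr_setr f5.2 // f4.2 // f3.2 // tp2.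
rewrite arr_setr regs_setr /=; case: (boolP (v \in blk s i)) => vb /=.
  (* A blocked vertex keeps the mark [n + 1], while the label of [rep i] is at most [n]. *)
  rewrite keep5 ?mk0E // /mk0 vb; apply/negbTE/eqP=> e.
  have r0 : mk0 (rep i) = 0 by rewrite /mk0 (negbTE nrep).
  by have := pos5 _ r0; rewrite -e; lia.
rewrite lab5 ?SE // /mk0 ?(negbTE vb) ?(negbTE nrep) //.
rewrite /=; lia.
Qed.

Definition visited (st : state) (s : seq 'I_na) : Prop :=
  regs st rcur = enc (unsat (es s)) /\
  forall i, unsat (es s) = Some i -> node_ready st s i.

Definition State_ok (st : state) (s : seq 'I_na) : Prop :=
  [/\ Core st s, flags st (es s) & reach s].

Lemma visit_ok st s : State_ok st s ->
  run M visit st (700 * (n + m) + 500) (fun st' => State_ok st' s /\ visited st' s).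
Proof.
move=> [C fl r]; rewrite /visit; apply: run_bound.
apply: run_seq; apply: (run_conseq (label_node_ok C r fl)) => s1 [lab1 C1 fl1].
apply: run_seq; apply: (run_conseq (run_fr W16 _ (find_unsat_ok C1 lab1))) => // s2 [[c2 c02] f2].
have C2 := Core_fr f2 C1 isT isT.
have fl2 : flags s2 (es s) by move=> a; rewrite f2.2.
have lab2 : labeled s2 s.
  have [h1 h2 h3] := lab1; split; try by move=> p q; rewrite !f2.2.
  by move: h3; case: (s) => // a s' h3 v; rewrite f2.2.
have N2 := envN (c_env C2).
apply: run_if; first by evt.
  rewrite c2 N2 eqb0 negbK; case u: (unsat (es s)) => [i|] /=; last by rewrite ltnn.
  move=> _; have ci : regs s2 rcur = i by rewrite c2 u.
  apply: (run_conseq (run_fr W16 _ (open_node_ok C2 fl2 lab2 u ci c02))) => // s3 [rd f3].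
  have C3 := Core_fr f3 C2 isT isT.
  split; first by split=> // a; rewrite f3.2.
  split; first by rewrite (f3.1 rcur isT) c2 u.
  by rewrite u => j [<-].
rewrite c2 N2 => /eqP; rewrite eqb0; case u: (unsat (es s)) => [i|] /=; first by rewrite ltn_ord.
move=> _; apply: run_skip; split=> //; split; rewrite ?c2 ?u //.
rewrite /=; lia.
Qed.

Definition found (s : seq 'I_na) (from res : nat) : Prop :=
  (res = na /\ forall b : 'I_na, from <= b -> ~~ valid s b) \/
  exists r : 'I_na, [/\ res = r, from <= r, valid s r &
    forall b : 'I_na, from <= b -> b < r -> ~~ valid s b].

Lemma find_child_ok st s i : State_ok st s -> unsat (es s) = Some i ->
  node_ready st s i ->
  run M find_child st (160 * m + 20) (fun st' => found s (regs st rfrom) (regs st' rres)).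
Proof.
move=> [C fl r] u [tpL mkL]; have hNA := envNA (c_env C); have na2 := na_def.
set from := regs st rfrom.
rewrite /find_child; apply: run_bound.
apply: run_seq; apply: run_set; first by evt.
apply: run_seq; apply: run_set; first by evt.
rewrite [regs (setr _ _ _) _]hNA hNA; set s2 := setr _ rj _.
have f2 : fr [:: rres; rj] [::] st s2.
  by split=> // x; rewrite !inE !negb_or !regs_setr => /andP[/negbTE-> /negbTE->].
pose inv P t := exists j, [/\ regs t rj = j, j <= na, P = j * 75 &
  (regs t rres = na /\ forall b : 'I_na, j <= b -> from <= b -> ~~ valid s b) \/
  exists r : 'I_na, [/\ regs t rres = r, from <= r, valid s r &
    forall b : 'I_na, j <= b -> from <= b -> b < r -> ~~ valid s b]].
pose Q t := found s from (regs t rres).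
apply: (run_conseq (@run_whileL inv Q _ _ s2 (na * 75) _ _ _)) => //.
- move=> P t ft [j [hj jn -> h]].
  have fst : fr [:: rres; rj] [::] st t.
    by apply: fr_trans (fr_weak f2 _ _) (fr_weak ft _ _).
  have ht : regs t rfrom = from := fst.1 rfrom isT.
  exists (from < j); split.
  + by rewrite -hj -ht; evt.
  + move=> /eqP; rewrite eqb0 -leqNgt => le.
    case: h => [[h1 h2]|[r' [h1 h2 h3 h4]]]; [left|right].
      by split=> // b fb; apply: h2 => //; apply: leq_trans fb.
    by exists r'; split=> // b fb; apply: h4 => //; apply: leq_trans fb.
  rewrite eqb0 negbK; case: j hj jn h => // j hj jn h fj.
  pose b : 'I_na := Ordinal jn.
  exists 70; apply: run_bound.
    apply: run_seq; apply: run_set; first by evt; rewrite hj; lia.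
    rewrite hj subn1 /=; set t1 := setr _ _ _.
    have eb : ev M t1 (Reg rj) b by apply: ev_reg.
    have e1 : ev M t1 (Arr aTP (src_e (Reg rj))) (tl b \in tp s i).
      rewrite -tpL -[arr st _ _](fst.2 aTP) // -[arr t _ _]/(arr t1 aTP (tl b)).
      by apply: ev_arrL (ev_src eb) _ _; first exact: vL.
    have e2 : ev M t1 (Bin Eq (Arr aMARK (dst_e (Reg rj))) (Reg rtgt))
        ((hd b \notin blk s i) && connA G (blk s i) (hd b) (rep i)).
      rewrite -mkL -[arr st _ _](fst.2 aMARK) // -[arr t _ _]/(arr t1 aMARK (hd b)).
      have -> : regs st rtgt = regs t1 rtgt by rewrite regs_setr /= (fst.1 rtgt isT).
      apply: ev_eqb; last by evt.
      by apply: ev_arrL (ev_dst eb) _ _; first exact: vL.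
    have e3 : ev M t1 (Bin Mul (Arr aTP (src_e (Reg rj)))
        (Bin Eq (Arr aMARK (dst_e (Reg rj))) (Reg rtgt))) (valid s b).
      have -> : nat_of_bool (valid s b) = (tl b \in tp s i) *
          ((hd b \notin blk s i) && connA G (blk s i) (hd b) (rep i)).
        by rewrite /valid u mulnb.
      by apply: ev_mul e1 e2 _; rewrite mulnb; case: (_ && _); lia.
    have keep (t2 : state) : regs t2 rj = j ->
        (regs t2 rres = na /\ (forall b' : 'I_na, j <= b' -> from <= b' -> ~~ valid s b')) \/
        (exists r' : 'I_na, [/\ regs t2 rres = r', from <= r', valid s r' &
           forall b' : 'I_na, j <= b' -> from <= b' -> b' < r' -> ~~ valid s b']) ->
        exists P', inv P' t2 /\ 70 + (esize (Bin Lt (Reg rfrom) (Reg rj))).+1 + P' <= j.+1 * 75.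
      move=> hj2 h2; exists (j * 75); split; last by rewrite /=; lia.
      by exists j; split=> //; apply: ltnW.
    have split_ (b' : 'I_na) : j <= b' -> b' = b \/ j < b'.
      by rewrite leq_eqVlt => /orP[/eqP e|]; [left; apply: ord_inj|right].
    apply: run_if e3 _ _.
      rewrite eqb0 negbK => vb; apply: run_set; first by evt.
      apply: keep => //; right; exists b; split=> //.
      by move=> b' h1 _ h2; exfalso; move: h1 h2 => /=; lia.
    move=> /eqP; rewrite eqb0 => nvb; apply: run_skip; apply: keep => //.
    case: h => [[h1 h2]|[r' [h1 h2 h3 h4]]]; [left|right].
      by split=> // b' /split_[->|] // jb'; apply: h2.
    by exists r'; split=> // b' /split_[->|] // jb'; apply: h4.
  by [].
- exists na; split=> //; left; split=> // b; rewrite leqNgt ltn_ord //.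
- by move=> t [].
rewrite /=; lia.
Qed.

Lemma push_ok st s (r : 'I_na) : State_ok st s -> valid s r -> regs st rres = r ->
  run M push_arc st 25 (fun st' => State_ok st' (r :: s)).
Proof.
move=> [C fl rs] v hr; have [sn sm] := size_reach rs; have ra := arc_lt r.
have rs' : reach (r :: s) by apply: reachS.
have [_ sm'] := size_reach rs'.
rewrite /push_arc; apply: run_bound.
apply: run_seq; apply: run_storeL; [by evt|by evt| |by []|].
  by rewrite (c_k C); lia.
rewrite (c_k C) hr; set s1 := seta _ _ _ _.
apply: run_seq; apply: run_storeL; [evt|by evt| |by []|].
- by rewrite [regs s1 _]hr; lia.
- by rewrite [regs s1 _]hr; apply: haL.
rewrite [regs s1 _]hr; set s2 := seta _ _ _ _.
apply: run_set; first by evt; rewrite [regs s2 _](c_k C); lia.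
rewrite [regs s2 _](c_k C); set s3 := setr _ _ _.
have f3 : fr [:: rk] [:: aSTK; aFL] st s3.
  split=> [x|k j]; first by rewrite inE regs_setr => /negbTE ->.
  by rewrite !inE !negb_or => /andP[h1 h2] k16; rewrite arr_setr !arr_seta // (negbTE h1) (negbTE h2).
have S3 j : arr s3 aSTK j = if j == size s then val r else arr st aSTK j.
  by rewrite arr_setr !arr_seta.
split=> //.
- have [h1 h2 h3 h4 _] := C; split.
  + by apply: Env_fr f3 h1 _ _.
  + by rewrite regs_setr /= addn1.
  + split; first by rewrite S3 eqxx.
    by apply: stk_eq h3 _ => j hj; rewrite S3 ltn_eqF.
  + by move=> w; rewrite f3.2.
  + by move=> w; rewrite f3.2 // (c_term C).
- by apply: (flags_add fl) => j; rewrite arr_setr !arr_seta.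
by [].
Qed.

Lemma pop_ok st s (r : 'I_na) : State_ok st (r :: s) ->
  run M pop_arc st 25 (fun st' => State_ok st' s /\ regs st' rta = r).
Proof.
move=> [C fl rs]; have [sn sm] := size_reach rs; have ra := arc_lt r.
rewrite /= in sn sm.
rewrite /pop_arc; apply: run_bound.
apply: run_seq; apply: run_set; first by evt; rewrite (c_k C) /=; lia.
rewrite (c_k C) /= subn1 /=; set s1 := setr _ _ _.
have [[top stk_s] rp_s] : stk st (r :: s) /\ forall v : V, arr st aREP v = rep v by case: C.
have k1 : regs s1 rk = size s by [].
apply: run_seq; apply: run_set; first by evt; rewrite k1; lia.
rewrite k1 [arr s1 _ _]top; set s2 := setr _ _ _.
have ta2 : regs s2 rta = r by [].
apply: run_storeL; [evt|by evt| |by []|].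
- by rewrite ta2; lia.
- by rewrite ta2; apply: haL.
rewrite ta2; set s3 := seta _ _ _ _.
have f3 : fr [:: rk; rta] [:: aFL] st s3.
  split=> [x|k j]; first by rewrite !inE negb_or regs_seta !regs_setr => /andP[/negbTE-> /negbTE->].
  by rewrite !inE => h1 k16; rewrite arr_seta // (negbTE h1).
split=> //; split.
- split=> //.
  + by apply: Env_fr f3 (c_env C) _ _.
  + by apply: stk_eq stk_s _ => j hj; rewrite f3.2.
  + by move=> w; rewrite f3.2.
  + by move=> w; rewrite f3.2 // (c_term C).
- by apply: (flags_del fl (reach_top rs)) => j; rewrite arr_seta.
- exact: (reach_behead rs).
by [].
Qed.

Notation sols := (sols tl hd rep).
Notation later := (later tl hd rep).
Hypothesis feasible : forall v, conn G v (rep v).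

(** The body of a round of [descend] or [backtrack] takes at most [900 * (n + m + 1)]; the excess
    absorbs the loop tests. *)
Definition unit_cost : nat := 1000 * (n + m + 1).

Lemma visited_eq st st' s rs ks : visited st s -> fr rs ks st st' ->
  all (fun x => x \notin rs) [:: rcur; rtgt] ->
  all (fun k => k \notin ks) [:: aTP; aMARK] -> visited st' s.
Proof.
move=> [h1 h2] f /and3P[k1 k2 _] /and3P[k3 k4 _]; split; first by rewrite f.1.
by move=> i /h2[h3 h4]; split=> v; rewrite ?f.1 ?f.2.
Qed.

Lemma State_fr rs ks st st' s : fr rs ks st st' -> State_ok st s ->
  all (fun x => x \notin rs) [:: rN; rM; rNA; rk] ->
  all (fun k => k \notin ks) [:: aHEAD; aNEXT; aSTK; aREP; aTERM; aFL] -> State_ok st' s.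
Proof.
move=> f [C fl r] k1 k2; split=> //.
  by apply: Core_fr f C k1 _; apply/allP=> x hx; apply: (allP k2); move: hx; rewrite !inE => /orP[->|/orP[->|/orP[->|/orP[->|->]]]]; rewrite ?orbT.
have k3 : aFL \notin ks by apply: (allP k2).
by move=> a; rewrite f.2.
Qed.

(** By [valid_exists] every unfinished node has a child, so the remaining depth is a potential and
    the descent always ends at a leaf, the first of those still to come. *)
Lemma descend_ok st s : State_ok st s -> visited st s ->
  run M descend st ((minn n m - size s) * unit_cost + 4) (fun st' => exists s',
    [/\ State_ok st' s', unsat (es s') = None &
        sols s ++ later s = s' :: later s']).
Proof.
move=> S0 v0.
pose inv P t := exists s', [/\ State_ok t s', visited t s',
   P = (minn n m - size s') * unit_cost & sols s ++ later s = sols s' ++ later s'].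
pose Q t := exists s', [/\ State_ok t s', unsat (es s') = None &
        sols s ++ later s = s' :: later s'].
apply: (run_conseq (@run_whileL inv Q _ _ st _ _ _ _)) => //; last 2 first.
- by exists s.
- by move=> t [].
move=> P t ft [s' [S' v' -> eqs]].
have [C fl r] := S'; have [hc rd] := v'; have hN := envN (c_env C).
exists (regs t rcur < n); split; first by rewrite -[X in _ < X]hN; evt.
  rewrite hc => /eqP; rewrite eqb0; case u: (unsat (es s')) => [i|] /=.
    by rewrite ltn_ord.
  by move=> _; exists s'; split=> //; rewrite eqs sols_leaf.
rewrite hc eqb0 negbK; case u: (unsat (es s')) => [i|] /=; last by rewrite ltnn.
move=> _; exists (900 * (n + m + 1)); apply: run_bound.
  apply: run_seq; apply: run_set; first by evt.
  set t1 := setr _ _ _; have f1 : fr [:: rfrom] [::] t t1 := fr_setr _ _ _.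
  have S1 := State_fr f1 S' isT isT.
  have rd1 : node_ready t1 s' i by have := (visited_eq v' f1 isT isT).2 i u.
  apply: run_seq; apply: (run_conseq (run_fr W16 _ (find_child_ok S1 u rd1))) => //.
  move=> t2 [fd f2]; have S2 := State_fr f2 S1 isT isT.
  have [[_ none]|[b [hb _ vb min]]] := fd.
    exfalso; have [|b vb] := @valid_exists _ _ tl hd rep (@arc_rev I) feasible s' r.
      by rewrite u.
    by have := none b (leq0n _); rewrite vb.
  apply: run_seq; apply: (run_conseq (push_ok S2 vb hb)) => t3 S3.
  apply: (run_conseq (visit_ok S3)) => t4 [S4 v4].
  exists ((minn n m - size (b :: s')) * unit_cost); split.
    exists (b :: s'); split=> //; rewrite eqs; apply: sols_later => // c cb.
    by apply: min.
  have [_ _ r3] := S3; have [/= sn sm] := size_reach r3.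
  have lt : size s' < minn n m by rewrite leq_min sn.
  rewrite -(subnSK lt) mulSn /unit_cost /=; lia.
by rewrite /=; lia.
Qed.

(** Each round pops one arc, so the height of the stack is the potential; finding a sibling ends the
    loop, and the remaining potential is dropped. *)
Lemma backtrack_ok st s : State_ok st s ->
  run M backtrack st (size s * unit_cost + 15) (fun st' =>
    (regs st' rfnd = 0 /\ later s = [::]) \/
    (regs st' rfnd = 1 /\ exists s', State_ok st' s' /\ later s = sols s' ++ later s')).
Proof.
move=> S0; rewrite /backtrack; apply: run_bound.
apply: run_seq; apply: run_set; first by evt.
set st1 := setr _ _ _; have f1 : fr [:: rfnd] [::] st st1 := fr_setr _ _ _.
pose inv P t := exists s', State_ok t s' /\
  ([/\ regs t rfnd = 0, P = size s' * unit_cost & later s = later s'] \/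
   [/\ regs t rfnd = 1, P = 0 & later s = sols s' ++ later s']).
pose Q t := (regs t rfnd = 0 /\ later s = [::]) \/
    (regs t rfnd = 1 /\ exists s', State_ok t s' /\ later s = sols s' ++ later s').
apply: (run_conseq (@run_whileL inv Q _ _ st1 (size s * unit_cost) _ _ _)) => //.
- move=> P t ft [s' [S' h]]; have [C fl r] := S'.
  exists ((0 < regs t rk) * (regs t rfnd == 0)); split.
  + apply: ev_mul; [by evt|by evt|].
    by rewrite mulnb; case: (_ && _); lia.
  + case: h => [[h1 _ h3]|[h1 _ h3]]; last by move=> _; right; split=> //; exists s'.
    rewrite h1 eqxx muln1 (c_k C) => /eqP; rewrite eqb0 -eqn0Ngt => /eqP/size0nil s0.
    by left; rewrite h3 s0.
  rewrite mulnb eqb0 negbK => /andP[k0 /eqP f0].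
  case: h => [[h1 -> h3]|[h1]]; last by rewrite f0 in h1.
  case: s' S' C fl r k0 h3 => [|a s'] S' C fl r k0 h3; first by rewrite (c_k C) in k0.
  have [rs' va] : reach s' /\ valid s' a by inversion r.
  have [i [u _ _ _]] := validP va.
  exists (900 * (n + m + 1)); apply: run_bound.
    apply: run_seq; apply: (run_conseq (run_fr W16 _ (pop_ok S'))) => // t2 [[S2 ta2] g2].
    have al := arc_lt a.
    apply: run_seq; apply: run_set; first by evt; rewrite ta2; lia.
    rewrite ta2; set t3 := setr _ _ _; have g3 : fr [:: rfrom] [::] t2 t3 := fr_setr _ _ _.
    have S3 := State_fr g3 S2 isT isT.
    apply: run_seq; apply: (run_conseq (run_fr W16 _ (visit_ok S3))) => // t4 [[S4 v4] g4].
    have fr4 : regs t4 rfrom = a + 1 by rewrite (g4.1 rfrom isT).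
    apply: run_seq.
    apply: (run_conseq (run_fr W16 _ (find_child_ok S4 u (v4.2 _ u)))) => // t5 [fd g5].
    have S5 := State_fr g5 S4 isT isT; have [C5 _ _] := S5.
    have fn5 : regs t5 rfnd = 0.
      by rewrite (g5.1 rfnd isT) (g4.1 rfnd isT) (g3.1 rfnd isT) (g2.1 rfnd isT).
    apply: run_if; first by evt.
      rewrite (envNA (c_env C5)) eqb0 negbK => lt.
      have [[e _]|[b [hb fb vb min]]] := fd; first by rewrite e ltnn in lt.
      rewrite fr4 addn1 in fb min.
      apply: run_seq; apply: (run_conseq (push_ok S5 vb hb)) => t6 S6.
      apply: run_set; first by evt.
      set t7 := setr _ _ _; have g7 : fr [:: rfnd] [::] t6 t7 := fr_setr _ _ _.
      exists 0; split; last by rewrite /= mulSn /unit_cost; lia.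
      exists (b :: s'); split; first exact: State_fr g7 S6 isT isT.
      by right; split=> //; rewrite h3; apply: later_next.
    rewrite (envNA (c_env C5)) => /eqP; rewrite eqb0 => nlt.
    have [[_ none]|[b [hb]]] := fd; last by rewrite hb ltn_ord in nlt.
    apply: run_skip; exists (size s' * unit_cost); split; last first.
      by rewrite /= mulSn /unit_cost; lia.
    exists s'; split=> //; left; split=> //; rewrite h3; apply: later_pop => b ab.
    by apply: none; rewrite fr4 addn1.
  by rewrite /=; lia.
- exists s; split; first exact: State_fr f1 S0 isT isT.
  by left.
- by move=> t [].
by rewrite /=; lia.
Qed.

(** * Writing a solution *)

Lemma mark_terminals_ok st s : State_ok st s ->
  run M mark_terminals st (n * 25 + 6) (fun st' => forall v : V, arr st' aTP v = (v \in TV)).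
Proof.
move=> [C _ _]; rewrite /mark_terminals.
pose F (v : V) (f : nat -> nat) := f aTP = (v \in TV).
apply: (run_le (@run_each F _ st 17 _ _ _ (envN (c_env C)) _ _)) => //;
  [|by move=> v f g h e0; rewrite /F -h|by move=> t []].
move=> v t f hj same; have vl := vL v.
apply: run_bound.
  apply: run_storeL; [by evt|by evt; rewrite hj|by rewrite hj|by []|].
  rewrite hj same // (c_term C); split.
    by move=> k j k16 iv; rewrite !arr_seta // (negbTE iv) !andbF.
  by rewrite /F arr_seta //= eqxx.
by [].
Qed.

Definition vset (s : seq 'I_na) : {set V} := TV :|: cover (es s).

Lemma mark_ends_ok st s : State_ok st s -> (forall v : V, arr st aTP v = (v \in TV)) ->
  run M mark_ends st (m * 80 + 6) (fun st' => forall v : V, arr st' aTP v = (v \in vset s)).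
Proof.
move=> [C fl r] tv; have na2 := na_def.
pose inv j t := forall v : V, arr t aTP v =
  (v \in TV) || [exists a : 'I_na, [&& a./2 < j, eo a \in es s & v \in eo a]].
have hM := envM (c_env C).
rewrite /mark_ends.
apply: (run_le (@run_forL inv rj rM _ st m 72 _ _ _ _ hM _ _ _ _)) => //.
- by lia.
- by move=> j t t' [_ fA] h v; rewrite fA // h.
- move=> v; rewrite tv; case: existsP => [[a /and3P[]]|] //; by rewrite orbF.
- move=> j t jm hj f h.
  have a2 : j.*2 < na by rewrite na2; lia.
  pose a : 'I_na := Ordinal a2.
  have ha : a./2 = j by rewrite /= doubleK.
  have flj : arr t aFL j = (eo a \in es s) by rewrite f.2 // -ha fl.
  have ea t' : regs t' rj = j -> ev M t' (Bin Mul (Cst 2) (Reg rj)) a.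
    move=> hj'; apply: (ev_eq (v := 2 * regs t' rj)); last by rewrite hj' /= mul2n.
    by evt; rewrite hj'; lia.
  have step v : [exists b : 'I_na, [&& b./2 < j.+1, eo b \in es s & v \in eo b]] =
     (eo a \in es s) && (v \in eo a) ||
     [exists b : 'I_na, [&& b./2 < j, eo b \in es s & v \in eo b]].
    apply/existsP/orP=> [[b /and3P[bj be vb]]|[/andP[ae va]|/existsP[b /and3P[bj be vb]]]].
    - move: bj; rewrite ltnS leq_eqVlt => /orP[/eqP bj|bj]; [left|right].
        have -> : eo a = eo b by apply/eqP; rewrite eo_half ha bj.
        by rewrite be.
      by apply/existsP; exists b; rewrite bj be.
    - by exists a; rewrite ha ltnSn ae.
    - by exists b; rewrite be vb ltnS ltnW.
  apply: run_bound.
    apply: run_if; first by evt; rewrite hj; lia.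
      rewrite hj flj eqb0 negbK => ae.
      apply: run_seq; apply: run_storeL.
      - exact: ev_src (ea _ hj).
      - by evt.
      - exact: vL.
      - by [].
      set t1 := seta _ _ _ _.
      apply: run_storeL.
      - exact: ev_dst (ea t1 hj).
      - by evt.
      - exact: vL.
      - by [].
      move=> v; rewrite step ae /= !arr_seta //= h /eo !inE -!val_eqE /=.
      by case: (_ == _) => /=; rewrite ?orbT //; case: (_ == _) => /=; rewrite ?orbT.
    rewrite hj flj => /eqP; rewrite eqb0 => ae; apply: run_skip => v.
    by rewrite step (negbTE ae) h.
  by [].
- move=> t [h _] v; rewrite h /vset inE; congr (nat_of_bool (_ || _)).
  apply/existsP/bigcupP=> [[a /and3P[_ ae va]]|[e ee ve]]; first by exists (eo a).
  have /imsetP[a _ ea] := subsetP (es_sub tl hd s) _ ee.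
  exists a; rewrite -ea ee ve !andbT; exact: half_arc.
Qed.

(** [run_for] only covers runs that write nothing, so this loop is treated directly by
    [runp_while]. *)
Lemma emit_loop_ok y N k e g st : regs st y = N -> N <= L -> y != rj -> k < 16 ->
  (forall s j, j < N -> fr [:: rj] [::] st s -> regs s rj = j -> ev M s e (g j)) ->
  runp M (emit_loop y k e) st (N * (esize e + 25) + 10) (fun w s =>
    w = [seq g i | i <- iota 0 N & arr st k i != 0] /\ fr [:: rj] [::] st s).
Proof.
move=> hy NL yj k16 he; rewrite /emit_loop /For.
set body := Seq (If _ _ _) _; set c := Bin Lt _ _.
have frx t v : fr [:: rj] [::] t (setr t rj v) by exact: fr_setr.
pose out j := [seq g i | i <- iota 0 j & arr st k i != 0].
pose inv P (w : seq nat) t := exists j, [/\ regs t rj = j, j <= N, w = out j,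
  fr [:: rj] [::] st t & P = (N - j) * (esize e + 25)].
pose Q w t := w = out N /\ fr [:: rj] [::] st t.
apply: (@runp_le _ _ _ (2 + (N * (esize e + 25) + 4)) _ (fun w t => Q ([::] ++ w) t)) => //; last by lia.
apply: runp_seq; apply: (@runp_le _ _ _ 2 _ (fun w t => w = [::] /\ t = setr st rj 0)) => //.
  by apply: run_set; first by evt.
move=> _ _ [-> ->].
have := @runp_while M inv Q c body _ (N * (esize e + 25)) [::] (setr st rj 0); apply; last first.
  by exists 0; split; rewrite ?subn0.
move=> P w t [j [hj jN -> f ->]].
have yt : regs t y = N by rewrite f.1 ?inE.
exists (j < N); split; first by rewrite -hj -yt; evt.
  move=> /eqP; rewrite eqb0 -leqNgt => le; have e0 : N = j by lia.
  by rewrite /Q e0.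
rewrite eqb0 negbK => lt; exists (esize e + 20).
have outS : out j.+1 = out j ++ (if arr st k j != 0 then [:: g j] else [::]).
  by rewrite /out -[j.+1]addn1 iotaD filter_cat map_cat /= add0n; case: ifP.
apply: (@runp_le _ _ _ ((esize (Arr k (Reg rj))).+1 + ((esize e).+1 + 1) + 4) _
  (fun w' t' => w' = (if arr st k j != 0 then [:: g j] else [::]) /\
     fr [:: rj] [::] st t' /\ regs t' rj = j.+1)); first last.
- move=> w' t' [-> [f' hj']]; exists ((N - j.+1) * (esize e + 25)); split.
    by exists j.+1; rewrite outS.
  have -> : N - j = (N - j.+1).+1 by lia.
  by rewrite mulSn /=; lia.
- by rewrite /=; lia.
apply: runp_seq.
apply: (@runp_le _ _ _ ((esize (Arr k (Reg rj))).+1 + ((esize e).+1 + 1)) _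
  (fun w' t' => w' = (if arr st k j != 0 then [:: g j] else [::]) /\ t' = t)) => //; last first.
  move=> w' t' [-> ->]; apply: (@runp_le _ _ _ 4 _ (fun w2 t2 => w2 = [::] /\ t2 = setr t rj j.+1)) => //.
    apply: run_set; first by evt; rewrite hj; lia.
    by rewrite hj addn1.
  by move=> w2 t2 [-> ->]; rewrite cats0; split=> //; split=> //; apply: fr_trans f (frx _ _).
apply: runp_if; first by evt; rewrite hj; lia.
  rewrite hj (f.2 k) // => ->; apply: runp_emit => //; exact: he.
by rewrite hj (f.2 k) // => ->; apply: run_skip.
Qed.

Definition outw (s : seq 'I_na) : seq nat := @codes I (vset s, es s).

Lemma emit_solution_ok st s : State_ok st s ->
  runp M emit_solution st (200 * (n + m) + 60) (fun w st' => w = outw s /\ State_ok st' s).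
Proof.
move=> S0; have na2 := na_def; rewrite /emit_solution.
apply: (@runp_le _ _ _ ((n * 25 + 6) + ((m * 80 + 6) + ((n * 30 + 10) + (m * 40 + 10)))) _
  (fun w t => w = outw s /\ State_ok t s)) => //; last by lia.
apply: runp_seq; apply: (runp_le (run_fr W16 _ (mark_terminals_ok S0))) => //.
move=> _ t1 [-> [tv1 f1]]; have S1 := State_fr f1 S0 isT isT.
apply: runp_seq; apply: (runp_le (run_fr W16 _ (mark_ends_ok S1 tv1))) => //.
move=> _ t2 [-> [tv2 f2]]; have S2 := State_fr f2 S1 isT isT; have [C2 fl2 _] := S2.
have hN := envN (c_env C2); have hM := envM (c_env C2).
apply: runp_seq; apply: (runp_le (@emit_loop_ok rN n aTP (Reg rj) id t2 hN _ _ _ _)) => //.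
- by lia.
- by move=> t j jn f hj; rewrite -hj; evt.
- by rewrite /=; lia.
move=> w3 t3 [-> f3]; have S3 := State_fr f3 S2 isT isT; have [C3 fl3 _] := S3.
have hN3 := envN (c_env C3); have hM3 := envM (c_env C3).
apply: (runp_le (@emit_loop_ok rM m aFL (Bin Add (Reg rN) (Reg rj)) (addn n) t3 hM3 _ _ _ _)) => //.
- by lia.
- move=> t j jm f hj; have Nt : regs t rN = n by rewrite (f.1 rN isT).
  apply: (ev_eq (v := regs t rN + regs t rj)); last by rewrite Nt hj.
  by evt; rewrite hj Nt; lia.
- by rewrite /=; lia.
move=> w4 t4 [-> f4]; split; last exact: State_fr f4 S3 isT isT.
rewrite /outw /codes /=; congr (_ ++ _).
  rewrite map_id -val_enum_ord filter_map; congr map; rewrite /= enumT.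
  rewrite [RHS]/(enum _) /=; apply: eq_filter => v /=.
  by rewrite tv2; case: (v \in _).
congr map; apply/eq_in_filter=> j; rewrite mem_iota /= => jm.
have a2 : j.*2 < na by rewrite na2; lia.
have := fl3 (Ordinal a2); rewrite eo_nth /= doubleK => ->; by case: (_ \in _).
Qed.

(** At most [minn n m] rounds of descent; two more units cover the initial visit and the output. *)
Definition leaf_cost : nat := (minn n m + 2) * unit_cost.

Lemma to_leaf_ok st s : State_ok st s ->
  runp M to_leaf st leaf_cost (fun w st' => exists s',
    [/\ State_ok st' s', sols s ++ later s = s' :: later s' & w = outw s']).
Proof.
move=> S0; rewrite /to_leaf.
apply: (@runp_le _ _ _ ((700 * (n + m) + 500) + (((minn n m - size s) * unit_cost + 4) +
   (200 * (n + m) + 60))) _ (fun w st' => exists s',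
    [/\ State_ok st' s', sols s ++ later s = s' :: later s' & w = outw s'])) => //; last first.
  have h : (minn n m - size s) * unit_cost <= minn n m * unit_cost.
    by rewrite leq_mul2r leq_subr orbT.
  have e1 : leaf_cost = minn n m * unit_cost + 2 * unit_cost by rewrite /leaf_cost mulnDl.
  have e2 : 2 * unit_cost = 2000 * (n + m + 1) by rewrite /unit_cost; lia.
  lia.
apply: runp_seq; apply: (runp_le (visit_ok S0)) => // _ t1 [-> [S1 v1]].
apply: runp_seq; apply: (runp_le (descend_ok S1 v1)) => // _ t2 [-> [s' [S2 u eqs]]].
apply: (runp_le (emit_solution_ok S2)) => // w t3 [-> S3].
by exists s'.
Qed.

Definition chunks (ss : seq (seq action)) (z : seq action) : seq action :=
  flatten [seq rcons x Out | x <- ss] ++ z.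

(** Induction on the number of leaves to come. A middle segment is the climb after one leaf followed
    by the descent to the next, hence the factor 2. The first segment is kept apart because the
    preprocessing will precede it, the last because it only holds the final climb. *)
Lemma main_loop_ok k : forall st s, State_ok st s -> regs st rfnd = 1 ->
  size (sols s ++ later s) = k ->
  exists st' x ss z, [/\
    exec M (While (Reg rfnd) round) st (chunks (x :: ss) z) st',
    all (all silent) (x :: ss), all silent z /\ puts z = [::],
    map puts (x :: ss) = map outw (sols s ++ later s) &
    [/\ size x <= leaf_cost + 2, size z <= 2 * leaf_cost + 20 &
        all (fun y => size y <= 2 * leaf_cost + 20) ss]].
Proof.
elim/ltn_ind: k => k IH st s S0 fn hk.
have [t1 [st1 [ex1 q1 le1 [s1 [S1 eqs w1]]]]] := to_leaf_ok S0.
have [t2 [st2 [ex2 q2 le2 [w2 post]]]] := backtrack_ok S1.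
have exr : exec M round st (t1 ++ [:: Out] ++ t2) st2.
  apply: ExecSeq ex1 _; apply: ExecSeq ex2; exact: ExecDeliver.
have ssz : size s1 * unit_cost + 15 <= leaf_cost + 15.
  have [_ _ r1] := S1; have [h1 h2] := size_reach r1.
  by rewrite leq_add2r leq_mul2r; apply/orP; right; rewrite -[X in X <= _]addn0 leq_add // leq_min h1.
have evf : ev M st (Reg rfnd) 1 := ev_eq (ev_reg _ _ _) fn.
set tk := rcons (ticks (Reg rfnd)) Tick.
have stk_ : size tk = 2 by [].
have [[f0 l0]|[f1 [s' [S' l1]]]] := post.
  have ex3 : exec M (While (Reg rfnd) round) st2 tk st2.
    by apply: ExecWhileEnd; rewrite /= f0.
  exists st2, (tk ++ t1), [::], (t2 ++ tk); split.
  - have := ExecWhile evf isT exr ex3; rewrite /chunks /= cats0 -cats1 /=.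
    by rewrite -!catA /=.
  - by rewrite /= q1.
  - by rewrite all_cat q2 puts_cat w2.
  - by rewrite eqs l0 /= -w1.
  - rewrite /= !size_cat stk_; split=> //; lia.
have lt : size (sols s' ++ later s') < k by rewrite -hk eqs l1.
have [st3 [x [ss [z [ex3 q3 [qz wz] w3 [b1 b2 b3]]]]]] := IH _ lt _ _ S' f1 erefl.
exists st3, (tk ++ t1), ((t2 ++ x) :: ss), z; split=> //.
- have := ExecWhile evf isT exr ex3; by rewrite /chunks /= -!cats1 -!catA /=.
- by move: q3 => /= /andP[qx qss]; rewrite q1 all_cat q2 qx qss.
- by rewrite eqs l1 /= -w3 /= puts_cat w2 -w1.
- split=> //; rewrite ?size_cat ?stk_; first by lia.
  by rewrite /= b3 andbT size_cat; lia.
Qed.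

End Search.

(** * Preprocessing *)

Lemma build_adjacency_ok st : regs st rNA = na ->
  (forall i, arr st aHEAD i = 0) ->
  run M build_adjacency st (na * 50 + 6) (fun st' =>
    (forall v : V, arr st' aHEAD v = prevarc I v na) /\
    (forall a : 'I_na, arr st' aNEXT a = prevarc I (tl a) a)).
Proof.
move=> hna h0; have na2 := na_def.
pose inv j t := (forall v : V, arr t aHEAD v = prevarc I v j) /\
  (forall a : 'I_na, a < j -> arr t aNEXT a = prevarc I (tl a) a).
rewrite /build_adjacency.
apply: (run_le (@run_forL inv rj rNA _ st na 42 _ _ _ _ hna _ _ _ _)) => //.
- by lia.
- by move=> j t t' [_ fA] [h1 h2]; split=> [v|a aj]; rewrite fA // ?h1 ?h2.
- move=> j t jn hj f [h1 h2]; pose a : 'I_na := Ordinal jn.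
  have ea t' : regs t' rj = j -> ev M t' (Reg rj) a.
    by move=> h; apply: (ev_eq (ev_reg _ _ _) h).
  have jl : j < L := aL a.
  apply: run_bound.
    apply: run_seq; apply: run_storeL.
    - exact: ea hj.
    - apply: ev_arrL; [exact: ev_src (ea _ hj)|exact: vL|by []].
    - exact: jl.
    - by [].
    rewrite h1; set t1 := seta _ _ _ _.
    apply: run_storeL.
    - exact: ev_src (ea t1 hj).
    - by evt; rewrite [regs t1 _]hj; lia.
    - exact: vL.
    - by [].
    rewrite [regs t1 _]hj; split=> [v|b].
      rewrite !arr_seta // h1 prevarcS (_ : nth 0 iw (2 + j) = tl a); last exact: iw_arc a.
      by rewrite eq_sym addn1.
    rewrite ltnS leq_eqVlt arr_seta //= arr_seta //= => /orP[/eqP bj|bj].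
      have -> : b = a by apply: ord_inj.
      by rewrite eqxx.
    by rewrite (ltn_eqF bj) h2.
  by [].
- by move=> t [[h1 h2] _]; split=> // a; apply: h2.
Qed.

Lemma init_rep_ok st : regs st rN = n ->
  run M init_rep st (n * 20 + 6) (fun st' => forall v : V, arr st' aREP v = v).
Proof.
move=> hN; rewrite /init_rep.
pose F (v : V) (f : nat -> nat) := f aREP = v.
apply: (run_le (@run_each F _ st 12 _ _ _ hN _ _)) => //;
  [|by move=> v f g h e0; rewrite /F -h|by move=> t []].
move=> v t f hj same; apply: run_bound.
  apply: run_storeL; [by evt|by evt|by rewrite hj; apply: vL|by []|].
  rewrite hj; split; last by rewrite /F arr_seta //= eqxx.
  by move=> k j k16 iv; rewrite arr_seta // (negbTE iv) andbF.
by [].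
Qed.

Lemma relabel_ok st : regs st rN = n ->
  run M relabel st (n * 40 + 6) (fun st' => forall v : V, arr st' aREP v =
    if arr st aREP v == regs st rold then regs st rnew else arr st aREP v).
Proof.
move=> hN; rewrite /relabel.
pose F (v : V) (f : nat -> nat) := f aREP =
  if arr st aREP v == regs st rold then regs st rnew else arr st aREP v.
apply: (run_le (@run_each F _ st 32 _ _ _ hN _ _)) => //;
  [|by move=> v f g h e0; rewrite /F -h|by move=> t []].
move=> v t f hj same; have v_l := vL v.
have ot : regs t rold = regs st rold := f.1 rold isT.
have nt : regs t rnew = regs st rnew := f.1 rnew isT.
apply: run_bound.
  apply: run_if; first by evt; rewrite hj.
    rewrite hj ot same // eqb0 negbK => e.
    apply: run_storeL; [by evt|by evt|by rewrite hj|by []|].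
    rewrite hj nt; split; last by rewrite /F e arr_seta //= eqxx.
    by move=> k j k16 iv; rewrite arr_seta // (negbTE iv) andbF.
  rewrite hj ot same // => /eqP; rewrite eqb0 => e; apply: run_skip; split=> //.
  by rewrite /F (negbTE e) same.
by [].
Qed.

(** A star centred at the first terminal imposes the same connectivity as all pairs, with linearly
    many pairs. The pair of the centre with itself is kept so that the second components are exactly
    the terminals. *)
Definition pairs_of (t : seq V) : seq (V * V) :=
  if t is u :: _ then [seq (u, w) | w <- t] else [::].
Definition pairs (ts : seq (seq V)) : seq (V * V) := flatten [seq pairs_of t | t <- ts].
Notation all_pairs := (pairs (tlist I)).

Definition joins (T : {set {set V}}) (D : seq (V * V)) : Prop :=
  forall p, p \in D -> conn T p.1 p.2.

Definition TV : {set V} := [set v in [seq p.2 | p <- all_pairs]].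

Definition nonisolated : {set V} := [set tl a | a in [set: 'I_na]].
(** The potential for merges. Leaving out isolated vertices bounds it by the number of arcs, so
    merging costs [O(nm)] rather than [O(n^2)]. *)
Definition classes (rho : V -> V) : nat := #|[set rho v | v in nonisolated]|.

Lemma classes_le rho : classes rho <= na.
Proof.
apply: leq_trans (leq_imset_card _ _) _; apply: leq_trans (leq_imset_card _ _) _.
by rewrite cardsT card_ord.
Qed.

Lemma conn_nonisolated (u w : V) : conn G u w -> u != w -> u \in nonisolated.
Proof.
move=> /connectP[[|x p] /= pth ->]; first by rewrite eqxx.
case/andP: pth => ux _ _; have [a [ta _]] := G_arc (@arc_rev I) ux.
by apply/imsetP; exists a.
Qed.

(** Distinct vertices connected in the graph are not isolated, so [rho w] was counted and is now
    gone. *)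
Lemma classes_merge rho (u w : V) : conn G w u -> rho w != rho u ->
  classes (fun v => if rho v == rho w then rho u else rho v) < classes rho.
Proof.
move=> c ne; have wu : w != u by apply: contraNneq ne => ->.
have wN := conn_nonisolated c wu.
have uN : u \in nonisolated by apply: (@conn_nonisolated u w); rewrite 1?connC 1?eq_sym.
apply: proper_card; apply/properP; split.
  by apply/subsetP=> x /imsetP[v vN ->]; case: ifP => _; apply: imset_f.
exists (rho w); first exact: imset_f.
apply/imsetP=> -[v _]; case: ifP => [_ /eqP|/eqP h /esym //].
by rewrite (negbTE ne).
Qed.

(** [r_rho] says that the classes never ask for more than the terminal sets do, [r_good] that they
    ask for at least the pairs [D] read so far. *)
Record Read (st : state) (D : seq (V * V)) (rho : V -> V) : Prop := MkRead {
  r_env : Env st;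
  r_mark : eqlab st aMARK G;
  r_rep : forall v : V, arr st aREP v = rho v;
  r_term : forall v : V, arr st aTERM v = (v \in [seq p.2 | p <- D]);
  r_rho : forall T v, joins T all_pairs -> conn T v (rho v);
  r_good : regs st rbad = 0 -> joins G D /\ forall p, p \in D -> rho p.1 = rho p.2;
  r_bad : regs st rbad != 0 -> ~ joins G D }.

Lemma Read_fr rs ks st st' D rho : fr rs ks st st' -> Read st D rho ->
  all (fun x => x \notin rs) [:: rN; rM; rNA; rbad] ->
  all (fun k => k \notin ks) [:: aHEAD; aNEXT; aMARK; aREP; aTERM] -> Read st' D rho.
Proof.
move=> f [h1 h2 h3 h4 h5 h6 h7] /and5P[k1 k2 k3 k4 _] /and5P[k5 k6 k7 k8 /andP[k9 _]].
split=> //.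
- by apply: Env_fr f h1 _ _; rewrite /= ?k1 ?k2 ?k3 ?k5 ?k6.
- by move=> u v; rewrite !f.2.
- by move=> v; rewrite f.2.
- by move=> v; rewrite f.2.
- by rewrite f.1.
- by rewrite f.1.
Qed.

Definition merge_cost : nat := n * 40 + 40.

Lemma drop_cons (A : Type) (d : A) q (l r : seq A) x : drop q l = x :: r ->
  [/\ q < size l, nth d l q = x & drop q.+1 l = r].
Proof.
move=> h; have lt : q < size l.
  by rewrite ltnNge; apply/negP=> le; rewrite drop_oversize in h.
by move: h; rewrite (drop_nth d lt) => -[-> ->].
Qed.

Lemma read_terminal_ok st D rho (u w : V) r : Read st D rho ->
  regs st ru = u -> (u, w) \in all_pairs ->
  0 < regs st rlen -> regs st rlen < W ->
  drop (regs st rq) iw = (w : nat) :: r ->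
  runx M read_terminal st (fun T st' => exists rho',
    [/\ Read st' (rcons D (u, w)) rho',
        regs st' rq = (regs st rq).+1, regs st' rlen = (regs st rlen).-1, regs st' ru = u &
        T + classes rho' * merge_cost <= classes rho * merge_cost + 80]).
Proof.
move=> R hu uw l0 lW dq.
have [qs nq _] := drop_cons 0 dq.
have [e mk rp tm rho_ok good bad] := R.
have := size_iw I; have na2 := na_def => sz.
have w_l := vL w; have u_l := vL u.
have wn := ltn_ord w.
rewrite /read_terminal.
apply: runx_seq; apply: run_runx.
  apply: run_set; first by apply: ev_input; [evt|exact: qs|rewrite nq; lia].
  by rewrite nq; apply: erefl.
move=> _ <-; set s1 := setr _ _ _.
apply: runx_seq; apply: run_runx.
  have q1 : regs s1 rq = regs st rq by [].
  apply: run_set; first by evt; rewrite q1; lia.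
  exact: erefl.
move=> _ <-; set s2 := setr _ _ _.
apply: runx_seq; apply: run_runx.
  have q2 : regs s2 rlen = regs st rlen by [].
  apply: run_set; first by evt; rewrite q2; lia.
  exact: erefl.
move=> _ <-; set s3 := setr _ _ _.
apply: runx_seq; apply: run_runx.
  apply: run_storeL; [by evt|by evt|exact: w_l|by []|].
  exact: erefl.
move=> _ <-; rewrite [regs s3 rw]/(val w); set s4 := seta _ _ _ _.
have f4 : fr [:: rw; rq; rlen] [:: aTERM] st s4.
  split=> [x|k j].
    by rewrite !inE !negb_or regs_seta !regs_setr => /and3P[/negbTE-> /negbTE-> /negbTE->].
  by rewrite inE => h k16; rewrite arr_seta // (negbTE h).
have q4 : regs s4 rq = (regs st rq).+1 by rewrite -[RHS]addn1.
have l4 : regs s4 rlen = (regs st rlen).-1 by rewrite -subn1.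
have u4 : regs s4 ru = u by rewrite (f4.1 ru isT).
have w4 : regs s4 rw = w by [].
have mk4 (v : V) : arr s4 aMARK v = arr st aMARK v by rewrite f4.2.
have rp4 (v : V) : arr s4 aREP v = rho v by rewrite f4.2.
have e4 : Env s4 by apply: Env_fr f4 e _ _.
have mkeq4 : eqlab s4 aMARK G by move=> p q; rewrite !mk4.
have tm4 (v : V) : arr s4 aTERM v = (v \in [seq p.2 | p <- rcons D (u, w)]).
  rewrite arr_seta //= [arr s3 _ _]tm map_rcons mem_rcons inE -val_eqE /=.
  by case: eqP.
have b4 : regs s4 rbad = regs st rbad := f4.1 rbad isT.
have ev_w t k : regs t rw = w -> k < 16 -> ev M t (Arr k (Reg rw)) (arr t k w).
  by move=> h k16; rewrite -h; apply: ev_arrL; [evt|rewrite h|].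
have ev_u t k : regs t ru = u -> k < 16 -> ev M t (Arr k (Reg ru)) (arr t k u).
  by move=> h k16; rewrite -h; apply: ev_arrL; [evt|rewrite h|].
have joinsS : joins G (rcons D (u, w)) <-> joins G D /\ conn G u w.
  split=> [h|[h1 h2] p].
    split; last by apply: (h (u, w)); rewrite mem_rcons mem_head.
    by move=> p pD; apply: h; rewrite mem_rcons inE pD orbT.
  by rewrite mem_rcons inE => /orP[/eqP->|/h1].
have mg : 0 < merge_cost by rewrite /merge_cost; lia.
apply: runx_if; first by apply: ev_eqb (ev_w s4 aMARK w4 isT) (ev_u s4 aMARK u4 isT).
  rewrite mkeq4 eqb0 negbK connC => cuw.
  apply: runx_if; first by apply: ev_eqb (ev_w s4 aREP w4 isT) (ev_u s4 aREP u4 isT).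
    rewrite !rp4 eqb0 negbK => /eqP/ord_inj ruw.
    apply: run_runx; first by apply: run_skip; apply: erefl.
    move=> _ <-; exists rho; split=> //; last by rewrite /=; lia.
    split=> //; rewrite b4.
      move=> /good[h1 h2]; split; first exact/joinsS.
      by move=> p; rewrite mem_rcons inE => /orP[/eqP->|/h2].
    by move=> /bad nb /joinsS[].
  rewrite !rp4 => /eqP; rewrite eqb0 => nruw.
  have ne : rho w != rho u by [].
  pose rho' v := if rho v == rho w then rho u else rho v.
  apply: (@run_runx _ _ _ merge_cost (fun t => (forall v : V, arr t aREP v = rho' v) /\
     fr (wr merge_class) (wa merge_class) s4 t)).
    apply: run_fr => //; rewrite /merge_class; apply: run_bound.
      apply: run_seq; apply: run_set; first exact: ev_w.
      set s5 := setr _ _ _.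
      apply: run_seq; apply: run_set; first exact: ev_u.
      set s6 := setr _ _ _.
      apply: (run_conseq (relabel_ok (envN e4 : regs s6 rN = n))) => t h v.
      rewrite h [arr s6 _ _]rp4 /rho'.
      have -> : regs s6 rold = rho w by rewrite -rp4.
      have -> : regs s6 rnew = rho u by rewrite -rp4.
      by rewrite val_eqE; case: eqP.
    by rewrite /merge_cost /=; lia.
  move=> t [rpt ft]; exists rho'; split.
  - have bt : regs t rbad = regs st rbad by rewrite (ft.1 rbad isT).
    split=> //.
    + by apply: Env_fr ft e4 _ _.
    + by move=> p q; rewrite !ft.2.
    + by move=> v; rewrite ft.2.
    + move=> T v jT; rewrite /rho'; case: eqP => [vw|_]; last exact: rho_ok.
      (* Connect [v] to [rho w], back to [w], across the pair to [u], and on to [rho u]. *)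
      have c1 := rho_ok T v jT; have c2 := rho_ok T w jT; have c3 := rho_ok T u jT.
      have c4 : conn T u w := jT _ uw.
      rewrite vw in c1; apply: conn_trans c1 _; rewrite connC in c2.
      apply: conn_trans c2 _; rewrite connC in c4; exact: conn_trans c4 c3.
    + rewrite bt => /good[h1 h2]; split; first exact/joinsS.
      move=> p; rewrite mem_rcons inE /rho' => /orP[/eqP->|/h2 ->] //=.
      by rewrite eqxx; case: ifP.
    + by rewrite bt => /bad nb /joinsS[].
  - by rewrite (ft.1 rq isT).
  - by rewrite (ft.1 rlen isT).
  - by rewrite (ft.1 ru isT).
  - rewrite connC in cuw; have := classes_merge cuw ne; rewrite -/rho' => lt.
    have : (classes rho').+1 * merge_cost <= classes rho * merge_cost by rewrite leq_mul2r lt orbT.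
    by rewrite mulSn /=; lia.
rewrite mkeq4 connC => /eqP; rewrite eqb0 => ncuw.
apply: run_runx; first by apply: run_set; [evt|apply: erefl].
move=> _ <-; exists rho; split=> //; last by rewrite /=; lia.
have f5 : fr [:: rbad] [::] s4 (setr s4 rbad 1) := fr_setr _ _ _.
split.
- by apply: Env_fr f5 e4 _ _.
- exact: mkeq4.
- exact: rp4.
- exact: tm4.
- exact: rho_ok.
- by rewrite regs_setr.
- by move=> _ /joinsS[_]; rewrite (negbTE ncuw).
Qed.

Definition words (ts : seq (seq V)) : seq nat :=
  flatten [seq size t :: [seq val v | v <- t] | t <- ts].

Lemma iw_terminals : drop (2 + na) iw = size (tlist I) :: words (tlist I).
Proof.
by rewrite /input_words add2n /= drop_size_cat // size_pairs.
Qed.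

Lemma pairs_cons t ts : pairs (t :: ts) = pairs_of t ++ pairs ts.
Proof. by []. Qed.

Lemma read_set_ok st D rho t0 ts : Read st D rho ->
  all_pairs = D ++ pairs (t0 :: ts) ->
  0 < regs st rcnt -> regs st rcnt < W ->
  drop (regs st rq) iw = words (t0 :: ts) ->
  runx M read_set st (fun T st' => exists rho',
    [/\ Read st' (D ++ pairs_of t0) rho',
        drop (regs st' rq) iw = words ts, regs st' rcnt = (regs st rcnt).-1 &
        T + classes rho' * merge_cost <= classes rho * merge_cost + 90 * (size t0).+1]).
Proof.
move=> R ap c0 cW dq.
have sz := size_iw I; have na2 := na_def.
have [qs nq dq1] := drop_cons 0 (dq : _ = size t0 :: ([seq val v | v <- t0] ++ words ts)).
have szt : size t0 <= size iw.
  rewrite -(size_map val t0); apply: leq_trans (leq_subr (regs st rq).+1 _).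
  by rewrite -size_drop dq1 size_cat leq_addr.
rewrite /read_set.
apply: runx_seq; apply: run_runx.
  apply: run_set; first by evt; lia.
  exact: erefl.
move=> _ <-; set s1 := setr _ _ _.
have q1 : regs s1 rq = regs st rq by [].
apply: runx_seq; apply: run_runx.
  apply: run_set; first by apply: ev_input; [evt|rewrite q1|rewrite q1 nq; lia].
  by rewrite q1 nq; apply: erefl.
move=> _ <-; set s2 := setr _ _ _.
have q2 : regs s2 rq = regs st rq by [].
apply: runx_seq; apply: run_runx.
  apply: run_set; first by evt; rewrite q2; lia.
  by rewrite q2 addn1; apply: erefl.
move=> _ <-; set s3 := setr _ _ _.
have f3 : fr [:: rcnt; rlen; rq] [::] st s3.
  by split=> // x; rewrite !inE !negb_or !regs_setr => /and3P[/negbTE-> /negbTE-> /negbTE->].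
have R3 := Read_fr f3 R isT isT.
have c3 : regs s3 rcnt = (regs st rcnt).-1 by rewrite -subn1.
have q3 : regs s3 rq = (regs st rq).+1 by [].
have l3 : regs s3 rlen = size t0 by [].
apply: runx_if; first by evt.
  rewrite l3; move: (s3) f3 R3 c3 q3 l3 => {s1 q1 s2 q2}s3 f3 R3 c3 q3 l3 t0n.
  case: t0 ap dq dq1 szt t0n nq l3 => // u t0 ap dq dq1 szt _ nq l3.
  have [qs3 nq3 _] := drop_cons 0 (dq1 : _ = (u : nat) :: ([seq val v | v <- t0] ++ words ts)).
  apply: runx_seq; apply: run_runx.
    apply: run_set; first by apply: ev_input; [evt|rewrite q3|rewrite q3 nq3; have := ltn_ord u; lia].
    by rewrite q3 nq3; apply: erefl.
  move=> _ <-; set s4 := setr _ _ _.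
  have f4 : fr [:: ru] [::] s3 s4 := fr_setr _ _ _.
  have R4 := Read_fr f4 R3 isT isT.
  pose inv P t := exists D' rho' (ws : seq V), [/\ Read t D' rho',
    D ++ pairs_of (u :: t0) = D' ++ [seq (u, w) | w <- ws],
    regs t rlen = size ws, drop (regs t rq) iw = [seq val v | v <- ws] ++ words ts &
    regs t ru = u /\ P = classes rho' * merge_cost + 85 * size ws].
  pose Q P t := exists rho', [/\ Read t (D ++ pairs_of (u :: t0)) rho',
    P = classes rho' * merge_cost & drop (regs t rq) iw = words ts].
  have i0 : inv (classes rho * merge_cost + 85 * (size t0).+1) s4.
    by exists D, rho, (u :: t0); split=> //; rewrite ?[regs s4 rq]q3.
  have := @runx_while M W16 inv Q (Reg rlen) read_terminal s4 _ isT _ i0; case.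
    move=> P t ft [D' [rho' [ws [Rt eD hl hq [hu ->]]]]].
    exists (regs t rlen); split; first by evt.
      move=> l0; move: hl; rewrite l0 => /esym/size0nil ws0; subst ws.
      exists rho'; split=> //; last by rewrite muln0 addn0.
      by rewrite eD cats0.
    rewrite hl; case: ws eD hl hq => // w ws eD hl hq _.
    have uw : (u, w) \in all_pairs.
      have -> : all_pairs = (D ++ pairs_of (u :: t0)) ++ pairs ts by rewrite ap pairs_cons catA.
      by rewrite eD !mem_cat mem_head orbT.
    have l0 : 0 < regs t rlen by rewrite hl.
    have lW : regs t rlen < W.
      have : regs t rlen <= size iw; last by lia.
      rewrite hl -(size_map val (w :: ws)); apply: leq_trans (leq_subr (regs t rq) _).
      by rewrite -size_drop hq size_cat leq_addr.
    have [T h] := read_terminal_ok Rt hu uw l0 lW hq.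
    exists T; apply: (run_conseq h) => t' [rho2 [R2 q2' l2 u2 le]].
    exists (classes rho2 * merge_cost + 85 * size ws); split; last by rewrite /=; lia.
    exists (rcons D' (u, w)), rho2, ws; split=> //.
    - by rewrite cat_rcons.
    - by rewrite l2 hl.
    - by rewrite q2'; have [] := drop_cons 0 hq.
  move=> T h; exists T; apply: (run_conseq h) => t [P [[rho' [Rt -> hq]] ft le]].
  exists rho'; split=> //; first by rewrite (ft.1 rcnt isT).
  by move: le; rewrite /=; lia.
rewrite l3 => /size0nil t0n; subst t0.
apply: run_runx; first by apply: run_skip; apply: erefl.
move=> _ <-; exists rho; split=> //; first by rewrite cats0.
by rewrite /=; lia.
Qed.

Lemma read_terminals_ok st rho : Read st [::] rho ->
  run M read_terminals st (na * merge_cost + 100 * termsize I + 30) (fun st' =>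
    exists rho', Read st' all_pairs rho').
Proof.
move=> R; have sz := size_iw I; have na2 := na_def.
have hNA := envNA (r_env R).
have [qs nq dq] := drop_cons 0 iw_terminals.
have tsz : size (tlist I) <= termsize I.
  by rewrite /termsize; elim: (tlist I) => //= t ts IH; lia.
rewrite /read_terminals; apply: run_bound.
apply: run_seq; apply: run_set; first by evt; rewrite hNA; lia.
rewrite hNA; set s1 := setr _ _ _.
have q1 : regs s1 rq = 2 + na by [].
apply: run_seq; apply: run_set.
  by apply: ev_input; [evt|rewrite q1|rewrite q1 nq; lia].
rewrite q1 nq; set s2 := setr _ _ _.
have q2 : regs s2 rq = 2 + na by [].
apply: run_seq; apply: run_set; first by evt; rewrite q2; lia.
rewrite q2 addn1; set s3 := setr _ _ _.
have f3 : fr [:: rq; rcnt] [::] st s3.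
  split=> // x; rewrite !inE !negb_or => /andP[/negbTE h1 /negbTE h2].
  by rewrite !regs_setr h1 h2.
pose inv P t := exists D rho ts, [/\ Read t D rho, all_pairs = D ++ pairs ts,
   regs t rcnt = size ts, drop (regs t rq) iw = words ts &
   P = classes rho * merge_cost + 100 * sumn [seq (size t).+1 | t <- ts]].
pose Q t := exists rho', Read t all_pairs rho'.
apply: (run_conseq (@run_whileL inv Q _ _ s3 (classes rho * merge_cost + 100 * termsize I) _ _ _)) => //.
- move=> P t ft [D [rho' [ts [Rt ap hc hq ->]]]]; exists (regs t rcnt); split; first by evt.
    move=> c0; move: hc; rewrite c0 => /esym/size0nil ts0; subst ts.
    by exists rho'; rewrite ap cats0.
  rewrite hc; case: ts ap hc hq => // t0 ts ap hc hq _.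
  have c0 : 0 < regs t rcnt by rewrite hc.
  have cW : regs t rcnt < W.
    have le : size (t0 :: ts) <= size (words (t0 :: ts)).
      by rewrite /words; elim: (t0 :: ts) => //= x xs IH; rewrite size_cat; lia.
    have := congr1 size hq; rewrite size_drop hc; lia.
  have [T h] := read_set_ok Rt ap c0 cW hq.
  exists T; apply: (run_conseq h) => t' [rho2 [R2 hq2 hc2 le]].
  exists (classes rho2 * merge_cost + 100 * sumn [seq (size t).+1 | t <- ts]).
  split; last by rewrite /=; lia.
  exists (D ++ pairs_of t0), rho2, ts; split=> //; last by rewrite hc2 hc.
  by rewrite ap pairs_cons catA.
- exists [::], rho, (tlist I); split=> //; exact: Read_fr f3 R isT isT.
- by move=> t [].
have := classes_le rho; move=> cl.
have : classes rho * merge_cost <= na * merge_cost by rewrite leq_mul2r cl orbT.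
by rewrite /=; lia.
Qed.

Definition prep_cost : nat :=
  na * merge_cost + 100 * termsize I + 400 * (n + m) + 100.

Lemma preprocess_ok : run M preprocess init prep_cost (fun st =>
  exists rho, Read st all_pairs rho).
Proof.
have sz := size_iw I; have na2 := na_def.
rewrite /preprocess; apply: run_bound.
apply: run_seq; apply: run_set.
  by apply: ev_input; [apply: ev_cst; lia|lia|rewrite /input_words /=; lia].
apply: run_seq; apply: run_set.
  by apply: ev_input; [apply: ev_cst; lia|lia|rewrite /input_words /=; lia].
set s2 := setr (setr _ _ _) _ _.
have m2 : regs s2 rM = m by [].
apply: run_seq; apply: run_set; first by evt; rewrite m2; lia.
rewrite m2 -na2; set s3 := setr _ _ _.
apply: run_seq; apply: (run_conseq (run_fr W16 _ (build_adjacency_ok (erefl : regs s3 rNA = na) _))) => //.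
move=> s4 [[hH hX] f4].
apply: run_seq; apply: run_set; first by evt.
set s5 := setr _ _ _; have f5 : fr [:: rALL] [::] s4 s5 := fr_setr _ _ _.
have e5 : Env s5.
  split.
  - by rewrite (f5.1 rN isT) (f4.1 rN isT).
  - by rewrite (f5.1 rM isT) (f4.1 rM isT).
  - by rewrite (f5.1 rNA isT) (f4.1 rNA isT).
  - by move=> v; rewrite f5.2.
  - by move=> a; rewrite f5.2.
have fl5 (a : 'I_na) : arr s5 aFL a./2 = 0 by rewrite f5.2 // f4.2.
have mk5 (v : V) : arr s5 aMARK v = 0 by rewrite f5.2 // f4.2.
apply: run_seq.
have fl1 (a : 'I_na) : arr s5 aFL a./2 <= 1 by rewrite fl5.
have ok5 (a : 'I_na) : (arr s5 aFL a./2 + 1 != 0) = (eo a \in G) by rewrite addn1 eoG.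
have comp := @components_ok G (fun=> 0) (subxx _) s5 1 e5 fl1 erefl isT ok5 mk5.
apply: (run_conseq (run_fr W16 _ comp)) => // s6 [[_ _ _ lab6] f6].
have e6 : Env s6 by apply: Env_fr f6 e5 _ _.
have eq6 : eqlab s6 aMARK G.
  move=> u v; rewrite lab6 // -connA0; congr connA; apply/setP=> z; by rewrite !inE.
apply: run_seq; apply: (run_conseq (run_fr W16 _ (init_rep_ok (envN e6)))) => // s7 [rp7 f7].
have R7 : Read s7 [::] id.
  split=> //.
  - by apply: Env_fr f7 e6 _ _.
  - by move=> u v; rewrite !f7.2.
  - by move=> v; rewrite f7.2 // f6.2 // f5.2 // f4.2.
  - by move=> T v _; apply: conn_refl.
  - by rewrite (f7.1 rbad isT) (f6.1 rbad isT) (f5.1 rbad isT) (f4.1 rbad isT).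
exact: read_terminals_ok R7.
by rewrite /prep_cost /=; lia.
Qed.

(** * Minimal Steiner forests *)

Lemma mem_pairs (t : seq V) (v w : V) : t \in tlist I -> v \in t -> w \in t ->
  exists u, (u, v) \in all_pairs /\ (u, w) \in all_pairs.
Proof.
move=> tin; case: t tin => // u t tin vt wt; exists u.
by split; apply/flatten_mapP; exists (u :: t) => //; apply: map_f.
Qed.

Lemma pairs_mem p : p \in all_pairs -> exists t, [/\ t \in tlist I, p.1 \in t & p.2 \in t].
Proof.
move=> /flatten_mapP[[|u t] tin] // /mapP[w wt ->].
by exists (u :: t); rewrite mem_head.
Qed.

(** Terminals belong to the vertex set even when nothing has to be joined, because [joined v v] is
    required too. *)
Lemma steiner_forestP (H : pregraph I) : reflect
  [/\ H.2 \subset G, cover H.2 \subset H.1, TV \subset H.1 & joins H.2 all_pairs]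
  (steiner_forest H).
Proof.
have TVP v : reflect (exists2 t, t \in tlist I & v \in t) (v \in TV).
  rewrite inE; apply: (iffP mapP) => [[p /pairs_mem[t [tin _ pt]] ->]|[t tin vt]].
    by exists t.
  by have [u [uv _]] := mem_pairs tin vt vt; exists (u, v).
apply: (iffP andP) => [[/forall_inP sub /allP term]|[HG cH TH jH]].
  have term' t u v : t \in tlist I -> u \in t -> v \in t -> joined H u v.
    move=> tin ut vt; have := term [set:: t] (map_f _ tin).
    by move=> /forall_inP /(_ u); rewrite inE => /(_ ut) /forall_inP /(_ v); rewrite inE; apply.
  split.
  - by apply/subsetP=> e /sub/andP[]; rewrite G_edges inE.
  - by apply/bigcupsP=> e /sub/andP[].
  - by apply/subsetP=> v /TVP[t tin vt]; have /and3P[] := term' t v v tin vt vt.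
  - by move=> p /pairs_mem[t [tin h1 h2]]; have /and3P[] := term' t p.1 p.2 tin h1 h2.
split.
  apply/forall_inP=> e eH; rewrite (subset_trans _ cH) ?andbT; last exact: bigcup_sup.
  by have := subsetP HG _ eH; rewrite G_edges inE.
apply/allP=> W /mapP[t tin ->]; apply/forall_inP=> u; rewrite inE => ut.
apply/forall_inP=> v; rewrite inE => vt; rewrite /joined.
rewrite (subsetP TH) ?(subsetP TH) /=; try by apply/TVP; exists t.
have [x [xu xv]] := mem_pairs tin ut vt.
have c1 := jH _ xu; have c2 := jH _ xv; rewrite /= connC in c1.
exact: conn_trans c1 c2.
Qed.

Section Forests.
Variable rho : V -> V.
Hypothesis rho_ok : forall T v, joins T all_pairs -> conn T v (rho v).
Hypothesis rho_eq : forall p, p \in all_pairs -> rho p.1 = rho p.2.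

Lemma sat_joins T : sat rho T <-> joins T all_pairs.
Proof.
split=> [sT p pin|jT v]; last exact: rho_ok.
by apply: conn_trans (sT p.1) _; rewrite (rho_eq pin) connC.
Qed.

(** Minimality splits: the vertex set is forced by the edges and the terminals, and what remains is
    minimality of the edge set. *)
Lemma minimal_steinerP (H : pregraph I) :
  minimal_steiner_forest H <-> minT tl hd rho H.2 /\ H.1 = TV :|: cover H.2.
Proof.
split=> [/andP[/steiner_forestP[HG cH TH jH] /forallP min]|[[TG sT mT] H1]].
  have minK (K : pregraph I) : steiner_forest K -> included K H -> K = H.
    by move=> h1 h2; have := min K; rewrite h1 h2 => /eqP.
  (* Discarding all other vertices leaves a Steiner forest, so a minimal one has none. *)
  have HE : (TV :|: cover H.2, H.2) = H.
    apply: minK; last by rewrite /included /= subUset TH cH subxx.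
    by apply/steiner_forestP; split; rewrite /= ?subsetUl ?subsetUr.
  split; last by rewrite -{1}HE.
  split=> //; first exact/sat_joins.
  move=> e eH /sat_joins jD.
  have : (H.1, H.2 :\ e) = H.
    apply: minK; last by rewrite /included /= subxx subD1set.
    apply/steiner_forestP; split=> //=; first exact: subset_trans (subD1set _ _) HG.
    apply: subset_trans cH; apply/bigcupsP=> f; rewrite inE => /andP[_ fH].
    exact: bigcup_sup.
  by move=> /(congr1 snd) /= /setP/(_ e); rewrite !inE eqxx eH.
apply/andP; split.
  apply/steiner_forestP; rewrite H1; split; rewrite ?subsetUl ?subsetUr //.
  exact/sat_joins.
apply/forallP=> K; apply/implyP=> /andP[/steiner_forestP[KG cK TK jK] /andP[s1 s2]].
have K2 : K.2 = H.2.
  apply/eqP; rewrite eqEsubset s2; apply/subsetP=> e eH.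
  apply/negPn/negP=> eK; apply: (mT _ eH) => v.
  by apply: connS (rho_ok v jK); rewrite subsetD1 s2.
have K1 : K.1 = H.1.
  by apply/eqP; rewrite eqEsubset s1 H1 -K2 subUset TK.
by rewrite -pair_eqE /pair_eq K1 K2 !eqxx.
Qed.

End Forests.

(** * Assembling the trace *)

Lemma segments_chunks ss z : all (all silent) ss -> all silent z ->
  segments (chunks ss z) = rcons ss z.
Proof.
have one x t : all silent x ->
    segments (x ++ t) = (x ++ head [::] (segments t)) :: behead (segments t).
  elim: x => [|a x IH] /=; last by case: a => //= [|v] /IH ->.
  by case: t => //= -[].
have zz x : all silent x -> segments x = [:: x].
  by move=> sx; have := one x [::] sx; rewrite cats0.
rewrite /chunks => + sz; elim: ss => [|x ss IH] /=; first by rewrite zz.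
by move=> /andP[sx /IH{}IH]; rewrite -cats1 -!catA one //= IH cats0.
Qed.

Definition fits_time (t : seq action) : Prop :=
  head 0 (gaps t) <= prep_cost + leaf_cost + 20 /\
  all (fun g => g <= 2 * leaf_cost + 30) (behead (gaps t)).

Lemma steiner_enum_ok : exists t st,
  [/\ exec M steiner_enum init t st, enumerates I t & fits_time t].
Proof.
have [t0 [st0 [ex0 q0 le0 [w0 [[rho R] f0]]]]] := run_fr W16 (isT : okp preprocess) preprocess_ok.
have [e mk rp tm rho_ok good bad] := R.
have evb : ev M st0 (Reg rbad) (regs st0 rbad) by [].
have [b0|bn] := eqVneq (regs st0 rbad) 0; last first.
  (* Infeasible instance: the run is one segment without output, and no Steiner forest exists since
     its edges would join the terminals within [G]. *)
  set t := t0 ++ rcons (ticks (Reg rbad)) Tick ++ [:: Tick].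
  have st_ : all silent t by rewrite /t all_cat q0.
  have seg : segments t = [:: t] := @segments_chunks [::] t isT st_.
  exists t, st0; split.
  - by apply: ExecSeq ex0 _; apply: ExecIf evb _; rewrite bn; apply: ExecSkip.
  - rewrite /enumerates /outputs seg /=; split.
      by rewrite /t puts_cat w0.
    exists [::]; split=> // H; apply/esym/negbTE/negP=> /andP[/steiner_forestP[HG _ _ jH] _].
    by apply: (bad bn) => p pin; apply: connS HG (jH p pin).
  - rewrite /fits_time /gaps seg /= /t size_cat /=; split=> //; lia.
have [jG req] := good b0.
have feas v : conn G v (rho v) := rho_ok G v jG.
set st1 := setr st0 rfnd 1.
have f1 : fr [:: rfnd] [::] st0 st1 := fr_setr _ _ _.
(* The empty stack and the cleared flags come from the zero-initialized state, which the
   preprocessing does not touch there. *)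
have S1 : State_ok rho TV st1 [::].
  split; last exact: reach0.
    split=> //.
    - by apply: Env_fr f1 e _ _.
    - by rewrite (f1.1 rk isT) (f0.1 rk isT).
    - by move=> v; rewrite f1.2 // tm inE.
  by move=> a; rewrite f1.2 // f0.2 // inE.
have [st2 [x [ss [z [ex2 q2 [qz wz] wo [b1 b2 b3]]]]]] :=
  main_loop_ok feas S1 (erefl : regs st1 rfnd = 1) erefl.
have ev1 : ev M st0 (Cst 1) 1 by apply: ev_cst; lia.
set pre := t0 ++ rcons (ticks (Reg rbad)) Tick ++ rcons (ticks (Cst 1)) Tick.
have spre : all silent pre by rewrite /pre all_cat q0.
have wpre : puts pre = [::] by rewrite /pre puts_cat w0.
have zpre : size pre = size t0 + 4 by rewrite /pre size_cat.
set t := chunks ((pre ++ x) :: ss) z.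
have seg : segments t = rcons ((pre ++ x) :: ss) z.
  apply: segments_chunks => //; move: q2 => /= /andP[qx qs].
  by rewrite all_cat spre qx qs.
exists t, st2; split.
- have -> : t = t0 ++ rcons (ticks (Reg rbad)) Tick ++
      (rcons (ticks (Cst 1)) Tick ++ chunks (x :: ss) z).
    by rewrite /t /chunks /= /pre -!cats1 -!catA.
  apply: ExecSeq ex0 _; apply: ExecIf evb _; rewrite b0 /=.
  exact: (ExecSeq (ExecSet rfnd ev1) ex2).
- rewrite /enumerates /outputs seg; split; first by rewrite last_rcons.
  pose Hs := [seq (vset TV s, es tl hd s) : pregraph I | s <- sols tl hd rho [::]].
  have HsE : map snd Hs = map (es tl hd) (sols tl hd rho [::]).
    by rewrite /Hs -map_comp.
  exists Hs; split.
  + apply: (@map_uniq _ _ snd); rewrite HsE.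
    exact: (sols_uniq rho (@arc_inj I) (@arc_rev I)).
  + have root T := sols_root rho (@arc_rev I) T.
    move=> H; apply/idP/idP.
      move=> /mapP[s sin ->]; apply/(minimal_steinerP rho_ok req); split=> //=.
      by apply/root; apply: map_f.
    move=> /(minimal_steinerP rho_ok req)[/root/mapP[s sin h2] h1].
    apply/mapP; exists s => //; case: H h1 h2 => H1 H2 /= -> ->.
    by [].
  + have key : map puts ((pre ++ x) :: ss) = map (outw TV) (sols tl hd rho [::]).
      by move: wo; rewrite cats0 => <-; rewrite /= puts_cat wpre.
    rewrite size_rcons succnK -cats1 take_size_cat // key /Hs.
    by elim: (sols _ _ _ _) => //= s l ->; rewrite perm_refl.
- rewrite /fits_time /gaps seg /=; split; first by rewrite size_cat zpre; lia.
  rewrite map_rcons all_rcons; apply/andP; split; first by lia.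
  by rewrite all_map; apply: sub_all b3 => y /=; lia.
Qed.

End Machine.

(** * Constants *)

(** Since [minn n m * n] and [minn n m * m] are at most [nm], [leaf_cost] is at most [9000 * nm I]:
    3000 from the rounds, 6000 from the rest. Twice this plus 30 stays below 20000 times [nm I]. *)
Lemma cost_bounds (I : instance) :
  prep_cost I + leaf_cost I + 20 <= 200 * 100 * (nm I + termsize I) /\
  2 * leaf_cost I + 30 <= 200 * 100 * nm I.
Proof.
rewrite /prep_cost /merge_cost /leaf_cost /unit_cost /narcs /nm.
set n := nv I; set m := ne I; set T := termsize I.
set p := maxn 1 n * maxn 1 m.
have n1 : n <= p by apply: leq_trans (leq_maxr 1 n) (leq_pmulr _ _); rewrite leq_maxl.
have m1 : m <= p by apply: leq_trans (leq_maxr 1 m) (leq_pmull _ _); rewrite leq_maxl.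
have p1 : 0 < p by rewrite muln_gt0 !leq_maxl.
have nmp : n * m <= p by rewrite leq_mul ?leq_maxr.
have h : minn n m * (n + m + 1) <= 3 * p.
  rewrite !mulnDr muln1.
  have h1 : minn n m * n <= n * m by rewrite mulnC leq_mul2l geq_minr orbT.
  have h2 : minn n m * m <= n * m by rewrite leq_mul2r geq_minl orbT.
  have h3 : minn n m <= n by apply: geq_minl.
  lia.
have e1 : (minn n m + 2) * (1000 * (n + m + 1)) =
    1000 * (minn n m * (n + m + 1)) + 2000 * (n + m + 1).
  by rewrite mulnDl mulnCA; lia.
have e2 : m.*2 * (n * 40 + 40) = 80 * (n * m) + 80 * m by lia.
rewrite e1 e2; clearbody p; lia.
Qed.

Lemma word_bounds (I : instance) c : 32 <= c ->
  let W := 2 ^ (c * logsize I) in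
  16 %| W /\ 64 * (nv I + ne I + termsize I + 4) <= W.
Proof.
move=> c32 W; rewrite {}/W /logsize; set N := nv I + ne I + termsize I.
set l := trunc_log 2 N.
have lN : N < 2 ^ l.+1 by apply: trunc_log_ltn.
split; first by rewrite (_ : 16 = 2 ^ 4) // dvdn_exp2l // mulnS; lia.
(* Of the exponent, [l + 1] bits hold [n + m + termsize] and ten more the constant factor. *)
have -> : c * l.+1 = l.+1 + (10 + (c.-1 * l.+1 - 10)).
  have : 31 <= c.-1 by lia.
  by case: c c32 => // c _ /= h; rewrite mulSn mulnS; lia.
rewrite expnD; apply: (@leq_trans (N.+1 * 2 ^ 10)); first by rewrite (_ : 2 ^ 10 = 1024) //; lia.
by apply: leq_mul => //; rewrite leq_exp2l // leq_addr.
Qed.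

Theorem theorem5p3 :
  exists (p : program) (c : nat), forall I : instance,
    exists (t : seq action) (st : state),
      [/\ exec (Machine (c * logsize I) (c * (nv I + ne I)) (input_words I))
               p init t st,
          enumerates I t,
          head 0 (gaps t) <= c * (nm I + termsize I)
        & all (fun g => g <= c * nm I) (behead (gaps t))].
Proof.
exists steiner_enum, (200 * 100) => I.
have [b1 b2] := cost_bounds I.
have [w16 wbig] := @word_bounds I (200 * 100) isT.
set M := Machine _ _ _.
(* Sixteen arrays of [2 * (n + m)] cells each: the longest index is an arc. *)
have cells : 2 * (nv I + ne I) * 16 <= mcells M.
  by rewrite /= mulnAC leq_mul2r; apply/orP; right.
have [t [st [ex en [g1 g2]]]] := @steiner_enum_ok I M erefl w16 cells wbig.
exists t, st; split=> //; first exact: leq_trans g1 b1.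
by apply: sub_all g2 => g le; apply: leq_trans le b2.
Qed.
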